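(* Let $A$ be a strongly graded connected $S$-ring which admits a bimodule of relations that is projective as a left $S$-module. Let $R$ be a graded $S$-subbimodule of $T_A$ generating the ideal $I_A$. Assume that $A^1$ and $R$ are projective as left $S$-modules. (1) If $P$ is an $S$-subbimodule of $T_A$ such that $R\subseteq R_P$, then $U(P)$ is a PBW-deformation of $A$ if and only if the ideals generated by $R$ and $R_P$ coincide, $\mathrm H_1({}^1M_* )=0$ and either $c(A)=-1$ or $P$ satisfies the Jacobi conditions $(\mathcal J_n)$ for $1\le n\le c(A)$, where $({}^1M_*,\delta_* )$ corresponds to the central extension $D:=T_A[z]/\langle P^*\rangle$. (2) Let $\alpha:R\to T_A$ be a map of filtered $S$-bimodules. If $P:=\alpha(R)$ and $R$ is a bimodule of relations for $A$, then $U(P)$ is a PBW-deformation of $A$ if and only if either $c(A)=-1$ or $P$ satisfies $(\mathcal J_n)$ for $1\le n\le c(A)$.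
   Context: $S$ is an associative unital ring, $\otimes=\otimes_S$. A positively graded $S$-ring $A$ is connected if $A^0=S$ and strongly graded if $A^nA^m=A^{n+m}$. $T:=T_A:=T_S(A^1)$ is the tensor $S$-ring, $\pi_A:T_A\to A$ the canonical surjection, $I_A=\ker\pi_A$. A bimodule of relations for $A$ is a graded $S$-subbimodule $R_0\subseteq I_A$ with $I_A=R_0\oplus(A^1I_A+I_AA^1)$ (it then generates $I_A$). $p^n:T\to T^n$ is the projection, $T^{\le n}=\bigoplus_{m\le n}T^m$, $X^{\le n}=X\cap T^{\le n}$, $\langle X\rangle$ the ideal generated by $X$. Shift: $X(d)^n=X^{n+d}$. For an $S$-subbimodule $P\subseteq T$: $R_P:=\bigoplus_np^n(P^{\le n})$; $U(P):=T/\langle P\rangle$, filtered by the images of $T^{\le n}$. When $R\subseteq R_P$ is graded and generates $I_A$, $U(P)$ is a PBW-deformation of $A=T/\langle R\rangle$ if the graded $S$-ring map $\Phi_{P,R}:T/\langle R\rangle\to\operatorname{gr}U(P)$, $x+\langle R\rangle\mapsto(x+\langle P\rangle)+U(P)^{\le n-1}$ ($x\in T^n$), is an isomorphism. A map of filtered $S$-bimodules $\alpha:R\to T$ is an $S$-bimodule map with $\alpha(R^n)\subseteq T^{\le n}$, always assumed to satisfy $p^n\alpha(r)=r$ for $r\in R^n$. $(\mathcal J_n)$: $P_{n+1}\cap T^{\le n}\subseteq P_n$, where $P_n:=\sum_{i+j+k=n}T^{\le i}P^{\le j}T^{\le k}$. Complexity: for a graded $S$-module $V$, $c_V=-1$ if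 $V=0$, else $c_V=\sup\{n-1\mid V^n\ne0\}$. The homological complexity is $c(A):=c_{\operatorname{Tor}_3^A(S,S)}$ (internal grading); if $c(A)=\infty$ all $(\mathcal J_n)$, $n\ge1$, are required. Central extension: $z$ is a central variable of degree $1$; for $a=\sum_{i\le d}a_i$ with $a_i\in T^i$, $a_d\ne0$, $a^*=\sum_ia_iz^{d-i}$ ($0^*=0$); $P^*=\{x^*\mid x\in P\}$. When $\langle R\rangle=\langle R_P\rangle$, $D=T[z]/\langle P^*\rangle$ is connected strongly graded and $D/zD\cong A$; let $\pi:D\to A$ be the projection. Complex ${}^1M_*$: fix a projective resolution $\cdots\to A\otimes V_n\xrightarrow{d_n}\cdots\to A\otimes V_2\xrightarrow{d_2}A\otimes A^1\xrightarrow{d_1}A\xrightarrow{d_0}S\to0$ of the left $A$-module $S$, with $V_n$ graded projective left $S$-modules, $d_n$ graded $A$-linear, $d_0$ the projection, $d_1$ the multiplication, $V_n^i=0$ for $n\ge3$, $i=0,1$, and $c_{V_3}=c(A)$ (such a resolution exists). Put $V_0=S$, $V_1=A^1$, $N_n:=D\otimes V_n$. Choose $\partial_1:N_1\to D$, $\partial_1(x\otimes a)=x\sigma^1(a)$ with $\sigma^1:A^1\to D^1$ a left $S$-linear section of $\pi^1$; graded $D$-linear $\partial_2:N_2\to N_1$ with $(\pi\otimes V_1)\partial_2=d_2(\pi\otimes V_2)$; graded $D$-linear $f_2:N_2\to N_0(-1)$ with $\partial_1\partial_2=-z\cdot f_2$. Then ${}^1M_*$ is $M_2\xrightarrow{\delta_2}M_1\xrightarrow{\delta_1}M_0\to0$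 with $M_0=D$, $M_1=N_1\oplus N_0(-1)$, $M_2=N_2\oplus N_1(-1)$, $\delta_1(x,y)=\partial_1(x)+zy$, $\delta_2(x,y)=(\partial_2(x)-zy,\ \partial_1(y)+f_2(x))$; $\mathrm H_1({}^1M_* )=\ker\delta_1/\operatorname{im}\delta_2$. *)

(* Defs.v *)
From HB Require Import structures.
From mathcomp Require Import all_boot all_order all_algebra.
From mathcomp Require Import generic_quotient ring_quotient.
From mathcomp Require Import boolp classical_sets constructive_ereal.

Set Implicit Arguments.
Unset Strict Implicit.
Unset Printing Implicit Defensive.

Import Order.TTheory GRing.Theory Num.Theory.

Local Open Scope classical_set_scope.
Local Open Scope quotient_scope.
Local Open Scope ring_scope.

Section AdditiveSpan.
Variable V : zmodType.

Inductive zspan (X : set V) : V -> Prop :=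
| zspan_gen x : X x -> zspan X x
| zspan0 : zspan X 0
| zspanB x y : zspan X x -> zspan X y -> zspan X (x - y).

Definition zspanp (X : set V) : {pred V} := fun x => `[< zspan X x >].

Lemma zspanp_closed X : zmod_closed (zspanp X).
Proof.
split; first by apply/asboolP; exact: zspan0.
by move=> x y /asboolP hx /asboolP hy; apply/asboolP; exact: zspanB.
Qed.

HB.instance Definition _ X := GRing.isZmodClosed.Build V (zspanp X)
  (zspanp_closed X).

Record zsub (X : set V) := ZSub { zval : V; zvalP : zval \in zspanp X }.

HB.instance Definition _ X := [isSub for @zval X].
HB.instance Definition _ X := [Choice of zsub X by <:].
HB.instance Definition _ X := [SubChoice_isSubZmodule of zsub X by <:].

End AdditiveSpan.

(* [subquot X Y] is <X> / (<X> n Y); it is only used for subgroups Y <= X. *)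
Definition subquot (V : zmodType) (X Y : set V) : zmodType :=
  Quotient.quot (zspanp [set u : zsub X | Y (val u)]).

Definition subquot_class (V : zmodType) (X Y : set V) (u : zsub X) : subquot X Y :=
  \pi_(subquot X Y) u.

Definition zsub_of (V : zmodType) (X : set V) x (h : X x) : zsub X :=
  ZSub (asboolT (zspan_gen h)).

Section RingQuotient.
Variables (R : pzRingType) (X : set R).

Inductive ideal_gen : R -> Prop :=
| ideal_gen_gen x : X x -> ideal_gen x
| ideal_gen0 : ideal_gen 0
| ideal_genB x y : ideal_gen x -> ideal_gen y -> ideal_gen (x - y)
| ideal_genMl a x : ideal_gen x -> ideal_gen (a * x)
| ideal_genMr a x : ideal_gen x -> ideal_gen (x * a).

Definition ideal_genp : {pred R} := fun x => `[< ideal_gen x >].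

Lemma ideal_genp_closed : zmod_closed ideal_genp.
Proof.
split; first by apply/asboolP; exact: ideal_gen0.
by move=> x y /asboolP hx /asboolP hy; apply/asboolP; exact: ideal_genB.
Qed.

HB.instance Definition _ := GRing.isZmodClosed.Build R ideal_genp
  ideal_genp_closed.

(* R / <X> *)
Definition rquot := Quotient.quot ideal_genp.
HB.instance Definition _ := GRing.Zmodule.on rquot.

Definition rquot_class (x : R) : rquot := \pi_(Quotient.quot ideal_genp) x.

Lemma rquot_eq x y : (rquot_class x = rquot_class y) <-> ideal_gen (x - y).
Proof.
split=> [/eqP|h]; first by rewrite /rquot_class -Quotient.idealrBE => /asboolP.
by apply/eqP; rewrite /rquot_class -Quotient.idealrBE; apply/asboolP.
Qed.

Lemma rquot_ind (Q : rquot -> Prop) : (forall x, Q (rquot_class x)) ->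
  forall u, Q u.
Proof. by move=> h u; rewrite -[u]reprK; apply: h. Qed.

Lemma rquot_classB : zmod_morphism rquot_class.
Proof. by move=> x y; rewrite /rquot_class raddfB. Qed.

HB.instance Definition _ := GRing.isZmodMorphism.Build R rquot rquot_class
  rquot_classB.

Definition rquot_mul (u v : rquot) : rquot := rquot_class (repr u * repr v).

Lemma rquot_mulE x y :
  rquot_mul (rquot_class x) (rquot_class y) = rquot_class (x * y).
Proof.
have hx : ideal_gen (repr (rquot_class x) - x).
  by apply/rquot_eq; rewrite /rquot_class reprK.
have hy : ideal_gen (repr (rquot_class y) - y).
  by apply/rquot_eq; rewrite /rquot_class reprK.
apply/rquot_eq; set a := repr _ in hx *; set b := repr _ in hy *.
have -> : a * b - x * y = (a - x) * b - (0 - x * (b - y)).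
  by rewrite sub0r opprK mulrBl mulrBr addrA subrK.
apply: ideal_genB; first exact: ideal_genMr.
by apply: ideal_genB; [exact: ideal_gen0 | exact: ideal_genMl].
Qed.

Fact rquot_mulA : associative rquot_mul.
Proof.
elim/rquot_ind=> x; elim/rquot_ind=> y; elim/rquot_ind=> z.
by rewrite !rquot_mulE mulrA.
Qed.
Fact rquot_mul1 : left_id (rquot_class 1) rquot_mul.
Proof. by elim/rquot_ind=> x; rewrite rquot_mulE mul1r. Qed.
Fact rquot_mulr1 : right_id (rquot_class 1) rquot_mul.
Proof. by elim/rquot_ind=> x; rewrite rquot_mulE mulr1. Qed.
Fact rquot_mulDl : left_distributive rquot_mul +%R.
Proof.
elim/rquot_ind=> x; elim/rquot_ind=> y; elim/rquot_ind=> z.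
by rewrite -raddfD !rquot_mulE -raddfD mulrDl.
Qed.
Fact rquot_mulDr : right_distributive rquot_mul +%R.
Proof.
elim/rquot_ind=> x; elim/rquot_ind=> y; elim/rquot_ind=> z.
by rewrite -raddfD !rquot_mulE -raddfD mulrDr.
Qed.

HB.instance Definition _ := GRing.Zmodule_isPzRing.Build rquot
  rquot_mulA rquot_mul1 rquot_mulr1 rquot_mulDl rquot_mulDr.

Lemma rquot_class_monoid : monoid_morphism rquot_class.
Proof. by split=> // x y; rewrite -rquot_mulE. Qed.

HB.instance Definition _ := GRing.isMonoidMorphism.Build R rquot rquot_class
  rquot_class_monoid.

End RingQuotient.

Section Modules.

Definition restr (B C : pzRingType) (eta : {rmorphism B -> C})
  (M : lmodType C) : Type := M.

HB.instance Definition _ B C eta M := GRing.Zmodule.on (@restr B C eta M).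

Section RestrTheory.
Variables (B C : pzRingType) (eta : {rmorphism B -> C}) (M : lmodType C).
Let scal (b : B) (x : restr eta M) : restr eta M := eta b *: (x : M).
Fact restr_scaleA a b v : scal a (scal b v) = scal (a * b) v.
Proof. by rewrite /scal scalerA rmorphM. Qed.
Fact restr_scale1 : left_id 1 scal.
Proof. by move=> x; rewrite /scal rmorph1 scale1r. Qed.
Fact restr_scaleDr : right_distributive scal +%R.
Proof. by move=> b x y; rewrite /scal; exact: scalerDr. Qed.
Fact restr_scaleDl v : {morph scal^~ v : a b / a + b}.
Proof. by move=> a b; rewrite /scal rmorphD; exact: scalerDl. Qed.
HB.instance Definition _ := GRing.Zmodule_isLmodule.Build B (restr eta M)
  restr_scaleA restr_scale1 restr_scaleDr restr_scaleDl.
End RestrTheory.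

Definition projective (B : pzRingType) (M : lmodType B) : Prop :=
  forall (X Y : lmodType B) (g : {linear X -> Y}) (f : {linear M -> Y}),
    (forall y, exists x, g x = y) ->
    exists h : {linear M -> X}, forall m, g (h m) = f m.

Record bimod (C B : pzRingType) := Bimod {
  bimod_car :> lmodType C;
  ract : bimod_car -> B -> bimod_car;
  ractDl : forall x y b, ract (x + y) b = ract x b + ract y b;
  ractDr : forall x b b', ract x (b + b') = ract x b + ract x b';
  ract1 : forall x, ract x 1 = x;
  ractM : forall x b b', ract x (b * b') = ract (ract x b) b';
  ractZ : forall c x b, ract (c *: x) b = c *: ract x b }.

(* The ring C as a (C, B)-bimodule, B acting on the right through eta. *)
Section RingBimod.
Variables (B C : pzRingType) (eta : {rmorphism B -> C}).
Let ra (x : C^o) (b : B) : C^o := (x : C) * eta b.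
Fact ring_ractDl x y b : ra (x + y) b = ra x b + ra y b.
Proof. exact: mulrDl. Qed.
Fact ring_ractDr x b b' : ra x (b + b') = ra x b + ra x b'.
Proof. by rewrite /ra rmorphD; exact: mulrDr. Qed.
Fact ring_ract1 x : ra x 1 = x.
Proof. by rewrite /ra rmorph1 mulr1. Qed.
Fact ring_ractM x b b' : ra x (b * b') = ra (ra x b) b'.
Proof. by rewrite /ra rmorphM mulrA. Qed.
Fact ring_ractZ c x b : ra (c *: x) b = c *: ra x b.
Proof. by rewrite /ra /GRing.scale /= mulrA. Qed.
Definition ring_bimod : bimod C B :=
  Bimod ring_ractDl ring_ractDr ring_ract1 ring_ractM ring_ractZ.
End RingBimod.

End Modules.

(* The tensor product of a (C, B)-bimodule M and a left B-module N is the     *)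
(* quotient of the formal sums of pairs by the congruence generated by the    *)
(* bilinearity and balancing relations.                                       *)
Section Tensor.
Variables (C B : pzRingType) (M : bimod C B) (N : lmodType B).

Inductive teq : seq (M * N) -> seq (M * N) -> Prop :=
| teq_refl s : teq s s
| teq_sym s t : teq s t -> teq t s
| teq_trans s t u : teq s t -> teq t u -> teq s u
| teq_cat s s' t t' : teq s s' -> teq t t' -> teq (s ++ t) (s' ++ t')
| teq_catC s t : teq (s ++ t) (t ++ s)
| teq_0 n : teq [:: (0, n)] [::]
| teq_Dl m m' n : teq [:: (m + m', n)] [:: (m, n); (m', n)]
| teq_Dr m n n' : teq [:: (m, n + n')] [:: (m, n); (m, n')]
| teq_bal m b n : teq [:: (ract m b, n)] [:: (m, b *: n)].

Definition teqb (s t : seq (M * N)) : bool := `[< teq s t >].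

Fact teqb_refl : reflexive teqb.
Proof. by move=> s; apply/asboolP; exact: teq_refl. Qed.
Fact teqb_sym : symmetric teqb.
Proof. by move=> s t; apply/asboolP/asboolP; exact: teq_sym. Qed.
Fact teqb_trans : transitive teqb.
Proof.
by move=> s t u /asboolP h /asboolP h'; apply/asboolP; exact: teq_trans h h'.
Qed.

Canonical teq_equiv := EquivRel teqb teqb_refl teqb_sym teqb_trans.

Definition tensor : Type := {eq_quot teq_equiv}.
HB.instance Definition _ := Choice.on tensor.

Definition tsum (s : seq (M * N)) : tensor := \pi_({eq_quot teq_equiv}) s.

Definition tpure (m : M) (n : N) : tensor := tsum [:: (m, n)].

Lemma tsum_eq s t : (tsum s = tsum t) <-> teq s t.
Proof.
by split=> [/eqP|h]; [rewrite eqmodE => /asboolP | apply/eqP; rewrite eqmodE; apply/asboolP].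
Qed.

Lemma tsum_ind (Q : tensor -> Prop) : (forall s, Q (tsum s)) -> forall u, Q u.
Proof. by move=> h u; rewrite -[u]reprK; apply: h. Qed.

Lemma repr_tsum s : teq (repr (tsum s)) s.
Proof. by apply/tsum_eq; rewrite /tsum reprK. Qed.

Definition tadd (u v : tensor) : tensor := tsum (repr u ++ repr v).
Definition topp (u : tensor) : tensor := tsum [seq (- p.1, p.2) | p <- repr u].
Definition tscale (c : C) (u : tensor) : tensor :=
  tsum [seq (c *: p.1, p.2) | p <- repr u].

Lemma taddE s t : tadd (tsum s) (tsum t) = tsum (s ++ t).
Proof. by apply/tsum_eq; apply: teq_cat; exact: repr_tsum. Qed.

Lemma teq_map (f : M -> M) s t : {morph f : x y / x + y} ->
  (forall x b, f (ract x b) = ract (f x) b) -> f 0 = 0 ->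
  teq s t -> teq [seq (f p.1, p.2) | p <- s] [seq (f p.1, p.2) | p <- t].
Proof.
move=> fD fr f0; elim=> {s t} /=.
- by move=> s; exact: teq_refl.
- by move=> s t _; exact: teq_sym.
- by move=> s t u _ + _; exact: teq_trans.
- by move=> s s' t t' _ h _ h'; rewrite !map_cat; exact: teq_cat.
- by move=> s t; rewrite !map_cat; exact: teq_catC.
- by move=> n; rewrite f0; exact: teq_0.
- by move=> m m' n; rewrite fD; exact: teq_Dl.
- by move=> m n n'; exact: teq_Dr.
- by move=> m b n; rewrite fr; exact: teq_bal.
Qed.

Lemma ract0 b : ract (0 : M) b = 0.
Proof. by apply: (addrI (ract 0 b)); rewrite -ractDl !addr0. Qed.

Lemma ractN (x : M) b : ract (- x) b = - ract x b.
Proof. by apply: (addIr (ract x b)); rewrite -ractDl !addNr ract0. Qed.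

Lemma toppE s : topp (tsum s) = tsum [seq (- p.1, p.2) | p <- s].
Proof.
apply/tsum_eq; apply: (teq_map (f := -%R)) (repr_tsum s).
- exact: opprD.
- by move=> x b; rewrite ractN.
- exact: oppr0.
Qed.

Lemma tscaleE c s : tscale c (tsum s) = tsum [seq (c *: p.1, p.2) | p <- s].
Proof.
apply/tsum_eq; apply: (teq_map (f := *:%R c)) (repr_tsum s).
- exact: scalerDr.
- by move=> x b; rewrite ractZ.
- exact: scaler0.
Qed.

Fact taddA : associative tadd.
Proof.
elim/tsum_ind=> s; elim/tsum_ind=> t; elim/tsum_ind=> u.
by rewrite !taddE catA.
Qed.
Fact taddC : commutative tadd.
Proof.
elim/tsum_ind=> s; elim/tsum_ind=> t; rewrite !taddE.
by apply/tsum_eq; exact: teq_catC.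
Qed.
Fact tadd0 : left_id (tsum [::]) tadd.
Proof. by elim/tsum_ind=> s; rewrite taddE. Qed.
Fact taddN : left_inverse (tsum [::]) topp tadd.
Proof.
elim/tsum_ind=> s; rewrite toppE taddE; apply/tsum_eq.
elim: s => [|[m n] s IHs] /=; first exact: teq_refl.
set s' := map _ s in IHs *.
have h1 : teq ((- m, n) :: s' ++ (m, n) :: s) (([:: (- m, n); (m, n)]) ++ (s' ++ s)).
  rewrite (_ : _ :: _ = [:: (- m, n)] ++ (s' ++ [:: (m, n)]) ++ s); last first.
    by rewrite /= -catA.
  rewrite (_ : _ ++ (s' ++ s) = [:: (- m, n)] ++ ([:: (m, n)] ++ s') ++ s) //.
  apply: teq_cat; first exact: teq_refl.
  by apply: teq_cat; [exact: teq_catC | exact: teq_refl].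
apply: teq_trans h1 _; rewrite -[X in teq _ X]/([::] ++ [::]).
apply: teq_cat IHs.
apply: teq_trans (teq_0 n); rewrite -(addNr m).
exact/teq_sym/teq_Dl.
Qed.

HB.instance Definition _ := GRing.isZmodule.Build tensor taddA taddC tadd0 taddN.

Lemma tsum_cat s t : tsum (s ++ t) = tsum s + tsum t.
Proof. by rewrite -taddE. Qed.

Lemma tsum_pure s : tsum s = \sum_(p <- s) tpure p.1 p.2.
Proof.
elim: s => [|p s IHs]; first by rewrite big_nil.
by rewrite big_cons -IHs -tsum_cat; case: p.
Qed.

Lemma tpureDl m m' n : tpure (m + m') n = tpure m n + tpure m' n.
Proof. by rewrite -tsum_cat; apply/tsum_eq; exact: teq_Dl. Qed.
Lemma tpureDr m n n' : tpure m (n + n') = tpure m n + tpure m n'.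
Proof. by rewrite -tsum_cat; apply/tsum_eq; exact: teq_Dr. Qed.
Lemma tpure_bal m b n : tpure (ract m b) n = tpure m (b *: n).
Proof. by apply/tsum_eq; exact: teq_bal. Qed.

Fact tscaleA a b v : tscale a (tscale b v) = tscale (a * b) v.
Proof.
elim/tsum_ind: v => s; rewrite !tscaleE -map_comp; congr tsum.
by apply: eq_map => p /=; rewrite scalerA.
Qed.
Fact tscale1 : left_id 1 tscale.
Proof.
elim/tsum_ind=> s; rewrite tscaleE; congr tsum.
by rewrite -[RHS]map_id; apply: eq_map => -[m n] /=; rewrite scale1r.
Qed.
Fact tscaleDr : right_distributive tscale +%R.
Proof.
move=> c; elim/tsum_ind=> s; elim/tsum_ind=> t.
by rewrite -tsum_cat !tscaleE -tsum_cat map_cat.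
Qed.
Fact tscaleDl v : {morph tscale^~ v : a b / a + b}.
Proof.
move=> a b; elim/tsum_ind: v => s; rewrite !tscaleE !tsum_pure !big_map /=.
rewrite -big_split /=; apply: eq_bigr => p _.
by rewrite scalerDl tpureDl.
Qed.

HB.instance Definition _ := GRing.Zmodule_isLmodule.Build C tensor
  tscaleA tscale1 tscaleDr tscaleDl.

Lemma tpureZ c m n : tpure (c *: m) n = c *: tpure m n.
Proof. by rewrite /GRing.scale /= tscaleE. Qed.

Definition balanced (X : zmodType) (phi : M -> N -> X) : Prop :=
  [/\ forall m m' n, phi (m + m') n = phi m n + phi m' n,
      forall m n n', phi m (n + n') = phi m n + phi m n' &
      forall m b n, phi (ract m b) n = phi m (b *: n)].

Definition tlift (X : zmodType) (phi : M -> N -> X) (h : balanced phi)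
  (u : tensor) : X := \sum_(p <- repr u) phi p.1 p.2.

Section Lift.
Variables (X : zmodType) (phi : M -> N -> X) (h : balanced phi).

Lemma tlift_sum s : tlift h (tsum s) = \sum_(p <- s) phi p.1 p.2.
Proof.
case: (h) => hl hr hb; rewrite /tlift.
suff aux s1 s2 : teq s1 s2 ->
    \sum_(p <- s1) phi p.1 p.2 = \sum_(p <- s2) phi p.1 p.2.
  exact/aux/repr_tsum.
elim=> {s s1 s2} //=.
- by move=> s t u _ -> _ ->.
- by move=> s s' t t' _ e _ e'; rewrite !big_cat e e'.
- by move=> s t; rewrite !big_cat /= addrC.
- move=> n; rewrite big_seq1 big_nil /=; apply: (addrI (phi 0 n)).
  by rewrite -hl !addr0.
- by move=> m m' n; rewrite !big_cons !big_nil /= !addr0 hl.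
- by move=> m n n'; rewrite !big_cons !big_nil /= !addr0 hr.
- by move=> m b n; rewrite !big_seq1 /= hb.
Qed.

Lemma tlift_pure m n : tlift h (tpure m n) = phi m n.
Proof. by rewrite tlift_sum big_seq1. Qed.

Fact tliftB : zmod_morphism (tlift h).
Proof.
have hD : {morph tlift h : u v / u + v}.
  elim/tsum_ind=> s; elim/tsum_ind=> t.
  by rewrite -tsum_cat !tlift_sum big_cat.
move=> u v; apply: (addIr (tlift h v)).
by rewrite -hD !subrK.
Qed.

HB.instance Definition _ := GRing.isZmodMorphism.Build tensor X (tlift h) tliftB.
End Lift.

Lemma tensor_eq (X : zmodType) (f g : {additive tensor -> X}) :
  (forall m n, f (tpure m n) = g (tpure m n)) -> f =1 g.
Proof.
move=> fg; elim/tsum_ind=> s; rewrite tsum_pure !raddf_sum.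
by apply: eq_bigr => p _.
Qed.

Lemma tlift_scale (X : lmodType C) (phi : M -> N -> X) (h : balanced phi) :
  (forall c m n, phi (c *: m) n = c *: phi m n) -> scalable (tlift h).
Proof.
move=> hc c; elim/tsum_ind=> s.
rewrite tsum_pure scaler_sumr (raddf_sum (tlift h)) (raddf_sum (tlift h)).
rewrite scaler_sumr.
by apply: eq_bigr => p _; rewrite -tpureZ /= !tlift_pure hc.
Qed.

End Tensor.

Arguments tpure {C B M N}.

Section TensorMaps.

Fact tensor_map_balanced (C B : pzRingType) (M : bimod C B) (N N' : lmodType B)
  (f : {linear N -> N'}) : balanced (fun (m : M) n => tpure m (f n)).
Proof.
split=> *; first exact: tpureDl.
  by rewrite linearD tpureDr.
by rewrite linearZ tpure_bal.
Qed.

Definition tensor_mapr (C B : pzRingType) (M : bimod C B) (N N' : lmodType B)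
  (f : {linear N -> N'}) : {additive tensor M N -> tensor M N'} :=
  tlift (tensor_map_balanced M f).

Fact tensor_mapl_balanced (C C' B : pzRingType) (M : bimod C B)
  (M' : bimod C' B) (f : {additive M -> M'})
  (hf : forall m b, f (ract m b) = ract (f m) b) (N : lmodType B) :
  balanced (fun m (n : N) => tpure (f m) n).
Proof.
split=> *; first by rewrite raddfD tpureDl.
  exact: tpureDr.
by rewrite hf tpure_bal.
Qed.

Definition tensor_mapl (C C' B : pzRingType) (M : bimod C B) (M' : bimod C' B)
  (f : {additive M -> M'}) (hf : forall m b, f (ract m b) = ract (f m) b)
  (N : lmodType B) : {additive tensor M N -> tensor M' N} :=
  tlift (tensor_mapl_balanced hf N).

End TensorMaps.

Section DirectSum.
Variable M : nat -> zmodType.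

Record dsum := DSum {
  dcomp :> forall n, M n;
  dcompP : exists N, forall n, (N <= n)%N -> dcomp n = 0 }.

HB.instance Definition _ := gen_eqMixin dsum.
HB.instance Definition _ := gen_choiceMixin dsum.

Lemma dsumP (x y : dsum) : (forall n, x n = y n) <-> x = y.
Proof.
split=> [|-> //]; case: x y => [x hx] [y hy] /= e.
have {}e : x = y by exact: functional_extensionality_dep.
by case: _ / e hy => hy; congr DSum; exact: Prop_irrelevance.
Qed.

Fact dsum0_subproof : exists N, forall n, (N <= n)%N -> (0 : M n) = 0.
Proof. by exists 0%N. Qed.
Fact dsumN_subproof (x : dsum) :
  exists N, forall n, (N <= n)%N -> - x n = 0.
Proof. by have [N h] := dcompP x; exists N => n /h ->; rewrite oppr0. Qed.
Fact dsumD_subproof (x y : dsum) :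
  exists N, forall n, (N <= n)%N -> x n + y n = 0.
Proof.
have [N h] := dcompP x; have [N' h'] := dcompP y.
exists (maxn N N') => n; rewrite geq_max => /andP[/h -> /h' ->].
by rewrite addr0.
Qed.

Definition dsum0 := DSum dsum0_subproof.
Definition dsum_opp x := DSum (dsumN_subproof x).
Definition dsum_add x y := DSum (dsumD_subproof x y).

Fact dsum_addA : associative dsum_add.
Proof. by move=> x y z; apply/dsumP => n /=; rewrite addrA. Qed.
Fact dsum_addC : commutative dsum_add.
Proof. by move=> x y; apply/dsumP => n /=; rewrite addrC. Qed.
Fact dsum_add0 : left_id dsum0 dsum_add.
Proof. by move=> x; apply/dsumP => n /=; rewrite add0r. Qed.
Fact dsum_addN : left_inverse dsum0 dsum_opp dsum_add.
Proof. by move=> x; apply/dsumP => n /=; rewrite addNr. Qed.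

HB.instance Definition _ := GRing.isZmodule.Build dsum
  dsum_addA dsum_addC dsum_add0 dsum_addN.

Lemma dcompD (x y : dsum) n : (x + y) n = x n + y n. Proof. by []. Qed.
Lemma dcompN (x : dsum) n : (- x) n = - x n. Proof. by []. Qed.
Lemma dcompE0 n : (0 : dsum) n = 0. Proof. by []. Qed.
Lemma dcomp_sum I (r : seq I) (P : pred I) (F : I -> dsum) n :
  (\sum_(i <- r | P i) F i) n = \sum_(i <- r | P i) F i n.
Proof. by elim/big_rec2: _ => // i y x _ <-. Qed.

Definition din_comp n (x : M n) m : M m :=
  if @eqP _ n m is ReflectT e then ecast k (M k) e x else 0.

Fact din_subproof n (x : M n) :
  exists N, forall m, (N <= m)%N -> din_comp x m = 0.
Proof.
exists n.+1 => m h; rewrite /din_comp; case: eqP => // e; exfalso.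
by move: h; rewrite -e ltnn.
Qed.

Definition din n (x : M n) : dsum := DSum (din_subproof x).

Lemma din_comp_eq n (x : M n) : din_comp x n = x.
Proof. by rewrite /din_comp; case: eqP => // e; rewrite eq_axiomK. Qed.

Lemma din_comp_neq n m (x : M n) : n <> m -> din_comp x m = 0.
Proof. by rewrite /din_comp; case: eqP. Qed.

Lemma din_eq n (x : M n) : din x n = x.
Proof. exact: din_comp_eq. Qed.

Lemma din_neq n m (x : M n) : n <> m -> din x m = 0.
Proof. exact: din_comp_neq. Qed.

Fact dinB n : zmod_morphism (@din n).
Proof.
move=> x y; apply/dsumP => m; rewrite dcompD dcompN.
have [<-|/eqP nm] := eqVneq n m; first by rewrite !din_eq.
by rewrite !din_neq // subr0.
Qed.
HB.instance Definition _ n := GRing.isZmodMorphism.Build (M n) dsum (@din n)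
  (@dinB n).

Definition dbound (x : dsum) : nat := projT1 (cid (dcompP x)).

Lemma dboundP (x : dsum) n : (dbound x <= n)%N -> x n = 0.
Proof. by rewrite /dbound; case: cid => N /= h; exact: h. Qed.

Definition dlift (X : zmodType) (f : forall n, {additive M n -> X})
  (x : dsum) : X := \sum_(n < dbound x) f n (x n).

Lemma dliftE (X : zmodType) (f : forall n, {additive M n -> X})
  (x : dsum) N :
  (forall n, (N <= n)%N -> x n = 0) -> dlift f x = \sum_(n < N) f n (x n).
Proof.
have aux p q (h : (p <= q)%N) : (forall n, (p <= n)%N -> x n = 0) ->
    \sum_(n < q) f n (x n) = \sum_(n < p) f n (x n).
  move=> hp; rewrite -!(big_mkord xpredT (fun n => f n (x n))).
  rewrite (big_cat_nat (leq0n p) h) /= [X in _ + X]big1_seq ?addr0 // => i.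
  by rewrite mem_index_iota => /andP[_ /andP[/hp -> _]]; rewrite raddf0.
move=> hN; rewrite /dlift; have [h|/ltnW h] := leqP (dbound x) N.
  by rewrite (aux _ _ h) // => n; exact: dboundP.
by rewrite (aux _ _ h).
Qed.

Fact dliftB (X : zmodType) (f : forall n, {additive M n -> X}) :
  zmod_morphism (dlift f).
Proof.
move=> x y; set N := maxn (dbound x) (dbound y).
have hx n : (N <= n)%N -> x n = 0.
  by rewrite geq_max => /andP[/dboundP].
have hy n : (N <= n)%N -> y n = 0.
  by rewrite geq_max => /andP[_ /dboundP].
rewrite (dliftE f hx) (dliftE f hy) (@dliftE _ _ (x - y) N).
  by rewrite -sumrB; apply: eq_bigr => i _; rewrite -raddfB.
by move=> n hn; rewrite dcompD dcompN hx ?hy ?subr0.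
Qed.
HB.instance Definition _ X f := GRing.isZmodMorphism.Build dsum X (@dlift X f)
  (@dliftB X f).

Lemma dlift_din (X : zmodType) (f : forall n, {additive M n -> X}) n x :
  dlift f (@din n x) = f n x.
Proof.
rewrite (@dliftE _ _ _ n.+1).
  rewrite (bigD1 ord_max) //= din_comp_eq big1 ?addr0 // => i.
  rewrite -val_eqE /= => /eqP ne; rewrite din_comp_neq ?raddf0 //.
  by move=> e; apply: ne.
by move=> m h; rewrite din_neq // => e; rewrite e ltnn in h.
Qed.

Lemma dsum_din (x : dsum) N : (forall n, (N <= n)%N -> x n = 0) ->
  x = \sum_(n < N) din (x n).
Proof.
move=> h; apply/dsumP => m; rewrite dcomp_sum.
have [hm|hm] := ltnP m N.
  rewrite (bigD1 (Ordinal hm)) //= din_comp_eq big1 ?addr0 // => i.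
  rewrite -val_eqE /= => /eqP ne; rewrite din_comp_neq //.
rewrite h // big1 // => i _; rewrite din_neq // => e.
by move: hm; rewrite -e leqNgt ltn_ord.
Qed.

End DirectSum.

(* The tensor ring T_S(V), the direct sum of the V^{(x) n}, where            *)
(* V^{(x) 0} = S and V^{(x) (n+1)} = V (x) V^{(x) n}.                         *)
Section TensorRing.
Variables (S : nzRingType) (V : bimod S S).

Fixpoint tpow (n : nat) : lmodType S :=
  if n is m.+1 then (tensor V (tpow m) : lmodType S) else (S^o : lmodType S).

Definition tring : Type := dsum tpow.
HB.instance Definition _ := GRing.Zmodule.on tring.

Fact tring_scale_subproof (s : S) (x : tring) :
  exists N, forall n, (N <= n)%N -> s *: x n = 0.
Proof. by have [N h] := dcompP x; exists N => n /h ->; rewrite scaler0. Qed.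

Definition tring_scale s (x : tring) : tring :=
  DSum (tring_scale_subproof s x).

Fact tring_scaleA a b v :
  tring_scale a (tring_scale b v) = tring_scale (a * b) v.
Proof. by apply/dsumP => n /=; rewrite scalerA. Qed.
Fact tring_scale1 : left_id 1 tring_scale.
Proof. by move=> x; apply/dsumP => n /=; rewrite scale1r. Qed.
Fact tring_scaleDr : right_distributive tring_scale +%R.
Proof. by move=> s x y; apply/dsumP => n /=; rewrite scalerDr. Qed.
Fact tring_scaleDl v : {morph tring_scale^~ v : a b / a + b}.
Proof. by move=> a b; apply/dsumP => n /=; rewrite scalerDl. Qed.
HB.instance Definition _ := GRing.Zmodule_isLmodule.Build S tring
  tring_scaleA tring_scale1 tring_scaleDr tring_scaleDl.

Lemma dcompZ s (x : tring) n : (s *: x) n = s *: x n. Proof. by []. Qed.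

Lemma dinZ n s (x : tpow n) : (din (s *: x) : tring) = s *: (din x : tring).
Proof.
apply/dsumP => m; rewrite dcompZ; have [<-|/eqP nm] := eqVneq n m.
  by rewrite !din_eq.
by rewrite !din_neq // scaler0.
Qed.

Definition lmul_comp (v : V) (t : tring) n : tpow n :=
  if n is m.+1 then (tpure v (t m) : tensor V (tpow m)) else 0.

Lemma tpure0 (N : lmodType S) (v : V) : tpure v (0 : N) = 0.
Proof. by apply: (addrI (tpure v 0)); rewrite -tpureDr !addr0. Qed.

Fact lmul_subproof v t : exists N, forall n, (N <= n)%N -> lmul_comp v t n = 0.
Proof.
have [N h] := dcompP t; exists N.+1 => -[//|n] /=.
by rewrite ltnS => /h ->; exact: tpure0.
Qed.

Definition lmul v t : tring := DSum (lmul_subproof v t).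

Lemma lmulDl v v' t : lmul (v + v') t = lmul v t + lmul v' t.
Proof.
by apply/dsumP => -[|n] /=; [exact/esym/addr0 | exact: tpureDl].
Qed.
Lemma lmulDr v t t' : lmul v (t + t') = lmul v t + lmul v t'.
Proof.
by apply/dsumP => -[|n] /=; [exact/esym/addr0 | exact: tpureDr].
Qed.
Lemma lmul_bal v s t : lmul (ract v s) t = lmul v (s *: t).
Proof. by apply/dsumP => -[|n] //=; exact: tpure_bal. Qed.
Lemma lmulZ s v t : lmul (s *: v) t = s *: lmul v t.
Proof.
by apply/dsumP => -[|n] /=; [exact/esym/scaler0 | exact: tpureZ].
Qed.
Fact lmulB v : zmod_morphism (lmul v).
Proof.
move=> x y; apply: (addIr (lmul v y)); rewrite -lmulDr !subrK //.
Qed.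
HB.instance Definition _ v := GRing.isZmodMorphism.Build tring tring (lmul v)
  (lmulB v).

Lemma lmul_din v n (x : tpow n) :
  lmul v (din x) = @din tpow n.+1 (tpure v x : tensor V (tpow n)).
Proof.
apply/dsumP => -[|m].
  by rewrite din_neq.
have [<-|/eqP nm] := eqVneq n m.
  rewrite din_eq; change (tpure v (@din tpow n x n) = tpure v x).
  by rewrite din_eq.
rewrite din_neq; last by move=> [].
change (tpure v (@din tpow n x m) = 0).
by rewrite din_neq // tpure0.
Qed.

(* x |-> x * y on V^{(x) n}: (v (x) x) * y = v (x) (x * y) *)
Section Rmul.
Variable y : tring.

Definition rmul0_fun (s : S^o) : tring := (s : S) *: y.
Fact rmul0_linear : linear rmul0_fun.
Proof. by move=> a s t; rewrite /rmul0_fun scalerDl scalerA. Qed.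
HB.instance Definition _ := GRing.isLinear.Build S S^o tring _ rmul0_fun
  rmul0_linear.
Definition rmul0 : {linear tpow 0 -> tring} := rmul0_fun.

Section Step.
Variables (N : lmodType S) (f : {linear N -> tring}).
Fact rmulS_balanced : balanced (fun (v : V) n => lmul v (f n)).
Proof.
split=> *; first exact: lmulDl.
  by rewrite linearD lmulDr.
by rewrite linearZ lmul_bal.
Qed.
Definition rmulS_fun := tlift rmulS_balanced.
HB.instance Definition _ := GRing.Additive.on rmulS_fun.
Fact rmulS_scalable : scalable rmulS_fun.
Proof. by apply: tlift_scale => c m n; exact: lmulZ. Qed.
HB.instance Definition _ := GRing.isScalable.Build S (tensor V N) tring _
  rmulS_fun rmulS_scalable.
Definition rmulS : {linear tensor V N -> tring} := rmulS_fun.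
End Step.

Fixpoint rmul n : {linear tpow n -> tring} :=
  if n is m.+1 then rmulS (rmul m) else rmul0.

End Rmul.

Definition tring_mul (x y : tring) : tring :=
  dlift (fun n => rmul y n : {additive tpow n -> tring}) x.
Definition tring_one : tring := @din tpow 0 (1 : S).

Lemma rmulS_pure y n v (x : tpow n) :
  rmul y n.+1 (tpure v x) = lmul v (rmul y n x).
Proof. exact: (tlift_pure (rmulS_balanced (rmul y n))). Qed.

Lemma tring_mul_din n (x : tpow n) y : tring_mul (din x) y = rmul y n x.
Proof. by rewrite /tring_mul dlift_din. Qed.

Lemma tring_mulE (x y : tring) N : (forall n, (N <= n)%N -> x n = 0) ->
  tring_mul x y = \sum_(n < N) rmul y n (x n).
Proof. by move=> h; rewrite /tring_mul (dliftE _ h). Qed.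

Fact tring_mulDl : left_distributive tring_mul +%R.
Proof. by move=> x y z; rewrite /tring_mul raddfD. Qed.

Lemma rmulD y z n (x : tpow n) : rmul (y + z) n x = rmul y n x + rmul z n x.
Proof.
elim: n x => [|n IHn] x; first exact: scalerDr.
elim/tsum_ind: x => s; rewrite tsum_pure !raddf_sum -big_split /=.
by apply: eq_bigr => p _; rewrite !rmulS_pure IHn lmulDr.
Qed.

Fact tring_mulDr : right_distributive tring_mul +%R.
Proof.
move=> x y z; rewrite !(tring_mulE _ (@dboundP _ x)) -big_split /=.
by apply: eq_bigr => n _; rewrite rmulD.
Qed.

Lemma tring_mulZ s (x y : tring) : tring_mul (s *: x) y = s *: tring_mul x y.
Proof.
have h n : (dbound x <= n)%N -> (s *: x) n = 0.
  by move=> /dboundP e; rewrite dcompZ e scaler0.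
rewrite (tring_mulE _ h) (tring_mulE _ (@dboundP _ x)) scaler_sumr.
by apply: eq_bigr => n _; rewrite dcompZ linearZ.
Qed.

Lemma tring_mul_lmul v t z : tring_mul (lmul v t) z = lmul v (tring_mul t z).
Proof.
have h n : ((dbound t).+1 <= n)%N -> lmul v t n = 0.
  by case: n => // n; rewrite ltnS => /dboundP /= ->; exact: tpure0.
rewrite (tring_mulE _ h) (tring_mulE _ (@dboundP _ t)) raddf_sum.
rewrite big_ord_recl raddf0 add0r; apply: eq_bigr => n _.
exact: rmulS_pure.
Qed.

Lemma rmul_mul y z n (x : tpow n) :
  tring_mul (rmul y n x) z = rmul (tring_mul y z) n x.
Proof.
elim: n x => [|n IHn] x; first exact: tring_mulZ.
elim/tsum_ind: x => s; rewrite tsum_pure !raddf_sum.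
rewrite {1}/tring_mul raddf_sum; apply: eq_bigr => p _.
have e w := rmulS_pure w p.1 (p.2 : tpow n).
rewrite [RHS]e -IHn -tring_mul_lmul; congr (tring_mul _ z); exact: e.
Qed.

Fact tring_mulA : associative tring_mul.
Proof.
move=> x y z; rewrite [in RHS](tring_mulE y (@dboundP _ x)).
rewrite (tring_mulE _ (@dboundP _ x)) [RHS]/tring_mul raddf_sum.
by apply: eq_bigr => n _; exact/esym/rmul_mul.
Qed.
Fact tring_mul1 : left_id tring_one tring_mul.
Proof. by move=> y; rewrite tring_mul_din; exact: scale1r. Qed.
Lemma rmul1 n (x : tpow n) : rmul tring_one n x = din x.
Proof.
elim: n x => [|n IHn] x.
  rewrite [LHS](_ : _ = (x : S) *: tring_one) // /tring_one -dinZ.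
  by rewrite /GRing.scale /= mulr1.
elim/tsum_ind: x => s; rewrite tsum_pure !raddf_sum.
apply: eq_bigr => p _; rewrite -[RHS]lmul_din -IHn; exact: rmulS_pure.
Qed.
Fact tring_mulr1 : right_id tring_one tring_mul.
Proof.
move=> x; rewrite (tring_mulE _ (@dboundP _ x)) [RHS](dsum_din (@dboundP _ x)).
by apply: eq_bigr => n _; rewrite rmul1.
Qed.
Fact tring_one_neq0 : tring_one != 0.
Proof.
apply/eqP => /dsumP /(_ 0%N); rewrite din_eq => /eqP; apply/negP.
exact: oner_neq0.
Qed.

HB.instance Definition _ := GRing.Zmodule_isNzRing.Build tring
  tring_mulA tring_mul1 tring_mulr1 tring_mulDl tring_mulDr tring_one_neq0.

Definition tring_eta (s : S) : tring := @din tpow 0 s.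

Fact tring_etaB : zmod_morphism tring_eta.
Proof. exact: (@dinB tpow 0). Qed.
Lemma tring_etaZ s x : tring_eta s * x = s *: x.
Proof. exact: tring_mul_din. Qed.
Fact tring_eta_monoid : monoid_morphism tring_eta.
Proof.
split=> // s t; rewrite tring_etaZ /tring_eta -dinZ; congr (@din tpow 0 _).
Qed.
HB.instance Definition _ := GRing.isZmodMorphism.Build S tring tring_eta
  tring_etaB.
HB.instance Definition _ := GRing.isMonoidMorphism.Build S tring tring_eta
  tring_eta_monoid.

(* T^n, T^{<= n} and p^n *)
Definition tdeg (n : nat) : set tring :=
  [set x | forall m, m <> n -> x m = 0].
Definition tle (n : nat) : set tring :=
  [set x | forall m, (n < m)%N -> x m = 0].
Definition tproj (n : nat) (x : tring) : tring := din (x n).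

End TensorRing.

Arguments tdeg {S} V n.
Arguments tle {S} V n.

Section Graded.

Definition is_grading (V : zmodType) (g : nat -> set V) : Prop :=
  [/\ forall n, g n 0 /\ (forall x y, g n x -> g n y -> g n (x - y)),
      forall x, exists N (f : nat -> V),
        (forall n, g n (f n)) /\ x = \sum_(i < N) f i &
      forall N (f : nat -> V), (forall n, g n (f n)) ->
        \sum_(i < N) f i = 0 -> forall i, (i < N)%N -> f i = 0].

Definition deg_in0 (V : zmodType) : nat -> set V :=
  fun n => if n is 0 then setT else [set 0].
Definition deg_in1 (V : zmodType) : nat -> set V :=
  fun n => if n is 1 then setT else [set 0].

(* the grading of V(-1) *)
Definition deg_shift (V : zmodType) (g : nat -> set V) : nat -> set V :=
  fun n => if n is m.+1 then g m else [set 0].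

Definition graded_map (V W : zmodType) (g : nat -> set V) (h : nat -> set W)
  (f : V -> W) : Prop := forall n x, g n x -> h n (f x).

Record gmod (B : pzRingType) (gB : nat -> set B) := GMod {
  gmod_car :> lmodType B;
  gdeg : nat -> set gmod_car;
  gdegP : is_grading gdeg;
  gdegZ : forall i j b x, gB i b -> gdeg j x -> gdeg (i + j)%N (b *: x) }.

Definition tensor_deg (C B : pzRingType) (M : bimod C B) (N : lmodType B)
  (gM : nat -> set M) (gN : nat -> set N) : nat -> set (tensor M N) :=
  fun k => zspan [set u | exists i j m n,
    [/\ (i + j = k)%N, gM i m, gN j n & u = tpure m n]].

(* c_V = sup {n - 1 | V^n != 0}, with the value -1 for V = 0 *)
Definition complexity (V : zmodType) (g : nat -> set V) : \bar int :=
  supremum (- 1)%:E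
    [set (n%:Z - 1)%:E | n in [set n | exists2 x, g n x & x <> 0]].

Definition homology (X Y Z : zmodType) (f : {additive X -> Y})
  (g : {additive Y -> Z}) : zmodType :=
  subquot [set y | g y = 0] (range f).

Definition homology_deg (X Y Z : zmodType) (f : {additive X -> Y})
  (g : {additive Y -> Z}) (gY : nat -> set Y) : nat -> set (homology f g) :=
  fun n => [set subquot_class (range f) u | u in
    [set u : zsub [set y | g y = 0] | gY n (val u)]].

End Graded.

Arguments deg_in0 : clear implicits.
Arguments deg_in1 : clear implicits.
Arguments gdeg {B gB} g n.

(* Connected positively graded S-rings. The identification A^0 = S is encoded *)
(* by the structure map [eta] together with [eps], the projection of A on A^0 *)
(* followed by the inverse of eta : S -> A^0; [eps] is determined by the      *)
(* other data, and is a ring morphism because A is positively graded.         *)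
Record connected_sring (S : nzRingType) := ConnectedSRing {
  csr_car :> nzRingType;
  eta : {rmorphism S -> csr_car};
  eps : {rmorphism csr_car -> S};
  adeg : nat -> set csr_car;
  adegP : is_grading adeg;
  adegM : forall i j x y, adeg i x -> adeg j y -> adeg (i + j)%N (x * y);
  adeg_eta : forall s, adeg 0 (eta s);
  etaK : cancel eta eps;
  epsK : forall x, adeg 0 x -> eta (eps x) = x;
  eps_pos : forall n x, adeg n.+1 x -> eps x = 0 }.

Arguments eta {S} c.
Arguments eps {S} c.
Arguments adeg {S} c n.

Section ConnectedRing.
Variables (S : nzRingType) (A : connected_sring S).

Definition strongly_graded : Prop :=
  forall n m (x : A), adeg A (n + m) x ->
    zspan [set u | exists a b, [/\ adeg A n a, adeg A m b & u = a * b]] x.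

Definition A_as_S : lmodType S := restr (eta A) A^o.

Definition deg1p : {pred A_as_S} := fun x => `[< adeg A 1 x >].

Fact deg1p_closed : submod_closed deg1p.
Proof.
have [/(_ 1%N)[h0 hB] _ _] := adegP A; split; first exact/asboolP.
move=> s x y /asboolP hx /asboolP hy; apply/asboolP.
have h : adeg A 1 (eta A s * (x : A)) := adegM (adeg_eta A s) hx.
by rewrite -[y]opprK; apply: (hB _ _ h); rewrite -sub0r; exact: (hB _ _ h0).
Qed.
HB.instance Definition _ := GRing.isSubmodClosed.Build S A_as_S deg1p
  deg1p_closed.

Record A1 := A1Of { a1val : A_as_S; _ : a1val \in deg1p }.
HB.instance Definition _ := [isSub for a1val].
HB.instance Definition _ := [Choice of A1 by <:].
HB.instance Definition _ := [SubChoice_isSubLmodule of A1 by <:].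

Definition a1_ring (a : A1) : A := val a.

Fact A1_ract_subproof (a : A1) (s : S) :
  ((a1_ring a * eta A s : A) : A_as_S) \in deg1p.
Proof.
by case: a => a ha; apply/asboolP; exact: (adegM (asboolW ha) (adeg_eta A s)).
Qed.
Definition A1_ract (a : A1) (s : S) : A1 := A1Of (A1_ract_subproof a s).
Fact A1_ractDl x y b : A1_ract (x + y) b = A1_ract x b + A1_ract y b.
Proof. by apply: val_inj; exact: mulrDl. Qed.
Fact A1_ractDr x b b' : A1_ract x (b + b') = A1_ract x b + A1_ract x b'.
Proof. by apply: val_inj; rewrite /= rmorphD; exact: mulrDr. Qed.
Fact A1_ract1 x : A1_ract x 1 = x.
Proof. by apply: val_inj; rewrite /= rmorph1; exact: mulr1. Qed.
Fact A1_ractM x b b' : A1_ract x (b * b') = A1_ract (A1_ract x b) b'.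
Proof. by apply: val_inj; rewrite /= rmorphM; exact: mulrA. Qed.
Fact A1_ractZ c x b : A1_ract (c *: x) b = c *: A1_ract x b.
Proof. by apply: val_inj; exact/esym/mulrA. Qed.
Definition A1_bimod : bimod S S :=
  Bimod A1_ractDl A1_ractDr A1_ract1 A1_ractM A1_ractZ.

Definition TA : nzRingType := tring A1_bimod.

(* pi_A : T_A -> A maps v_1 (x) ... (x) v_n to the product v_1 ... v_n in A. *)
Section PiStep.
Variables (N : lmodType S) (f : {linear N -> A_as_S}).
Fact piS_balanced : balanced (fun (v : A1_bimod) n =>
  a1_ring v * (f n : A) : A_as_S).
Proof.
split=> [v v' n|v n n'|v s n]; first exact: mulrDl.
  by rewrite linearD; exact: mulrDr.
by rewrite linearZ; exact/esym/mulrA.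
Qed.
Definition piS_fun := tlift piS_balanced.
HB.instance Definition _ := GRing.Additive.on piS_fun.
Fact piS_scalable : scalable piS_fun.
Proof. by apply: tlift_scale => c m n; exact/esym/mulrA. Qed.
HB.instance Definition _ := GRing.isScalable.Build S (tensor A1_bimod N) A_as_S
  _ piS_fun piS_scalable.
Definition piS : {linear tensor A1_bimod N -> A_as_S} := piS_fun.
End PiStep.

Definition pi0_fun (s : S^o) : A_as_S := eta A s.
Fact pi0_linear : linear pi0_fun.
Proof. by move=> a s t; rewrite /pi0_fun rmorphD rmorphM. Qed.
HB.instance Definition _ := GRing.isLinear.Build S S^o A_as_S _ pi0_fun
  pi0_linear.
Definition pi0 : {linear tpow A1_bimod 0 -> A_as_S} := pi0_fun.

Fixpoint pi_pow n : {linear tpow A1_bimod n -> A_as_S} :=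
  if n is m.+1 then piS (pi_pow m) else pi0.

Definition piA (t : TA) : A :=
  dlift (fun n => pi_pow n : {additive tpow A1_bimod n -> A_as_S}) t.

Definition IA : set TA := [set t | piA t = 0].

Record subbimod := SubBimod {
  sb_set :> set TA;
  sb0 : sb_set 0;
  sbB : forall x y, sb_set x -> sb_set y -> sb_set (x - y);
  sbMl : forall s x, sb_set x -> sb_set (tring_eta A1_bimod s * x);
  sbMr : forall s x, sb_set x -> sb_set (x * tring_eta A1_bimod s) }.

Section SubBimodModule.
Variable X : subbimod.
Definition sb_pred : {pred tring A1_bimod} := fun x => `[< sb_set X x >].
Fact sb_pred_closed : submod_closed sb_pred.
Proof.
split; first by apply/asboolP; exact: sb0.
move=> s x y /asboolP hx /asboolP hy; apply/asboolP.
rewrite -[y]opprK; apply: sbB; first by rewrite -tring_etaZ; exact: sbMl.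
by rewrite -sub0r; apply: sbB => //; exact: sb0.
Qed.
HB.instance Definition _ := GRing.isSubmodClosed.Build S (tring A1_bimod)
  sb_pred sb_pred_closed.

Record sb_mod := SBMod { sbval : tring A1_bimod; _ : sbval \in sb_pred }.
HB.instance Definition _ := [isSub for sbval].
HB.instance Definition _ := [Choice of sb_mod by <:].
HB.instance Definition _ := [SubChoice_isSubLmodule of sb_mod by <:].

Fact sb_mod_ract_subproof (x : sb_mod) (s : S) :
  val x * tring_eta A1_bimod s \in sb_pred.
Proof. by case: x => x hx; apply/asboolP; exact: sbMr (asboolW hx). Qed.
Definition sb_mod_ract (x : sb_mod) (s : S) : sb_mod :=
  SBMod (sb_mod_ract_subproof x s).
End SubBimodModule.

Definition graded_sub (X : set TA) : Prop :=
  forall x, X x -> forall n, X (tproj n x).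

Definition IA_decomposable : set TA :=
  zspan [set u | exists v x, [/\ tdeg A1_bimod 1 v, IA x & u = v * x \/ u = x * v]].

Definition relation_bimod (R0 : subbimod) : Prop :=
  [/\ graded_sub R0, R0 `<=` IA,
      forall x, IA x -> exists r y, [/\ sb_set R0 r, IA_decomposable y & x = r + y] &
      forall x, sb_set R0 x -> IA_decomposable x -> x = 0].

(* R_P, i.e. the (+)_n p^n (P^{<= n}) *)
Definition RP (P : set TA) : set TA :=
  [set x | forall n, exists2 y, (P `&` tle A1_bimod n) y &
     tproj n x = tproj n y].

Definition UP (P : set TA) : pzRingType := rquot P.

Definition UP_le (P : set TA) (n : nat) : set (UP P) :=
  [set rquot_class P x | x in tle A1_bimod n].
Arguments UP_le : clear implicits.
Definition UP_lt (P : set TA) (n : nat) : set (UP P) :=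
  if n is m.+1 then UP_le P m else [set 0].

Arguments UP_lt : clear implicits.

Definition grU_piece (P : set TA) (n : nat) : zmodType :=
  subquot (UP_le P n) (UP_lt P n).
Definition grU (P : set TA) : zmodType := dsum (grU_piece P).

(* Phi is determined by its values on homogeneous elements, and these values  *)
(* make it a morphism of graded S-rings: it is an isomorphism of graded       *)
(* S-rings if and only if it is bijective.                                    *)
Definition pbw_deformation (P R : set TA) : Prop :=
  exists Phi : {additive rquot R -> grU P},
    (forall n x, tdeg A1_bimod n x -> forall h : UP_le P n (rquot_class P x),
       Phi (rquot_class R x) =
         @din (grU_piece P) n (subquot_class (UP_lt P n) (zsub_of h))) /\
    bijective Phi.

(* jacobi_sum P n is the bimodule written P_n in the Jacobi conditions. *)
Definition jacobi_sum (P : set TA) (n : nat) : set TA :=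
  zspan [set u | exists i j k a x b,
    [/\ (i + j + k = n)%N, tle A1_bimod i a, (P `&` tle A1_bimod j) x, tle A1_bimod k b &
        u = a * x * b]].

Definition jacobi (P : set TA) (n : nat) : Prop :=
  jacobi_sum P n.+1 `&` tle A1_bimod n `<=` jacobi_sum P n.

Definition S_bimod : bimod S A := ring_bimod (eps A).
Definition S_lmod : lmodType A := restr (eps A) S^o.

Record gresolution := GResolution {
  gres :> nat -> gmod (adeg A);
  gres_proj : forall n, projective (gres n);
  gres_d : forall n, {linear gres n.+1 -> gres n};
  gres_d_deg : forall n,
    graded_map (gdeg (gres n.+1)) (gdeg (gres n)) (gres_d n);
  gres_aug : {linear gres 0 -> S_lmod};
  gres_aug_deg : graded_map (gdeg (gres 0)) (deg_in0 S_lmod) gres_aug;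
  gres_aug_surj : forall s, exists x, gres_aug x = s;
  gres_exact0 : forall x, gres_aug x = 0 <-> exists y, x = gres_d 0 y;
  gres_exactS : forall n x, gres_d n x = 0 <-> exists y, x = gres_d n.+1 y }.

Definition Tor3 (F : gresolution) : zmodType :=
  homology (tensor_mapr S_bimod (gres_d F 3)) (tensor_mapr S_bimod (gres_d F 2)).

Definition Tor3_deg (F : gresolution) : nat -> set (Tor3 F) :=
  homology_deg (tensor_deg (deg_in0 S_bimod) (gdeg (F 3))).

(* c(A), for which any graded projective resolution F of S can be used *)
Definition hcomplexity (F : gresolution) : \bar int :=
  complexity (@Tor3_deg F).

Definition jacobi_upto (P : set TA) (c : \bar int) : Prop :=
  c = (- 1)%:E \/
  forall n : nat, (1 <= n)%N -> (n%:Z%:E <= c)%E -> jacobi P n.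

Definition A_bimod : bimod A S := ring_bimod (eta A).

Fact d1_balanced : balanced (fun (x : A_bimod) (a : A1) => (x : A) * a1_ring a).
Proof.
split=> [x y a|x a b|x s a]; [exact: mulrDl | exact: mulrDr |].
exact/esym/mulrA.
Qed.

Definition res_d1 : {additive tensor A_bimod A1 -> A} := tlift d1_balanced.

Definition gmodS := gmod (deg_in0 S).

Definition AV_deg (V : lmodType S) (g : nat -> set V) :
  nat -> set (tensor A_bimod V) := @tensor_deg _ _ A_bimod V (adeg A) g.

(* The resolutions A (x) V_* of S used for 1M_*; [resV n] is V_{n+2} and      *)
(* [res_d n] is d_{n+3}; V_0 = S and V_1 = A^1.                               *)
Record vresolution (c : \bar int) := VResolution {
  resV : nat -> gmodS;
  resV_proj : forall n, projective (resV n);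
  res_d2 : {linear tensor A_bimod (resV 0) -> tensor A_bimod A1};
  res_d2_deg : graded_map (AV_deg (gdeg (resV 0))) (AV_deg (deg_in1 A1))
    res_d2;
  res_d : forall n,
    {linear tensor A_bimod (resV n.+1) -> tensor A_bimod (resV n)};
  res_d_deg : forall n, graded_map (AV_deg (gdeg (resV n.+1)))
    (AV_deg (gdeg (resV n))) (res_d n);
  res_exact0 : forall x, eps A x = 0 <-> exists u, x = res_d1 u;
  res_exact1 : forall u, res_d1 u = 0 <-> exists v, u = res_d2 v;
  res_exact2 : forall u, res_d2 u = 0 <-> exists v, u = res_d 0 v;
  res_exactS : forall n u, res_d n u = 0 <-> exists v, u = res_d n.+1 v;
  resV_low : forall n i x, (i < 2)%N -> gdeg (resV n.+1) i x -> x = 0;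
  resV3_complexity : complexity (gdeg (resV 1)) = c }.

Section CentralExtension.
Variables (c : \bar int) (Q : vresolution c) (P : set TA).

(* For a in T^{<= d} with a_d <> 0, [star d a] is a^*; [star d 0] = 0. *)
Definition star (d : nat) (a : TA) : {poly TA} :=
  \sum_(i < d.+1) (tproj i a : TA)%:P * 'X^(d - i).

Definition Pstar : set {poly TA} :=
  [set x | exists d a, [/\ P a, tle A1_bimod d a,
     tproj d a <> 0 \/ a = 0 & x = star d a]].

Definition Dring : pzRingType := rquot Pstar.
Definition Dz : Dring := rquot_class Pstar 'X.

Definition D_eta : {rmorphism S -> Dring} :=
  (rquot_class Pstar \o (@polyC TA \o tring_eta A1_bimod))%FUN.

(* In T[z]^n the coefficient of z^i lies in T^{n - i}. *)
Definition Ddeg (n : nat) : set Dring :=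
  [set rquot_class Pstar q | q in [set q : {poly TA} | forall i,
     if (i <= n)%N then tdeg A1_bimod (n - i) q`_i else q`_i = 0]].

Definition D_bimod : bimod Dring S := ring_bimod D_eta.

Definition DV_deg (V : lmodType S) (g : nat -> set V) :
  nat -> set (tensor D_bimod V) := @tensor_deg _ _ D_bimod V Ddeg g.

Section Partial1.
Variable sigma : {linear A1 -> restr D_eta Dring^o}.
Fact par1_balanced :
  balanced (fun (x : D_bimod) (a : A1) => (x : Dring) * sigma a : Dring^o).
Proof.
split=> [x y a|x a b|x s a]; first exact: mulrDl.
  by rewrite linearD; exact: mulrDr.
by rewrite linearZ; exact/esym/mulrA.
Qed.
Definition par1_fun := tlift par1_balanced.
HB.instance Definition _ := GRing.Additive.on par1_fun.
Fact par1_scalable : scalable par1_fun.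
Proof. by apply: tlift_scale => d m n; exact/esym/mulrA. Qed.
HB.instance Definition _ := GRing.isScalable.Build Dring (tensor D_bimod A1)
  Dring^o _ par1_fun par1_scalable.
Definition par1 : {linear tensor D_bimod A1 -> Dring^o} := par1_fun.
End Partial1.

Section PiTensor.
Variables (p : {rmorphism Dring -> A}).
Hypothesis pE : forall q : {poly TA}, p (rquot_class Pstar q) = piA q`_0.
Let p_add : {additive D_bimod -> A_bimod} := (p : {additive Dring -> A}).
Fact pi_ract m b : p_add (ract m b) = ract (p_add m) b.
Proof.
rewrite /= rmorphM; congr (_ * _); rewrite pE coefC eqxx.
exact: (dlift_din (fun n => pi_pow n : {additive tpow A1_bimod n -> A_as_S})).
Qed.
Definition pi_tensor (V : lmodType S) :
  {additive tensor D_bimod V -> tensor A_bimod V} := tensor_mapl pi_ract V.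
End PiTensor.

(* The projection D -> A, which exists only if P^* maps to 0 in A, followed   *)
(* by the choices that determine 1M_*                                         *)
Record central_data := CentralData {
  cd_pi : {rmorphism Dring -> A};
  cd_piE : forall q : {poly TA}, cd_pi (rquot_class Pstar q) = piA q`_0;
  cd_sigma : {linear A1 -> restr D_eta Dring^o};
  cd_sigma_deg : forall a, Ddeg 1 (cd_sigma a);
  cd_sigmaK : forall a, cd_pi (cd_sigma a) = a1_ring a;
  cd_par2 : {linear tensor D_bimod (resV Q 0) -> tensor D_bimod A1};
  cd_par2_deg :
    graded_map (DV_deg (gdeg (resV Q 0))) (DV_deg (deg_in1 A1)) cd_par2;
  cd_par2E : forall x, pi_tensor cd_piE A1 (cd_par2 x) =
    res_d2 Q (pi_tensor cd_piE (resV Q 0) x);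
  cd_f2 : {linear tensor D_bimod (resV Q 0) -> Dring^o};
  cd_f2_deg : graded_map (DV_deg (gdeg (resV Q 0))) (deg_shift Ddeg) cd_f2;
  cd_f2E : forall x, par1 cd_sigma (cd_par2 x) = - (Dz * cd_f2 x) }.

Section OneM.
Variable K : central_data.
Let N1 : lmodType Dring := tensor D_bimod A1.
Let N2 : lmodType Dring := tensor D_bimod (resV Q 0).

Definition delta1_fun (u : N1 * Dring) : Dring :=
  par1 (cd_sigma K) u.1 + Dz * u.2.
Fact delta1B : zmod_morphism delta1_fun.
Proof.
by move=> u v; rewrite /delta1_fun raddfB mulrBr /= opprD addrACA.
Qed.
HB.instance Definition _ := GRing.isZmodMorphism.Build (N1 * Dring)%type Dring
  delta1_fun delta1B.

Definition delta2_fun (u : N2 * N1) : N1 * Dring :=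
  (cd_par2 K u.1 - Dz *: u.2, par1 (cd_sigma K) u.2 + cd_f2 K u.1).
Fact delta2B : zmod_morphism delta2_fun.
Proof.
move=> u v; rewrite /delta2_fun; congr pair => /=.
  by rewrite raddfB scalerBr /= !opprD addrACA.
by rewrite !raddfB /= opprD addrACA.
Qed.
HB.instance Definition _ := GRing.isZmodMorphism.Build (N2 * N1)%type
  (N1 * Dring)%type delta2_fun delta2B.

Definition H1M : zmodType := homology delta2_fun delta1_fun.

End OneM.

End CentralExtension.

End ConnectedRing.

(* Main.v *)
Require Import Defs.
From HB Require Import structures.
From mathcomp Require Import all_boot all_order all_algebra.
From mathcomp Require Import generic_quotient ring_quotient.
From mathcomp Require Import boolp classical_sets constructive_ereal.
From mathcomp Require Import finmap.
From mathcomp Require monalg.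
Import -(notations) monalg.

Set Implicit Arguments.
Unset Strict Implicit.
Unset Printing Implicit Defensive.

Import Defs Order.TTheory GRing.Theory Num.Theory.
Local Open Scope classical_set_scope.
Local Open Scope quotient_scope.
Local Open Scope ring_scope.

(* U(P) is a PBW-deformation iff the leading form of every element of <P> is  *)
(* in <R>, iff <R> = <R_P> and all (J_n) hold, iff <R> = <R_P> and z is       *)
(* regular on D = T[z]/<P^*>. If K = {y | z y = 0} is the annihilator of z,   *)
(* then lifting a syzygy x of d_2 to D, so that its boundary becomes z w,     *)
(* yields an obstruction in K / K A^1, linear in x. When H_1(1M) = 0, all of  *)
(* K / K A^1 arises in this way. The syzygies are generated modulo A_+ in the *)
(* internal degrees of Tor_3, up to c(A) + 1, where (J_n) for n <= c(A) kills *)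
(* the obstruction. Hence K = D_+ K + K A^1, and K = 0 as it is graded.       *)
(*   When R is a bimodule of relations, V_2 = R is a minimal choice, with     *)
(* d_2, partial_2 and f_2 given by Fox derivatives. It need not extend to a   *)
(* resolution computing c(A), so the degrees of its syzygies are bounded by   *)
(* comparison with an arbitrary graded resolution.                            *)

(** Both parts rest on the Rees description of D. The degree n part of T[z] is T^{<=n}, and the
    degree n part of <P^*> becomes P_n ([Pstar_hcomp]), so D^n = T^{<=n}/P_n. Multiplication by z
    from D^n to D^{n+1} is induced by inclusion and has kernel (P_{n+1} cap T^{<=n})/P_n. Thus a
    single (J_n) is injectivity of z on D^n ([Dz_inj_deg]), and all of them together say that z is
    regular ([Dz_regular_jacobi]). On the other side, Phi is bijective iff the leading forms of <P>
    lie in <R> ([pbw_leading]), which amounts to <R> = <R_P> together with all (J_n) ([leading_RP]).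
    What remains is to get the regularity of z from the (J_n) with n <= c(A).

    This is [H1_regular]. Since D/zD = A, a syzygy x of d_2 lifts to some u with partial_2 u = z w,
    and y = partial_1 w + f_2 u is killed by z. Other choices of u and w change y within K A^1,
    because A^1 is projective ([obs0]), and H_1 = 0 says that every y in K arises in this way. If
    the syzygies are generated, modulo A_+ times syzygies, in degrees m + 2 where (J_{m+1}) holds,
    then K = D_+ K + K A^1, and induction on the degree gives K = 0 ([K_Nakayama]).

    In (1) the module V_3 of the given resolution bounds these degrees ([vresolution_gen]), and
    [regular_H1] gives the converse vanishing of H_1. In (2) the data are built from alpha: [d2R],
    [par2R] and [f2R] come from Fox derivatives, H_1 = 0 is proved outright ([range_H1]), and the
    degrees of the syzygies of [d2R] are bounded by comparison with F ([tor_gen]), where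
    [d2R_minimal] supplies minimality. *)

Section Span.
Variable V : zmodType.
Implicit Type X : set V.

Lemma zspanN X x : zspan X x -> zspan X (- x).
Proof. by move=> hx; rewrite -sub0r; apply: zspanB => //; exact: zspan0. Qed.

Lemma zspanD X x y : zspan X x -> zspan X y -> zspan X (x + y).
Proof. by move=> hx hy; rewrite -[y]opprK; apply/zspanB/zspanN. Qed.

Lemma zspan_sum X I (r : seq I) (P : pred I) (F : I -> V) :
  (forall i, P i -> zspan X (F i)) -> zspan X (\sum_(i <- r | P i) F i).
Proof. by move=> h; elim/big_ind: _ => //; [exact: zspan0 | exact: zspanD]. Qed.

Lemma zspan_min X (Q : V -> Prop) : Q 0 ->
  (forall x y, Q x -> Q y -> Q (x - y)) -> (forall x, X x -> Q x) ->
  forall x, zspan X x -> Q x.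
Proof. by move=> h0 hB hX x; elim=> {x} // x y _ hx _ hy; exact: hB. Qed.

Lemma closed_sum (Q : V -> Prop) : Q 0 ->
  (forall x y, Q x -> Q y -> Q (x - y)) ->
  forall I (r : seq I) (P : pred I) (F : I -> V),
  (forall i, P i -> Q (F i)) -> Q (\sum_(i <- r | P i) F i).
Proof.
move=> h0 hB I r P F h; elim/big_ind: _ => // x y hx hy.
by rewrite -[y]opprK; apply: (hB) => //; rewrite -sub0r; exact: hB.
Qed.

Lemma zspan_map (W : zmodType) (f : {additive V -> W}) X (Y : set W) x :
  (forall x, X x -> zspan Y (f x)) -> zspan X x -> zspan Y (f x).
Proof.
move=> h; elim=> {x} //; first by rewrite raddf0; exact: zspan0.
by move=> x y _ hx _ hy; rewrite raddfB; exact: zspanB.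
Qed.

Definition subgroup X := X 0 /\ forall x y, X x -> X y -> X (x - y).

Lemma zspan_subgroup X x : subgroup X -> zspan X x -> X x.
Proof. by case=> h0 hB; exact: (@zspan_min X X). Qed.

End Span.

Section Subquotient.
Variables (V : zmodType) (X Y : set V).
Hypotheses (hX : subgroup X) (hY : subgroup Y).

Lemma zsub_val (u : zsub X) : X (val u).
Proof. by case: u => u /= /asboolP; exact: zspan_subgroup. Qed.

Lemma subquot_eq (u v : zsub X) :
  subquot_class Y u = subquot_class Y v <-> Y (val u - val v).
Proof.
rewrite /subquot_class; split=> [/eqP|h].
  rewrite -Quotient.idealrBE => /asboolP.
  case: hY => h0 hB; rewrite -raddfB; elim=> // [w w'] _ h _ h'.
  by rewrite raddfB; exact: hB.
by apply/eqP; rewrite -Quotient.idealrBE; apply/asboolP; exact: zspan_gen.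
Qed.

Lemma subquot_ind (Q : subquot X Y -> Prop) :
  (forall u, Q (subquot_class Y u)) -> forall q, Q q.
Proof. by move=> h q; rewrite -[q]reprK; exact: h. Qed.

Lemma subquot_classB : zmod_morphism (@subquot_class V X Y).
Proof. by move=> u v; rewrite /subquot_class raddfB. Qed.

Lemma subquot_eq0 (u : zsub X) : subquot_class Y u = 0 <-> Y (val u).
Proof.
have e : subquot_class Y (0 : zsub X) = 0 by rewrite /subquot_class raddf0.
by have := subquot_eq u 0; rewrite e raddf0 addr0.
Qed.

End Subquotient.

Section Homology.
Variables (X Y Z : zmodType) (f : {additive X -> Y}) (g : {additive Y -> Z}).

Lemma subgroup_ker : subgroup [set y | g y = 0].
Proof.
by split=> [|x y /= hx hy]; rewrite /= ?raddf0 // raddfB /= hx hy subrr.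
Qed.

Lemma subgroup_range : subgroup (range f).
Proof.
split=> [|x y [a _ <-] [b _ <-]]; first by exists 0; rewrite ?raddf0.
by exists (a - b); rewrite ?raddfB.
Qed.

Lemma homology_class_eq0 y (hy : g y = 0) :
  (subquot_class (range f) (zsub_of (hy : [set y | g y = 0] y)) : homology f g)
    = 0 <-> exists x, y = f x.
Proof.
have [h1 h2] := subquot_eq0 (X := [set y | g y = 0]) subgroup_range
  (zsub_of (hy : [set y | g y = 0] y)).
split=> [/h1[x _ e]|[x e]]; first by exists x.
by apply: h2; exists x.
Qed.

Lemma homology_eq0 : (forall h : homology f g, h = 0) <->
  forall y, g y = 0 -> exists x, y = f x.
Proof.
split=> [h y hy|h]; first by apply/(homology_class_eq0 hy); exact: h.
elim/subquot_ind=> u; apply/(subquot_eq0 subgroup_range).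
have [x e] := h _ (zsub_val subgroup_ker u).
by exists x.
Qed.

End Homology.

Section IdealGen.
Variables (R : pzRingType) (X : set R).

Lemma ideal_genN x : ideal_gen X x -> ideal_gen X (- x).
Proof. by move=> h; rewrite -sub0r; apply: ideal_genB => //; exact: ideal_gen0. Qed.

Lemma ideal_genD x y : ideal_gen X x -> ideal_gen X y -> ideal_gen X (x + y).
Proof. by move=> h h'; rewrite -[y]opprK; apply/ideal_genB/ideal_genN. Qed.

Lemma ideal_gen_sum I (r : seq I) (P : pred I) (F : I -> R) :
  (forall i, P i -> ideal_gen X (F i)) ->
  ideal_gen X (\sum_(i <- r | P i) F i).
Proof.
by move=> h; elim/big_ind: _ => //; [exact: ideal_gen0 | exact: ideal_genD].
Qed.

Lemma ideal_gen_min (Y : set R) : (forall x, X x -> ideal_gen Y x) ->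
  forall x, ideal_gen X x -> ideal_gen Y x.
Proof.
move=> h x; elim=> {x} //.
- exact: ideal_gen0.
- by move=> x y _ hx _ hy; exact: ideal_genB.
- by move=> a x _ hx; exact: ideal_genMl.
- by move=> a x _ hx; exact: ideal_genMr.
Qed.

Lemma rquot_eq0 x : rquot_class X x = 0 <-> ideal_gen X x.
Proof. by rewrite -(raddf0 (rquot_class X)) rquot_eq subr0. Qed.

End IdealGen.

(** * Tensor products: extension of scalars and right exactness *)

Section TensorTheory.
Variables (C B : pzRingType) (M : bimod C B) (N : lmodType B).

Lemma tensor_ind (Q : tensor M N -> Prop) : Q 0 ->
  (forall x y, Q x -> Q y -> Q (x - y)) -> (forall m n, Q (tpure m n)) ->
  forall u, Q u.
Proof.
move=> h0 hB hp; elim/tsum_ind=> s; rewrite tsum_pure.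
exact: closed_sum.
Qed.

Lemma tpure_sumr (m : M) I (r : seq I) (P : pred I) (F : I -> N) :
  tpure m (\sum_(i <- r | P i) F i) = \sum_(i <- r | P i) tpure m (F i).
Proof.
elim/big_ind2: _ => // [|? x ? y <- <-]; last exact: tpureDr.
by apply: (addrI (tpure m 0)); rewrite -tpureDr !addr0.
Qed.

Lemma tpurer0 (m : M) : tpure m (0 : N) = 0.
Proof. by apply: (addrI (tpure m 0)); rewrite -tpureDr !addr0. Qed.

Lemma tpurel0 (n : N) : tpure (0 : M) n = 0.
Proof. by apply: (addrI (tpure 0 n)); rewrite -tpureDl !addr0. Qed.

Lemma tpureNl (m : M) (n : N) : tpure (- m) n = - tpure m n.
Proof. by apply: (addIr (tpure m n)); rewrite -tpureDl !addNr tpurel0. Qed.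

Lemma tpureBl (m m' : M) (n : N) : tpure (m - m') n = tpure m n - tpure m' n.
Proof. by rewrite tpureDl tpureNl. Qed.

Lemma tpureNr (m : M) (n : N) : tpure m (- n) = - tpure m n.
Proof. by apply: (addIr (tpure m n)); rewrite -tpureDr !addNr tpurer0. Qed.

End TensorTheory.

Lemma tensor_mapl_pure (C C' B : pzRingType) (M : bimod C B) (M' : bimod C' B)
  (f : {additive M -> M'}) (hf : forall m b, f (ract m b) = ract (f m) b)
  (N : lmodType B) m (n : N) :
  tensor_mapl hf N (tpure m n) = tpure (f m) n.
Proof. exact: (tlift_pure (tensor_mapl_balanced hf N)). Qed.

Lemma tensor_mapr_pure (C B : pzRingType) (M : bimod C B) (N N' : lmodType B)
  (f : {linear N -> N'}) (m : M) n :
  tensor_mapr M f (tpure m n) = tpure m (f n).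
Proof. exact: (tlift_pure (tensor_map_balanced M f)). Qed.

Section Extension.
Variables (B C : pzRingType) (eta : {rmorphism B -> C}).
Variables (N : lmodType B) (W : lmodType C) (f : {linear N -> restr eta W}).

Fact tensor_ext_balanced :
  balanced (fun (c : ring_bimod eta) n => (c : C) *: (f n : W)).
Proof.
split=> [c c' n|c n n'|c b n]; first exact: scalerDl.
  by rewrite linearD; exact: scalerDr.
by rewrite linearZ; exact/esym/scalerA.
Qed.
Definition tensor_ext_fun := tlift tensor_ext_balanced.
HB.instance Definition _ := GRing.Additive.on tensor_ext_fun.
Fact tensor_ext_scalable : scalable tensor_ext_fun.
Proof. by apply: tlift_scale => c m n; exact/esym/scalerA. Qed.
HB.instance Definition _ := GRing.isScalable.Build C
  (tensor (ring_bimod eta) N) W _ tensor_ext_fun tensor_ext_scalable.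
(** The universal property of extension of scalars. The maps [d2R], [par2R], [f2R] and the
    comparison maps into F are all obtained from it. *)
Definition tensor_ext : {linear tensor (ring_bimod eta) N -> W} :=
  tensor_ext_fun.

Lemma tensor_ext_pure (c : C) n :
  tensor_ext (tpure (c : ring_bimod eta) n) = c *: (f n : W).
Proof. exact: (tlift_pure tensor_ext_balanced). Qed.

End Extension.

Section TensorKernel.
Variables (B C C' : pzRingType) (M : bimod C B) (M' : bimod C' B).
Variables (f : {additive M -> M'}).
Hypothesis hf : forall m b, f (ract m b) = ract (f m) b.
Hypothesis f_surj : forall m', exists m, f m = m'.
Variable N : lmodType B.

Let K : set (tensor M N) := [set u | exists m n, f m = 0 /\ u = tpure m n].
Let Q : zmodType := Quotient.quot (zspanp K).
Let cls (u : tensor M N) : Q := \pi_Q u.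
Let cls_eq u v : cls u = cls v <-> zspan K (u - v).
Proof.
split=> [/eqP|h]; first by rewrite /cls -Quotient.idealrBE => /asboolP.
by apply/eqP; rewrite /cls -Quotient.idealrBE; apply/asboolP.
Qed.
Let clsD u v : cls (u + v) = cls u + cls v.
Proof. by rewrite /cls raddfD. Qed.

Let lft (m' : M') : M := projT1 (cid (f_surj m')).
Let lftK m' : f (lft m') = m'.
Proof. by rewrite /lft; case: cid. Qed.

Let cls_pure m1 m2 n : f m1 = f m2 -> cls (tpure m1 n) = cls (tpure m2 n).
Proof.
move=> e; apply/cls_eq/zspan_gen; exists (m1 - m2), n.
by rewrite raddfB e subrr tpureBl.
Qed.

(** The chosen preimages [lft] are not additive, but two preimages of the same element differ by the
    kernel of f, hence agree modulo K. This gives an inverse to the map that f induces on M (x) N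
    modulo K. *)
Let back_balanced : balanced (fun m' n => cls (tpure (lft m') n)).
Proof.
split=> [m m' n|m n n'|m b n].
- by rewrite -clsD -tpureDl; apply: cls_pure; rewrite raddfD /= !lftK.
- by rewrite -clsD -tpureDr.
- by rewrite -tpure_bal; apply: cls_pure; rewrite hf !lftK.
Qed.

Lemma tensor_mapl_ker u : tensor_mapl hf N u = 0 ->
  zspan [set u | exists m n, f m = 0 /\ u = tpure m n] u.
Proof.
move=> hu; rewrite -[u]subr0; apply/cls_eq.
suff h v : cls v = tlift back_balanced (tensor_mapl hf N v).
  by rewrite h hu raddf0 /cls raddf0.
elim/tensor_ind: v => [|x y hx hy|m n].
- by rewrite /cls !raddf0.
- have -> : cls (x - y) = cls x - cls y by rewrite /cls raddfB.
  by rewrite hx hy !raddfB.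
- by rewrite tensor_mapl_pure tlift_pure; apply: cls_pure; rewrite lftK.
Qed.

Lemma tensor_mapl_surj v : exists u, tensor_mapl hf N u = v.
Proof.
elim/tensor_ind: v => [|x y [u <-] [v <-]|m n].
- by exists 0; rewrite raddf0.
- by exists (u - v); rewrite raddfB.
- have [m' <-] := f_surj m; exists (tpure m' n).
  exact: tensor_mapl_pure.
Qed.

End TensorKernel.

(** * Projective modules: controlled lifts and dual bases *)

Section ProjectiveLift.
Variables (B : pzRingType) (M X Y : lmodType B).
Variables (g : {linear X -> Y}) (f : {linear M -> Y}) (U : set X).
Hypotheses (U0 : U 0) (UL : forall b x y, U x -> U y -> U (b *: x + y)).

Definition pullbackp : {pred X * M} :=
  fun p => `[< U p.1 /\ g p.1 = f p.2 >].
Fact pullbackp_closed : submod_closed pullbackp.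
Proof.
split; first by apply/asboolP; rewrite /= !raddf0.
move=> b p q /asboolP[hp ep] /asboolP[hq eq]; apply/asboolP; split=> /=.
  exact: UL.
by rewrite !linearP ep eq.
Qed.
HB.instance Definition _ := GRing.isSubmodClosed.Build B (X * M)%type
  pullbackp pullbackp_closed.
Record pullback := Pullback { pbval : X * M; _ : pbval \in pullbackp }.
HB.instance Definition _ := [isSub for pbval].
HB.instance Definition _ := [Choice of pullback by <:].
HB.instance Definition _ := [SubChoice_isSubLmodule of pullback by <:].

(** A section of the projection from the fibre product of U and M over Y is a lift with values in U.
    Taking for U a homogeneous component yields graded lifts. *)
Lemma projective_lift : projective M ->
  (forall m, exists2 x, U x & g x = f m) ->
  exists h : {linear M -> X}, forall m, U (h m) /\ g (h m) = f m.
Proof.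
move=> pM hs.
pose snd' : {linear pullback -> M} := (snd \o val)%FUN.
pose fst' : {linear pullback -> X} := (fst \o val)%FUN.
have sur m : exists x, snd' x = m.
  have [x hx e] := hs m.
  have h : (x, m) \in pullbackp by apply/asboolP.
  by exists (Pullback h).
have [h hh] := pM pullback M snd' idfun sur.
exists (fst' \o h)%FUN => m /=.
have := hh m; rewrite /snd' /=; case: (h m) => -[x m'] /= /asboolP[/= h1 h2] e.
by rewrite e in h2.
Qed.

End ProjectiveLift.

Section DualBasis.
Variables (S : nzRingType) (M : lmodType S).

(** The free S-module on the underlying set of M; [fval] evaluates a formal combination in M. *)
Let free := malg M S.
Let fval (g : free) : M :=
  \sum_(k <- enum_fset (msupp g)) mcoeff k g *: k.

Let fvalE (g : free) (s : seq M) : uniq s ->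
  (forall k, k \notin s -> mcoeff k g = 0) ->
  fval g = \sum_(k <- s) mcoeff k g *: k.
Proof.
move=> us hs; rewrite /fval.
rewrite [RHS](bigID (fun k => k \in msupp g)) /= [X in _ + X]big1.
  rewrite addr0 -[RHS]big_filter; apply: perm_big; apply: uniq_perm.
  - exact: fset_uniq.
  - exact: filter_uniq.
  move=> k; rewrite mem_filter; case: (boolP (k \in msupp g)) => hk.
    apply/esym/negPn/negP => /hs /eqP.
    by rewrite mcoeff_eq0 => /negP; apply.
  by apply/negbTE.
by move=> k /mcoeff_outdom ->; rewrite scale0r.
Qed.

Let fval_linear : linear fval.
Proof.
move=> a g h.
pose s := undup ((msupp g : seq M) ++ (msupp h : seq M)).
have us : uniq s by exact: undup_uniq.
have hs (x : free) k : {subset (msupp x : seq M) <= s} ->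
    k \notin s -> mcoeff k x = 0.
  move=> sub hk; apply: mcoeff_outdom; apply: contra hk; exact: sub.
have sg : {subset (msupp g : seq M) <= s}.
  by move=> k hk; rewrite mem_undup mem_cat hk.
have sh : {subset (msupp h : seq M) <= s}.
  by move=> k hk; rewrite mem_undup mem_cat hk orbT.
rewrite !(fvalE us) => [|k hk|k hk|k hk].
- rewrite scaler_sumr -big_split /=; apply: eq_bigr => k _.
  by rewrite mcoeffD mcoeffZ scalerDl scalerA.
- exact: hs hk.
- exact: hs hk.
- by rewrite mcoeffD mcoeffZ !(hs _ k) // mulr0 addr0.
Qed.

Let fval_surj m : exists g, fval g = m.
Proof.
exists (mkmalgU m (1 : S)); rewrite (@fvalE _ [:: m]) //.
  by rewrite big_seq1 mcoeffUU scale1r.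
move=> k; rewrite inE eq_sym => /negbTE hk.
by rewrite mcoeffU hk.
Qed.

(** The coordinates of a linear section of the evaluation map from the free module on M. The
    expansion is claimed over every duplicate-free list containing the support, so that the lists of
    several elements can be merged. *)
Lemma dual_basis : projective M ->
  exists phi : M -> {linear M -> S^o}, forall m, exists s : seq M,
    forall t, uniq t -> {subset s <= t} -> m = \sum_(k <- t) phi k m *: k.
Proof.
move=> pM.
pose L := GRing.isLinear.Build S free M _ fval fval_linear.
pose fv : {linear free -> M} := HB.pack fval L.
have [h hh] := pM free M fv idfun fval_surj.
have lin k : linear (fun m => mcoeff k (h m) : S^o).
  by move=> a x y; rewrite linearP mcoeffD mcoeffZ.
pose phi k : {linear M -> S^o} := HB.pack (fun m => mcoeff k (h m) : S^o)
  (GRing.isLinear.Build S M S^o _ _ (lin k)).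
exists phi => m; exists (msupp (h m) : seq M) => t ut st.
rewrite -[LHS](hh m) [LHS](fvalE ut) // => k hk.
by apply: mcoeff_outdom; apply: contra hk; exact: st.
Qed.

End DualBasis.

(* z acts coordinatewise with respect to a dual basis of M. *)
Lemma projective_torsion (S : nzRingType) (C : pzRingType)
  (eta : {rmorphism S -> C}) (M : lmodType S) (z : C)
  (x : tensor (ring_bimod eta) M) :
  projective M -> z *: x = 0 ->
  zspan [set u | exists c m, z * c = 0 /\
     u = tpure (c : ring_bimod eta) m] x.
Proof.
move=> /dual_basis[phi hphi] zx.
pose phi' k : M -> restr eta C^o := fun m => eta (phi k m).
have lin k : linear (phi' k).
  move=> a m m'; rewrite /phi' linearP rmorphD rmorphM.
  by [].
pose psi k : {linear M -> restr eta C^o} := HB.pack (phi' k)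
  (GRing.isLinear.Build S M (restr eta C^o) _ _ (lin k)).
(* The dual basis expansion of M, extended to C (x) M: on a pure tensor the coefficients phi_k(m)
   move across the tensor sign. *)
have hx : exists s : seq M, forall t, uniq t -> {subset s <= t} ->
    x = \sum_(k <- t) tpure (tensor_ext (psi k) x : ring_bimod eta) k.
  elim/tensor_ind: x {zx} => [|x y [s hs] [s' hs']|c m].
  - exists [::] => t _ _; rewrite big1 // => k _; rewrite raddf0.
    exact: tpurel0.
  - exists (s ++ s') => t ut st.
    have sx : {subset s <= t} by move=> k hk; apply: st; rewrite mem_cat hk.
    have sy : {subset s' <= t}.
      by move=> k hk; apply: st; rewrite mem_cat hk orbT.
    have ex := hs t ut sx; have ey := hs' t ut sy.
    rewrite [in LHS]ex [in LHS]ey -sumrB; apply: eq_bigr => k _.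
    by rewrite raddfB tpureBl.
  - have [s hs] := hphi m; exists s => t ut st.
    rewrite {1}(hs t ut st) tpure_sumr; apply: eq_bigr => k _.
    by rewrite -tpure_bal tensor_ext_pure.
have [s hs] := hx; rewrite (hs _ (undup_uniq s)); last first.
  by move=> k; rewrite mem_undup.
apply: zspan_sum => k _; apply: zspan_gen; exists (tensor_ext (psi k) x), k.
(* Each coordinate is C-linear in x, so z x = 0 forces z to kill it. *)
split=> //; have := linearZZ (tensor_ext (psi k)) z x.
by rewrite zx raddf0 => /esym.
Qed.

(** * The tensor ring: components, filtration and augmentation *)

Section TensorRingTheory.
Variables (S : nzRingType) (V : bimod S S).
Notation T := (tring V).
Implicit Types x y : T.

Definition vin (v : V) : T := lmul v 1.

Lemma lmulE v x : lmul v x = vin v * x.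
Proof. by rewrite /vin -[RHS]/(tring_mul _ _) tring_mul_lmul tring_mul1. Qed.

Lemma tring_ind (Q : T -> Prop) : Q 0 ->
  (forall x y, Q x -> Q y -> Q (x - y)) -> (forall s, Q (tring_eta V s)) ->
  (forall v x, Q x -> Q (lmul v x)) -> forall x, Q x.
Proof.
move=> h0 hB hs hv x; have [N hN] := dcompP x; rewrite (dsum_din hN).
apply: closed_sum => // i _; move: (x i); move: (i : nat) => n.
elim: n => [|n IHn] y; first exact: hs.
elim/tensor_ind: y => [|u w hu hw|v y]; first by rewrite raddf0.
  by rewrite raddfB; exact: hB.
by rewrite -[din _]lmul_din; exact: hv.
Qed.

Fact tproj_is_zmod n : zmod_morphism (@tproj S V n).
Proof. by move=> x y; rewrite /tproj dcompD dcompN raddfB. Qed.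
HB.instance Definition _ n := GRing.isZmodMorphism.Build T T (@tproj S V n)
  (tproj_is_zmod n).

Lemma tprojZ n s x : tproj n (s *: x) = s *: tproj n x.
Proof. by rewrite /tproj dcompZ dinZ. Qed.

Lemma tdeg_tproj n x : tdeg V n (tproj n x).
Proof. by move=> m hm; rewrite /tproj din_neq // => e; apply: hm. Qed.

Lemma tproj_eq0 n x : tproj n x = 0 <-> x n = 0.
Proof.
split=> [/dsumP/(_ n)|e]; first by rewrite din_eq.
by rewrite /tproj e; exact: raddf0.
Qed.

Lemma tproj_id n x : tdeg V n x -> tproj n x = x.
Proof.
move=> hx; apply/dsumP => m; have [<-|/eqP nm] := eqVneq n m.
  by rewrite din_eq.
by rewrite din_neq // hx // => e; apply: nm.
Qed.

Lemma tproj_tdeg n m x : tdeg V m x -> n <> m -> tproj n x = 0.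
Proof. by move=> hx nm; apply/tproj_eq0/hx. Qed.

Lemma tproj_tproj n m x : tproj n (tproj m x) = if n == m then tproj n x else 0.
Proof.
case: eqVneq => [->|/eqP nm]; first exact/tproj_id/tdeg_tproj.
exact: (tproj_tdeg (@tdeg_tproj m x) nm).
Qed.

Lemma tle_tproj n x : tle V n x <-> forall m, (n < m)%N -> tproj m x = 0.
Proof. by split=> h m /h /tproj_eq0. Qed.

Lemma tle_sum n x : tle V n x -> x = \sum_(i < n.+1) tproj i x.
Proof. by move=> hx; apply: dsum_din => m hm; exact: hx. Qed.

Lemma tle_ex x : exists n, tle V n x.
Proof. by have [N hN] := dcompP x; exists N => m /ltnW; exact: hN. Qed.

Lemma tle_le m n x : (m <= n)%N -> tle V m x -> tle V n x.
Proof. by move=> mn hx k nk; apply: hx; exact: leq_ltn_trans nk. Qed.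

Lemma tdeg_tle n x : tdeg V n x -> tle V n x.
Proof. by move=> hx m nm; apply: hx => e; rewrite e ltnn in nm. Qed.

Lemma tle_subgroup n : subgroup (tle V n).
Proof.
split=> [m _ //|x y hx hy m nm].
by rewrite dcompD dcompN hx // hy // subrr.
Qed.

Lemma tdeg_subgroup n : subgroup (tdeg V n).
Proof.
split=> [m _ //|x y hx hy m nm].
by rewrite dcompD dcompN hx // hy // subrr.
Qed.

Lemma tproj_eta n s : tproj n (tring_eta V s) = if n is 0 then tring_eta V s else 0.
Proof.
case: n => [|n]; first by rewrite /tproj din_eq.
by apply/tproj_eq0; rewrite din_neq.
Qed.

Lemma tproj_lmul n v x :
  tproj n (lmul v x) = if n is m.+1 then lmul v (tproj m x) else 0.
Proof.
case: n => [|n]; first exact/tproj_eq0.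
by rewrite [RHS]lmul_din.
Qed.

Lemma tprojM n x y :
  tproj n (x * y) = \sum_(i < n.+1) tproj i x * tproj (n - i) y.
Proof.
elim/tring_ind: x n => [|x z hx hz|s|v x hx] n.
- rewrite mul0r raddf0 big1 // => i _; rewrite raddf0 mul0r //.
- rewrite mulrBl raddfB /= hx hz -sumrB; apply: eq_bigr => i _.
  by rewrite raddfB mulrBl.
- rewrite big_ord_recl [X in _ + X]big1 ?addr0 => [|i _].
    by rewrite tproj_eta !tring_etaZ tprojZ subn0.
  by rewrite tproj_eta mul0r.
- have e t : lmul v x * t = lmul v (x * t) by rewrite !lmulE mulrA.
  rewrite e tproj_lmul big_ord_recl tproj_lmul mul0r add0r.
  case: n => [|n]; first by rewrite big_ord0.
  rewrite hx raddf_sum /=; apply: eq_bigr => i _.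
  by rewrite /bump /= add1n tproj_lmul subSS !lmulE mulrA.
Qed.

Lemma tleM i j x y : tle V i x -> tle V j y -> tle V (i + j) (x * y).
Proof.
move=> /tle_tproj hx /tle_tproj hy; apply/tle_tproj => m hm.
rewrite tprojM big1 // => k _; have [hk|hk] := ltnP i k.
  by rewrite hx // mul0r.
by rewrite (hy (m - k)%N) ?mulr0 // ltn_subRL (leq_ltn_trans _ hm) // leq_add2r.
Qed.

Lemma tdegM i j x y : tdeg V i x -> tdeg V j y -> tdeg V (i + j) (x * y).
Proof.
move=> hx hy m hm; apply/tproj_eq0; rewrite tprojM big1 // => k _.
have [ki|/eqP ki] := eqVneq (k : nat) i; last by rewrite (tproj_tdeg hx) ?mul0r.
rewrite [X in _ * X](tproj_tdeg hy) ?mulr0 // => e; apply: hm.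
by rewrite -e -ki subnKC // -ltnS ltn_ord.
Qed.

Lemma tprojM_top i j x y : tle V i x -> tle V j y ->
  tproj (i + j) (x * y) = tproj i x * tproj j y.
Proof.
move=> /tle_tproj hx /tle_tproj hy; rewrite tprojM.
have hi : (i < (i + j).+1)%N by rewrite ltnS leq_addr.
rewrite (bigD1 (Ordinal hi)) //= addKn big1 ?addr0 // => k.
rewrite -val_eqE /= neq_ltn => /orP[hk|hk]; last by rewrite hx ?mul0r.
rewrite [X in _ * X]hy ?mulr0 // ltn_subRL ltn_add2r //.
Qed.

Definition eps0 x : S := x 0%N.

Lemma eta_eps0 x : tring_eta V (eps0 x) = tproj 0 x.
Proof. by []. Qed.

Lemma tring_eta_inj : injective (tring_eta V).
Proof. by move=> s t /dsumP/(_ 0%N); rewrite !din_eq. Qed.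

Fact eps0_is_zmod : zmod_morphism eps0.
Proof. by move=> x y; rewrite /eps0 dcompD dcompN. Qed.
HB.instance Definition _ := GRing.isZmodMorphism.Build T S eps0 eps0_is_zmod.
Fact eps0_is_monoid : monoid_morphism eps0.
Proof.
split; first by rewrite /eps0 din_eq.
move=> x y; apply: tring_eta_inj; rewrite rmorphM !eta_eps0 tprojM.
by rewrite big_ord_recl big_ord0 addr0.
Qed.
HB.instance Definition _ := GRing.isMonoidMorphism.Build T S eps0 eps0_is_monoid.

Lemma eps0_eta s : eps0 (tring_eta V s) = s.
Proof. by apply: tring_eta_inj; rewrite eta_eps0 tproj_eta. Qed.

Lemma eps0_vin v : eps0 (vin v) = 0.
Proof. by []. Qed.

Lemma tdeg_eta s : tdeg V 0 (tring_eta V s).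
Proof. by move=> m hm; apply/tproj_eq0; rewrite tproj_eta; case: m hm. Qed.

Lemma tdeg0 x : tdeg V 0 x -> x = tring_eta V (eps0 x).
Proof. by move=> hx; rewrite eta_eps0 tproj_id. Qed.

Lemma tdeg_vin v : tdeg V 1 (vin v).
Proof.
move=> m hm; apply/tproj_eq0; rewrite tproj_lmul.
case: m hm => [|[|m]] // _; rewrite (_ : tproj m.+1 1 = 0) ?lmulE ?mulr0 //.
by rewrite -(rmorph1 (tring_eta V)) tproj_eta.
Qed.

Lemma vin_ract v s : vin (ract v s) = vin v * tring_eta V s.
Proof. by rewrite /vin lmul_bal -lmulE -tring_etaZ mulr1. Qed.

Lemma vinZ s v : vin (s *: v) = tring_eta V s * vin v.
Proof. by rewrite /vin lmulZ -tring_etaZ. Qed.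

Lemma tdeg1 x : tdeg V 1 x -> exists v, x = vin v.
Proof.
move=> hx; rewrite -(tproj_id hx) /tproj {hx}; move: (x 1%N); elim/tensor_ind.
- exists 0; rewrite raddf0; apply: (addrI (vin 0)).
  by rewrite addr0 -[RHS]lmulDl addr0.
- move=> u w [v e] [v' e']; exists (v - v').
  rewrite raddfB /= e e'; apply: (addIr (vin v')); rewrite subrK.
  by rewrite -[RHS]lmulDl subrK.
- move=> v s; exists (ract v (s : S)); rewrite vin_ract -lmulE.
  exact/esym/lmul_din.
Qed.

End TensorRingTheory.

(** * The canonical surjection T -> A and its kernel *)

Section PiA.
Variables (S : nzRingType) (A : connected_sring S).
Notation T := (TA A).
Notation V := (A1_bimod A).

Fact piA_is_zmod : zmod_morphism (@piA S A).
Proof. exact: dliftB. Qed.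
HB.instance Definition _ := GRing.isZmodMorphism.Build T A (@piA S A)
  piA_is_zmod.

Lemma piA_eta s : piA (tring_eta V s : T) = eta A s.
Proof.
exact: (dlift_din (fun n => pi_pow A n : {additive tpow V n -> A_as_S A})).
Qed.

Lemma piA_lmul (v : V) (x : T) : piA (lmul v x : T) = a1_ring v * piA x.
Proof.
have [N hN] := dcompP x.
rewrite [in LHS](dsum_din hN) [in RHS](dsum_din hN) !raddf_sum mulr_sumr.
apply: eq_bigr => i _ /=; rewrite lmul_din /piA.
rewrite (dlift_din (fun n => pi_pow A n : {additive tpow V n -> A_as_S A})).
rewrite (dlift_din (fun n => pi_pow A n : {additive tpow V n -> A_as_S A})).
exact: (tlift_pure (piS_balanced (pi_pow A i))).
Qed.

Fact piA_is_monoid : monoid_morphism (@piA S A).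
Proof.
split=> [|x y]; first by rewrite -(rmorph1 (tring_eta V)) piA_eta rmorph1.
elim/tring_ind: x => [|x z hx hz|s|v x hx].
- by rewrite mul0r raddf0 mul0r.
- by rewrite mulrBl !raddfB /= hx hz mulrBl.
- elim/tring_ind: y => [|x z hx hz|t|v y hy].
  + by rewrite mulr0 raddf0 mulr0.
  + by rewrite mulrBr !raddfB /= hx hz mulrBr.
  + by rewrite -rmorphM !piA_eta rmorphM.
  + have -> : tring_eta V s * lmul v y = lmul (s *: v) y.
      by rewrite tring_etaZ lmulZ.
    by rewrite !piA_lmul piA_eta mulrA.
- have -> : lmul v x * y = lmul v (x * y) by rewrite !lmulE mulrA.
  by rewrite !piA_lmul hx mulrA.
Qed.
HB.instance Definition _ := GRing.isMonoidMorphism.Build T A (@piA S A)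
  piA_is_monoid.

Lemma piA_vin (v : V) : piA (vin v : T) = a1_ring v.
Proof. by rewrite piA_lmul rmorph1 mulr1. Qed.

Lemma adeg_subgroup n : subgroup (adeg A n).
Proof. by case: (adegP A) => h _ _; exact: h. Qed.

Lemma a1_adeg (v : A1 A) : adeg A 1 (a1_ring v).
Proof. by case: v => v hv; exact: (asboolW hv). Qed.

Lemma piA_tdeg n (x : T) : tdeg V n x -> adeg A n (piA x).
Proof.
move=> hx; rewrite -(tproj_id hx) {hx}.
elim/tring_ind: x n => [|x z hx hz|s|v x hx] n.
- by rewrite !raddf0; case: (adeg_subgroup n).
- by rewrite !raddfB; apply: (adeg_subgroup n).2.
- rewrite tproj_eta; case: n => [|n]; first by rewrite piA_eta; exact: adeg_eta.
  by rewrite raddf0; case: (adeg_subgroup n.+1).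
- rewrite tproj_lmul; case: n => [|n].
    by rewrite raddf0; case: (adeg_subgroup 0).
  by rewrite piA_lmul -add1n; apply: adegM => //; exact: a1_adeg.
Qed.

Lemma piA_surj_deg (A_strong : strongly_graded A) n (a : A) :
  adeg A n a -> exists2 t : T, tdeg V n t & piA t = a.
Proof.
elim: n a => [|n IHn] a ha.
  by exists (tring_eta V (eps A a)); [exact: tdeg_eta | rewrite piA_eta epsK].
have := A_strong 1%N n a ha; elim=> {a ha}.
- move=> _ [a [b [ha /IHn[t ht <-] ->]]].
  have ha' : (a : A_as_S A) \in @deg1p S A by exact: asboolT.
  pose v : A1 A := A1Of ha'.
  exists (lmul (v : V) t); last by rewrite piA_lmul.
  by rewrite lmulE -add1n; apply: tdegM => //; exact: tdeg_vin.
- by exists 0; [case: (tdeg_subgroup V n.+1) | rewrite raddf0].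
- move=> _ _ _ [t ht <-] _ [t' ht' <-]; exists (t - t'); last exact: raddfB.
  exact: (tdeg_subgroup V n.+1).2.
Qed.

Lemma adeg_decomp (a : A) : exists N (f : nat -> A),
  (forall n, adeg A n (f n)) /\ a = \sum_(i < N) f i.
Proof. by case: (adegP A). Qed.

Lemma piA_surj (A_strong : strongly_graded A) (a : A) : exists t : T, piA t = a.
Proof.
have [N [f [hf ->]]] := adeg_decomp a.
elim/big_ind: _ => [|x y [t <-] [t' <-]|i _].
- by exists 0; rewrite raddf0.
- by exists (t + t'); rewrite raddfD.
- by have [t _ <-] := piA_surj_deg A_strong (hf i); exists t.
Qed.

Lemma eps_piA (t : T) : eps A (piA t) = eps0 t.
Proof.
elim/tring_ind: t => [|x z hx hz|s|v x hx].
- by rewrite !raddf0.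
- by rewrite !raddfB /= hx hz.
- by rewrite piA_eta etaK eps0_eta.
- by rewrite piA_lmul rmorphM /= (eps_pos (a1_adeg v)) mul0r.
Qed.

Lemma IA_eps0 (t : T) : IA t -> eps0 t = 0.
Proof. by rewrite -eps_piA => ->; rewrite raddf0. Qed.

(** [piA] preserves degrees and the homogeneous components of A are independent, so the images of
    the components of t vanish one by one. *)
Lemma IA_tproj (t : T) n : IA t -> IA (tproj n t : T).
Proof.
move=> ht; have [N hN] := tle_ex t.
have [_ _ uniq] := adegP A.
have [nN|Nn] := leqP n N; last first.
  by rewrite /IA /= ((tle_tproj N t).1 hN) // raddf0.
apply: (uniq N.+1 (fun i => piA (tproj i t : T))); last by rewrite ltnS.
  by move=> i; apply: piA_tdeg; exact: tdeg_tproj.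
by rewrite -raddf_sum -(tle_sum hN).
Qed.

(** On T^0 = S and T^1 = A^1 the map [piA] is injective, so the relations start in degree 2. *)
Lemma IA_low (t : T) n : IA t -> (n < 2)%N -> tproj n t = 0.
Proof.
move=> ht; case: n => [|[|//]] _.
  by rewrite -eta_eps0 IA_eps0 // raddf0.
have := IA_tproj 1 ht; have [v ->] := tdeg1 (@tdeg_tproj _ _ 1 t).
rewrite /IA /= piA_vin => e; have -> : v = 0 by apply: val_inj.
apply: (addrI (vin (0 : V))); rewrite addr0 -[RHS]addr0 /vin.
by rewrite -[LHS]lmulDl addr0 addr0.
Qed.

End PiA.

(** * Leading forms of <P>, the Jacobi conditions and gr U(P) *)

Section LeadingForms.
Variables (S : nzRingType) (A : connected_sring S).
Notation T := (TA A).
Notation V := (A1_bimod A).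
Variables (P R : subbimod A).

(** The excess n - m is absorbed by the left factor, because T^{<=i} grows with i. *)
Lemma js_le m n x : (m <= n)%N -> jacobi_sum P m x -> jacobi_sum P n x.
Proof.
move=> mn; apply: zspan_min; [exact: zspan0 | exact: zspanB |].
move=> _ [i [j [k [a [y [b [e ha hy hb ->]]]]]]]; apply: zspan_gen.
exists (i + (n - m))%N, j, k, a, y, b; split=> //.
  by rewrite [(i + _ + j)%N]addnAC addnAC e subnKC.
exact: tle_le (leq_addr _ _) ha.
Qed.

Lemma js_mull i n a x : tle V i a -> jacobi_sum P n x ->
  jacobi_sum P (i + n) (a * x).
Proof.
move=> ha; apply: (@zspan_map T T (a \*o idfun)).
move=> _ [i' [j [k [a' [y [b [e ha' hy hb ->]]]]]]]; apply: zspan_gen.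
exists (i + i')%N, j, k, (a * a'), y, b; split=> //.
- by rewrite -e !addnA.
- exact: tleM.
- by rewrite /= !mulrA.
Qed.

Lemma js_mulr i n a x : tle V i a -> jacobi_sum P n x ->
  jacobi_sum P (n + i) (x * a).
Proof.
move=> ha; apply: (@zspan_map T T (a \o* idfun)).
move=> _ [i' [j [k [a' [y [b [e ha' hy hb ->]]]]]]]; apply: zspan_gen.
exists i', j, (k + i)%N, a', y, (b * a); split=> //.
- by rewrite -e !addnA.
- exact: tleM.
- by rewrite /= !mulrA.
Qed.

Lemma js_tle n x : jacobi_sum P n x -> tle V n x.
Proof.
apply: zspan_min; [exact: (tle_subgroup V n).1|exact: (tle_subgroup V n).2|].
move=> _ [i [j [k [a [y [b [<- ha [_ hy] hb ->]]]]]]].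
by apply: tleM => //; exact: tleM.
Qed.

Lemma js_ideal n x : jacobi_sum P n x -> ideal_gen P x.
Proof.
apply: zspan_min; [exact: ideal_gen0|exact: ideal_genB|].
move=> _ [i [j [k [a [y [b [_ _ [hy _] _ ->]]]]]]].
exact/ideal_genMr/ideal_genMl/ideal_gen_gen.
Qed.

Lemma tle1 : tle V 0 (1 : T).
Proof. exact: (tdeg_tle (tdeg_eta V 1)). Qed.

Lemma js_gen n x : sb_set P x -> tle V n x -> jacobi_sum P n x.
Proof.
move=> hx hn; apply: zspan_gen; exists 0%N, n, 0%N, 1, x, 1.
by split=> //; rewrite ?addn0 ?mul1r ?mulr1 //; exact: tle1.
Qed.

Lemma ideal_js x : ideal_gen P x -> exists n, jacobi_sum P n x.
Proof.
elim=> {x} [x hx||x y _ [n hx] _ [m hy]|a x _ [n hx]|a x _ [n hx]].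
- by have [n hn] := tle_ex x; exists n; exact: js_gen.
- by exists 0%N; exact: zspan0.
- exists (maxn n m); apply: zspanB; first exact: js_le (leq_maxl _ _) hx.
  exact: js_le (leq_maxr _ _) hy.
- by have [i ha] := tle_ex a; exists (i + n)%N; exact: js_mull.
- by have [i ha] := tle_ex a; exists (n + i)%N; exact: js_mulr.
Qed.

(** Components of elements of R lift by R <= R_P. The degree n component of a x is the sum of the
    a_i x_{n-i}; if y lies in P_{n-i} with top component x_{n-i}, then a_i y lies in P_n with top
    component a_i x_{n-i}. The induction therefore treats all n at once. *)
Lemma ideal_lift (hR : R `<=` RP P) (t : T) : ideal_gen R t ->
  forall n, exists2 y, jacobi_sum P n y & tproj n y = tproj n t.
Proof.
elim=> {t} [t /hR ht||x y _ hx _ hy|a x _ hx|a x _ hx] n.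
- by have [y [Py hy] ->] := ht n; exists y => //; exact: js_gen.
- by exists 0; [exact: zspan0 | ].
- have [x' hx' ex] := hx n; have [y' hy' ey] := hy n.
  by exists (x' - y'); [exact: zspanB | rewrite !raddfB /= ex ey].
- pose y i := projT1 (cid2 (hx i)).
  have hy i : jacobi_sum P i (y i) by rewrite /y; case: cid2.
  have ey i : tproj i (y i) = tproj i x by rewrite /y; case: cid2.
  exists (\sum_(i < n.+1) tproj i a * y (n - i)%N).
    apply: zspan_sum => i _; have hi : (i <= n)%N by rewrite -ltnS.
    have := js_mull (tdeg_tle (@tdeg_tproj _ V i a)) (hy (n - i)%N).
    by rewrite subnKC.
  rewrite raddf_sum tprojM; apply: eq_bigr => i _ /=.
  have hi : (i <= n)%N by rewrite -ltnS.
  rewrite -{1}(subnKC hi) tprojM_top ?tproj_tproj ?eqxx ?ey //.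
    exact/tdeg_tle/tdeg_tproj.
  exact: js_tle.
- pose y i := projT1 (cid2 (hx i)).
  have hy i : jacobi_sum P i (y i) by rewrite /y; case: cid2.
  have ey i : tproj i (y i) = tproj i x by rewrite /y; case: cid2.
  exists (\sum_(i < n.+1) y i * tproj (n - i)%N a).
    apply: zspan_sum => i _; have hi : (i <= n)%N by rewrite -ltnS.
    have := js_mulr (tdeg_tle (@tdeg_tproj _ V (n - i) a)) (hy i).
    by rewrite subnKC.
  rewrite raddf_sum tprojM; apply: eq_bigr => i _ /=.
  have hi : (i <= n)%N by rewrite -ltnS.
  rewrite -{1}(subnKC hi) tprojM_top ?tproj_tproj ?eqxx ?ey //.
    exact: js_tle.
  exact/tdeg_tle/tdeg_tproj.
Qed.

Lemma RP_lead j x : sb_set P x -> tle V j x -> RP P (tproj j x : T).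
Proof.
move=> Px hx m; rewrite tproj_tproj; case: eqVneq => [->|_].
  by exists x.
by exists 0; [split; [exact: sb0 | exact: (tle_subgroup V m).1] | rewrite raddf0].
Qed.

Lemma js_lead n y : jacobi_sum P n y -> ideal_gen (RP P) (tproj n y : T).
Proof.
elim=> {y} [_ [i [j [k [a [x [b [<- ha [Px hx] hb ->]]]]]]]||x y _ hx _ hy].
- rewrite tprojM_top ?tprojM_top //; last exact: tleM.
  exact/ideal_genMr/ideal_genMl/ideal_gen_gen/RP_lead.
- by rewrite raddf0; exact: ideal_gen0.
- by rewrite raddfB; exact: ideal_genB.
Qed.

Definition leading_in (I : set T) : Prop :=
  forall n y, ideal_gen P y -> tle V n y -> I (tproj n y).

(** The leading form of y lies in <R>, so [ideal_lift] provides an element of P_n with the same one;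
    subtracting it lowers the degree. So P_n is all of <P> in T^{<=n}, which contains (J_n). *)
Lemma leading_js (hR : R `<=` RP P) : leading_in (ideal_gen R) ->
  forall n y, ideal_gen P y -> tle V n y -> jacobi_sum P n y.
Proof.
move=> hl; elim=> [|n IHn] y Py hy.
  have [y' hy' e] := ideal_lift hR (hl _ _ Py hy) 0.
  rewrite tproj_tproj eqxx in e.
  suff -> : y = y' by [].
  have h x : tle V 0 x -> x = tproj 0 x.
    by move=> hx; rewrite {1}(tle_sum hx) big_ord1.
  by rewrite (h y) // -e -h //; exact: js_tle.
have [y' hy' e] := ideal_lift hR (hl _ _ Py hy) n.+1.
rewrite tproj_tproj eqxx in e.
rewrite -[y](subrK y'); apply: zspanD => //.
apply: (js_le (leqnSn n)); apply: IHn.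
  by apply: ideal_genB => //; exact: js_ideal hy'.
apply/tle_tproj => m; rewrite leq_eqVlt => /orP[/eqP <-|hm].
  by rewrite raddfB /= e subrr.
by move: m hm; apply/tle_tproj/(tle_subgroup V _).2 => //; exact: js_tle.
Qed.

Lemma leading_jacobi (hR : R `<=` RP P) : leading_in (ideal_gen R) ->
  forall n, jacobi P n.
Proof. by move=> hl n y [/js_ideal hy hn]; exact: leading_js hn. Qed.

(** <P> is the union of the P_m; an element of P_m lying in T^{<=n} descends to P_n one index at a
    time by (J_{m-1}), ..., (J_n). *)
Lemma jacobi_js : (forall n, jacobi P n) ->
  forall n y, ideal_gen P y -> tle V n y -> jacobi_sum P n y.
Proof.
move=> hJ n y /ideal_js[m]; elim: m => [|m IHm] hm hy; first exact: js_le hm.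
have [nm|mn] := leqP n m; last exact: js_le hm.
by apply: IHm => //; apply: hJ; split=> //; exact: tle_le hy.
Qed.

(** The elements of R_P are sums of leading forms of elements of P, which gives <R_P> <= <R>.
    Conversely the (J_n) place y in P_n, and leading forms of elements of P_n lie in <R_P>. *)
Lemma leading_RP (hR : R `<=` RP P) : leading_in (ideal_gen R) <->
  ideal_gen R = ideal_gen (RP P) /\ forall n, jacobi P n.
Proof.
split=> [hl|[e hJ] n y Py hy]; last by rewrite e; apply/js_lead/jacobi_js.
split; last exact: leading_jacobi.
apply/seteqP; split=> x; apply: ideal_gen_min => {}x hx.
  exact/ideal_gen_gen/hR.
have [N hN] := tle_ex x; rewrite (tle_sum hN); apply: ideal_gen_sum => i _.
by have [y [Py hy] ->] := hx i; apply: hl => //; exact: ideal_gen_gen.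
Qed.

Let clsP : {additive T -> rquot P} := @rquot_class T P.

Lemma UP_le_subgroup n : subgroup (@UP_le S A P n).
Proof.
split; first by exists 0; [exact: (tle_subgroup V n).1 | exact: (raddf0 clsP)].
move=> _ _ [x hx <-] [y hy <-]; exists (x - y).
  exact: (tle_subgroup V n).2.
exact: (raddfB clsP).
Qed.

Lemma UP_lt_subgroup n : subgroup (@UP_lt S A P n).
Proof.
case: n => [|n]; last exact: UP_le_subgroup.
by split=> // x y -> ->; exact: subrr.
Qed.

Lemma UP_lt_tproj n y : tle V n y -> @UP_lt S A P n (clsP (y - tproj n y)).
Proof.
move=> hy; case: n hy => [|n] hy.
  by rewrite {1}(tle_sum hy) big_ord1 subrr; exact: (raddf0 clsP).
exists (y - tproj n.+1 y) => //; apply/tle_tproj => m.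
rewrite raddfB /= tproj_tproj; case: eqVneq => [-> _|nm hm].
  by rewrite subrr.
by rewrite subr0; apply: (tle_tproj _ _).1 hy _ _; rewrite ltn_neqAle eq_sym nm.
Qed.

(** The translation between gr U(P) and leading forms: y vanishes in gr^n only if its top component
    is that of an element of <P>. *)
Lemma UP_lt_ideal n y : tle V n y -> @UP_lt S A P n (clsP y) ->
  exists2 y', ideal_gen P y' & tle V n y' /\ tproj n y' = tproj n y.
Proof.
case: n => [|n] hy; first by move=> /rquot_eq0 h; exists y.
case=> w hw /esym/rquot_eq h; exists (y - w) => //; split.
  by apply: (tle_subgroup V _).2 => //; exact: tle_le (leqnSn n) hw.
by rewrite raddfB /= (_ : tproj n.+1 w = 0) ?subr0 //; exact/tproj_eq0/hw.
Qed.

Lemma grU_class_eq0 n x (h : @UP_le S A P n (rquot_class P x)) :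
  subquot_class (@UP_lt S A P n) (zsub_of h) = 0 <->
  @UP_lt S A P n (rquot_class P x).
Proof. exact: (subquot_eq0 (UP_lt_subgroup n) (zsub_of h)). Qed.

Let hpiece n (x : tpow V n) : @UP_le S A P n (rquot_class P (din x : T)).
Proof.
exists (din x) => // m nm; rewrite din_neq // => e.
by rewrite e ltnn in nm.
Qed.
Let piece n (x : tpow V n) : grU_piece P n :=
  subquot_class (@UP_lt S A P n) (zsub_of (hpiece x)).

Let piece_is_zmod n : zmod_morphism (@piece n).
Proof.
move=> x y; rewrite /piece -subquot_classB; congr subquot_class.
by apply: val_inj; rewrite /= !raddfB.
Qed.
HB.instance Definition _ n := GRing.isZmodMorphism.Build (tpow V n)
  (grU_piece P n) (@piece n) (@piece_is_zmod n).

(** The composite T -> T/<R> -> gr U(P), built on T itself so that it is available before Phi is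
    known to be well defined. *)
Let Psi : {additive T -> grU P} :=
  @dlift (tpow V) (grU P) (fun n => (@din (grU_piece P) n \o @piece n)%FUN).

Let Psi_comp (t : T) n : Psi t n = piece (t n).
Proof.
have [N hN] := dcompP t; rewrite [in LHS](dsum_din hN) raddf_sum dcomp_sum.
have E (i : nat) : Psi (din (t i) : T) = din (piece (t i)).
  exact: (@dlift_din (tpow V) (grU P)
    (fun n => (@din (grU_piece P) n \o @piece n)%FUN)).
under eq_bigr do rewrite E.
have [hn|hn] := ltnP n N; last first.
  rewrite hN // raddf0 big1 // => i _; rewrite din_neq // => e.
  by move: hn; rewrite -e leqNgt ltn_ord.
rewrite (bigD1 (Ordinal hn)) //= din_comp_eq big1 ?addr0 // => i.
by rewrite -val_eqE /= => /eqP ne; rewrite din_comp_neq.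
Qed.

Let Psi_eq0 (t : T) : Psi t = 0 <->
  forall n, @UP_lt S A P n (clsP (tproj n t)).
Proof.
rewrite -dsumP; split=> h n.
  have := Psi_comp t n; rewrite h => e.
  exact: (grU_class_eq0 (hpiece (t n))).1 (esym e).
rewrite Psi_comp; exact: (grU_class_eq0 (hpiece (t n))).2 (h n).
Qed.

(** [Psi] is onto because U(P)^{<=n} is the image of T^{<=n}, and it kills <R> by [ideal_lift]. Its
    kernel consists of the t all of whose components are leading forms from <P>, so injectivity of
    Phi is exactly the condition on leading forms. *)
Lemma pbw_leading (hR : R `<=` RP P) (R_gen : ideal_gen R = @IA S A) :
  pbw_deformation P R <-> leading_in (ideal_gen R).
Proof.
split=> [[Phi [hPhi [Phi' K _]]] n y Py hy|hl].
  apply/rquot_eq0; apply: (can_inj K); rewrite raddf0.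
  have h : @UP_le S A P n (rquot_class P (tproj n y)).
    by exists (tproj n y) => //; exact/tdeg_tle/tdeg_tproj.
  rewrite (hPhi n _ (@tdeg_tproj _ V n y) h).
  suff -> : subquot_class (@UP_lt S A P n) (zsub_of h) = 0 by rewrite raddf0.
  apply/grU_class_eq0; have := UP_lt_tproj hy.
  rewrite raddfB /=; have /rquot_eq0 -> := Py; rewrite sub0r => h'.
  rewrite -[rquot_class P _]opprK -sub0r.
  by apply: (UP_lt_subgroup n).2 => //; exact: (UP_lt_subgroup n).1.
have kill t : ideal_gen R t <-> Psi t = 0.
  rewrite Psi_eq0; split=> [ht n|ht].
    have [y /[dup] /js_tle hy /js_ideal /rquot_eq0 Py e] := ideal_lift hR ht n.
    have := UP_lt_tproj hy; rewrite raddfB /= Py sub0r -e => h'.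
    rewrite -[X in _ X]opprK -sub0r.
    by apply: (UP_lt_subgroup n).2 => //; exact: (UP_lt_subgroup n).1.
  have [N hN] := tle_ex t; rewrite (tle_sum hN); apply: ideal_gen_sum => i _.
  have ti : tle V i (tproj i t) by exact/tdeg_tle/tdeg_tproj.
  have [y Py [hy e]] := UP_lt_ideal ti (ht i).
  by rewrite tproj_tproj eqxx in e; rewrite -e; exact: hl.
pose Phi (u : rquot R) : grU P := Psi (repr u).
have PhiE x : Phi (rquot_class R x) = Psi x.
  apply/eqP; rewrite -subr_eq0 -raddfB; apply/eqP/kill/rquot_eq.
  by rewrite /rquot_class reprK.
have PhiB : zmod_morphism Phi.
  elim/rquot_ind=> x; elim/rquot_ind=> y.
  have -> : rquot_class R x - rquot_class R y = rquot_class R (x - y).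
    by rewrite raddfB.
  by rewrite !PhiE raddfB.
pose Phia : {additive rquot R -> grU P} :=
  HB.pack Phi (GRing.isZmodMorphism.Build (rquot R) (grU P) Phi PhiB).
exists Phia.
split=> /= [n x hx h|].
  rewrite PhiE; apply/dsumP => m; rewrite Psi_comp.
  have [<-|/eqP nm] := eqVneq n m.
    rewrite din_eq /piece; congr subquot_class; apply: val_inj => /=.
    by rewrite -[in RHS](tproj_id hx).
  by rewrite din_neq // hx ?raddf0 // => e; apply: nm.
have inj : injective Phi.
  elim/rquot_ind=> x; elim/rquot_ind=> y; rewrite !PhiE => e.
  by apply/rquot_eq/kill; rewrite raddfB e subrr.
have sur v : exists u, Phi u = v.
  have [N hN] := dcompP v.
  have sp n (w : grU_piece P n) : exists x : tpow V n, piece x = w.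
    elim/subquot_ind: w => w; have [x hx e] := zsub_val (UP_le_subgroup n) w.
    exists (x n); apply/(subquot_eq (UP_lt_subgroup n)) => /=.
    rewrite -e -[din _]/(tproj n x) -opprB -sub0r.
    apply: (UP_lt_subgroup n).2; first exact: (UP_lt_subgroup n).1.
    by rewrite -raddfB; exact: UP_lt_tproj.
  pose x n := projT1 (cid (sp n (v n))).
  have hx n : piece (x n) = v n by rewrite /x; case: cid.
  exists (rquot_class R (\sum_(i < N) (din (x i) : T))); rewrite PhiE.
  rewrite raddf_sum [RHS](dsum_din hN); apply: eq_bigr => i _.
  rewrite -hx; exact: (@dlift_din (tpow V) (grU P)
    (fun n => (@din (grU_piece P) n \o @piece n)%FUN)).
pose Phi' v := projT1 (cid (sur v)).
have K v : Phi (Phi' v) = v by rewrite /Phi'; case: cid.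
by exists Phi' => // u; apply: inj; rewrite K.
Qed.

End LeadingForms.

(** * The central extension D as a Rees ring *)

Section Homogenization.
Variables (S : nzRingType) (A : connected_sring S).
Notation T := (TA A).
Notation V := (A1_bimod A).

(* The degree n component of an element of T[z], dehomogenized at z = 1. *)
Definition hcomp (n : nat) (q : {poly T}) : T :=
  \sum_(i < n.+1) tproj (n - i) q`_i.

Fact hcomp_is_zmod n : zmod_morphism (hcomp n).
Proof.
move=> p q; rewrite -sumrB; apply: eq_bigr => i _.
by rewrite coefB raddfB.
Qed.
HB.instance Definition _ n := GRing.isZmodMorphism.Build {poly T} T (hcomp n)
  (hcomp_is_zmod n).

Fact star_is_zmod d : zmod_morphism (@star S A d).
Proof.
move=> x y; rewrite -sumrB; apply: eq_bigr => i _.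
by rewrite raddfB /= polyCB mulrBl.
Qed.
HB.instance Definition _ d := GRing.isZmodMorphism.Build T {poly T}
  (@star S A d) (star_is_zmod d).

Lemma mulr_monomial (x y : T) k l :
  x%:P * 'X^k * (y%:P * 'X^l) = (x * y)%:P * 'X^(k + l).
Proof.
rewrite mulrA -(mulrA x%:P) -(commr_polyXn y%:P k).
by rewrite mulrA -polyCM -mulrA -exprD.
Qed.

Lemma hpoly_ind (Q : {poly T} -> Prop) : Q 0 ->
  (forall x y, Q x -> Q y -> Q (x - y)) ->
  (forall p t k, tdeg V p t -> Q (t%:P * 'X^k)) -> forall q, Q q.
Proof.
move=> h0 hB hm q; rewrite -[q]coefK poly_def; apply: closed_sum => // i _.
rewrite -mul_polyC; have [n hn] := tle_ex q`_i.
rewrite (tle_sum hn) rmorph_sum mulr_suml; apply: closed_sum => // j _.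
by apply: (hm j); exact: tdeg_tproj.
Qed.

Lemma hcomp_tle n q : tle V n (hcomp n q).
Proof.
apply: closed_sum; [exact: (tle_subgroup V n).1|exact: (tle_subgroup V n).2|].
move=> i _; apply: (tle_le (leq_subr i n)); exact/tdeg_tle/tdeg_tproj.
Qed.

Lemma hcomp_mono n p k t : tdeg V p t ->
  hcomp n (t%:P * 'X^k) = if n == (p + k)%N then t else 0.
Proof.
move=> ht; rewrite /hcomp; case: eqP => [->|hn].
  have hk : (k < (p + k).+1)%N by rewrite ltnS leq_addl.
  rewrite (bigD1 (Ordinal hk)) //= coefMXn ltnn subnn coefC eqxx addnK.
  rewrite tproj_id // big1 ?addr0 // => i.
  rewrite -val_eqE /= coefMXn coefC => hi; case: ltnP => [_|ki].
    by rewrite raddf0.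
  by rewrite subn_eq0 leqNgt ltn_neqAle eq_sym hi ki raddf0.
rewrite big1 // => i _; rewrite coefMXn coefC.
case: ltnP => [_|ki]; first by rewrite raddf0.
case: eqP => [|_]; last by rewrite raddf0.
move=> /eqP; rewrite subn_eq0 => ik; apply: (tproj_tdeg ht) => e; apply: hn.
have -> : k = i by apply/eqP; rewrite eqn_leq ik ki.
by rewrite -e subnK // -ltnS.
Qed.

Lemma star_mono n p t : tdeg V p t -> (p <= n)%N ->
  star n t = t%:P * 'X^(n - p).
Proof.
move=> ht pn; have hp : (p < n.+1)%N by rewrite ltnS.
rewrite /star (bigD1 (Ordinal hp)) //= tproj_id // big1 ?addr0 // => i.
by rewrite -val_eqE /= => /eqP hi; rewrite (tproj_tdeg ht) ?mul0r.
Qed.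

(** Together with [hcomp_sum] this identifies T[z] with the Rees ring of T: [star n] embeds T^{<=n}
    as the degree n part, and [hcomp n] is its inverse there. *)
Lemma hcomp_star m n t : tle V n t ->
  hcomp m (star n t) = if m == n then t else 0.
Proof.
move=> ht; rewrite raddf_sum /=.
transitivity (\sum_(i < n.+1) if m == n then (tproj i t : T) else 0).
  apply: eq_bigr => i _; have hi : (i <= n)%N by rewrite -ltnS.
  by rewrite (@hcomp_mono _ i) ?subnKC //; exact: tdeg_tproj.
by case: eqP => _; [rewrite -(tle_sum ht) | rewrite big1].
Qed.

Lemma coef_star n t i :
  (star n t)`_i = if (i <= n)%N then (tproj (n - i) t : T) else 0.
Proof.
rewrite /star coef_sum; case: leqP => hi.
  have hni : (n - i < n.+1)%N by rewrite ltnS leq_subr.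
  rewrite (bigD1 (Ordinal hni)) //= coefCM coefXn subKn // eqxx mulr1.
  rewrite big1 ?addr0 // => j; rewrite -val_eqE /= => hj.
  rewrite coefCM coefXn; case: eqP => [e|_]; last exact: mulr0.
  by move: hj; rewrite e subKn ?eqxx // -ltnS.
rewrite big1 // => j _; rewrite coefCM coefXn gtn_eqF ?mulr0 //.
exact: leq_ltn_trans (leq_subr _ _) hi.
Qed.

Lemma tproj_hcomp n q i : (i <= n)%N ->
  tproj (n - i) (hcomp n q) = tproj (n - i) q`_i.
Proof.
move=> hi; have hi' : (i < n.+1)%N by rewrite ltnS.
rewrite raddf_sum (bigD1 (Ordinal hi')) //= tproj_tproj eqxx big1 ?addr0 //.
move=> j; rewrite -val_eqE /= => hj; rewrite tproj_tproj; case: eqP => // e.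
have hjn : (j <= n)%N by rewrite -ltnS.
by move: hj; rewrite -(subKn hjn) -e subKn // eqxx.
Qed.

Lemma starM i j x y : tle V i x -> tle V j y ->
  star (i + j) (x * y) = star i x * star j y.
Proof.
move=> hx hy; rewrite [in LHS](tle_sum hx) [in LHS](tle_sum hy).
rewrite mulr_suml raddf_sum mulr_suml; apply: eq_bigr => k _.
rewrite mulr_sumr raddf_sum mulr_sumr; apply: eq_bigr => l _ /=.
have kd := @tdeg_tproj _ V k x; have ld := @tdeg_tproj _ V l y.
have ki : (k <= i)%N by rewrite -ltnS.
have lj : (l <= j)%N by rewrite -ltnS.
rewrite (star_mono (tdegM kd ld)) ?leq_add //.
have -> : (i + j - (k + l) = (i - k) + (j - l))%N.
  by rewrite subnDA -(addnBAC j ki) (addnBA _ lj).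
by rewrite -mulr_monomial.
Qed.

Lemma hcomp_sum q : exists N, forall M, (N <= M)%N ->
  q = \sum_(n < M) star n (hcomp n q).
Proof.
elim/hpoly_ind: q => [|x y [N hN] [N' hN']|p t k ht].
- exists 0%N => M _; rewrite big1 // => i _; rewrite !raddf0 //.
- exists (maxn N N') => M; rewrite geq_max => /andP[h h'].
  rewrite [in LHS](hN M h) [in LHS](hN' M h') -sumrB; apply: eq_bigr => i _.
  by rewrite !raddfB.
- exists (p + k).+1 => M hM.
  rewrite (bigD1 (Ordinal hM)) //= (hcomp_mono _ _ ht) eqxx.
  rewrite (star_mono ht) ?leq_addr // addKn big1 ?addr0 // => i.
  rewrite -val_eqE /= => /negbTE hi.
  by rewrite (hcomp_mono _ _ ht) hi raddf0.
Qed.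

Lemma hcompM n p q :
  hcomp n (p * q) = \sum_(i < n.+1) hcomp i p * hcomp (n - i) q.
Proof.
elim/hpoly_ind: p => [|x y hx hy|d t k ht].
- by rewrite mul0r raddf0 big1 // => i _; rewrite raddf0 mul0r.
- rewrite mulrBl raddfB /= hx hy -sumrB; apply: eq_bigr => i _.
  by rewrite raddfB mulrBl.
elim/hpoly_ind: q => [|x y hx hy|d' t' k' ht'].
- by rewrite mulr0 raddf0 big1 // => i _; rewrite raddf0 mulr0.
- rewrite mulrBr raddfB /= hx hy -sumrB; apply: eq_bigr => i _.
  by rewrite raddfB mulrBr.
rewrite mulr_monomial (hcomp_mono _ _ (tdegM ht ht')).
have [hn|hn] := ltnP n (d + k).
  rewrite big1 => [|i _].
    by rewrite ltn_eqF // (leq_trans hn) // addnACA leq_addr.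
  rewrite (hcomp_mono _ _ ht) ltn_eqF ?mul0r //.
  by apply: leq_ltn_trans hn; rewrite -ltnS.
rewrite -ltnS in hn; rewrite (bigD1 (Ordinal hn)) //=.
rewrite (hcomp_mono _ _ ht) eqxx (hcomp_mono _ _ ht') big1 ?addr0.
  rewrite ltnS in hn; rewrite -{1}(subnKC hn) addnACA eqn_add2l.
  by case: eqP => // _; rewrite mulr0.
move=> i; rewrite -val_eqE /= => /negbTE hi.
by rewrite (hcomp_mono _ _ ht) hi mul0r.
Qed.

(** In the Rees picture z acts as the inclusion of T^{<=n} into T^{<=n+1}. *)
Lemma hcompMX n q : hcomp n ('X * q) = if n is m.+1 then hcomp m q else 0.
Proof.
rewrite /hcomp big_ord_recl coefXM /= raddf0 add0r.
case: n => [|n]; first by rewrite big_ord0.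
by apply: eq_bigr => i _; rewrite coefXM /= subSS.
Qed.

Lemma star_mulX n t : tle V n t -> star n.+1 t = 'X * star n t.
Proof.
move=> ht; have e : star 1 (1 : T) = 'X.
  rewrite (@star_mono 1 0) // ?mul1r ?subn0 ?expr1 // .
  exact: (tdeg_eta V 1).
by rewrite -e -starM ?mul1r ?add1n //; exact: tle_le (tle1 A).
Qed.

Variable P : subbimod A.

(** When j exceeds the degree of x, [star j x] is x^* times a power of z; the induction peels off
    these factors. *)
Lemma star_Pstar j x : sb_set P x -> tle V j x ->
  ideal_gen (Pstar P) (star j x).
Proof.
move=> Px; elim: j => [|j IHj] hx.
  apply: ideal_gen_gen; exists 0%N, x; split=> //.
  have [->|/eqP ne] := eqVneq x 0; [by right | left].
  by rewrite -(_ : x = tproj 0 x) // {1}(tle_sum hx) big_ord1.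
have [e|/eqP ne] := eqVneq (tproj j.+1 x : T) 0; last first.
  by apply: ideal_gen_gen; exists j.+1, x; split=> //; left.
have hj : tle V j x.
  apply/tle_tproj => m; rewrite leq_eqVlt => /orP[/eqP <- //|].
  by move: m; exact/tle_tproj.
by rewrite star_mulX //; apply: ideal_genMl; exact: IHj.
Qed.

(** The key dictionary: <P^*> is homogeneous with degree n part P_n. Multiplicativity of [hcomp] and
    of [star] turns a generator a x b of P_n into an element of <P^*>, and back. *)
Lemma Pstar_hcomp q :
  ideal_gen (Pstar P) q <-> forall n, jacobi_sum P n (hcomp n q).
Proof.
split.
  elim=> {q} [_ [d [a [Pa ha _ ->]]]||x y _ hx _ hy|a x _ hx|a x _ hx] n.
  - rewrite hcomp_star //; case: eqP => [->|_]; first exact: js_gen.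
    exact: zspan0.
  - by rewrite raddf0; exact: zspan0.
  - by rewrite raddfB; exact: (zspanB (hx n) (hy n)).
  - rewrite hcompM; apply: zspan_sum => i _.
    have hi : (i <= n)%N by rewrite -ltnS.
    by have := js_mull (@hcomp_tle i a) (hx (n - i)%N); rewrite subnKC.
  - rewrite hcompM; apply: zspan_sum => i _.
    have hi : (i <= n)%N by rewrite -ltnS.
    by have := js_mulr (@hcomp_tle (n - i) a) (hx i); rewrite subnKC.
move=> hq; have [N hN] := hcomp_sum q; rewrite (hN N (leqnn N)).
apply: ideal_gen_sum => n _; move: (hcomp n q) (hq n) => y.
elim=> {y} [_ [i [j [k [a [x [b [<- ha [Px hx] hb ->]]]]]]]||x y _ hx _ hy].
- rewrite !starM //; last exact: tleM.
  exact/ideal_genMr/ideal_genMl/star_Pstar.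
- by rewrite raddf0; exact: ideal_gen0.
- by rewrite raddfB; exact: ideal_genB.
Qed.

Notation D := (Dring P).
Notation cls := (rquot_class (Pstar P)).
Notation z := (Dz P).

Lemma cls_star_eq0 n t : tle V n t ->
  cls (star n t) = 0 :> D <-> jacobi_sum P n t.
Proof.
move=> ht; rewrite rquot_eq0 Pstar_hcomp; split=> [/(_ n)|h m].
  by rewrite hcomp_star // eqxx.
rewrite hcomp_star //; case: eqP => [-> //|_]; exact: zspan0.
Qed.

Lemma DzC (x : D) : z * x = x * z.
Proof.
elim/rquot_ind: x => q; rewrite /Dz -!rmorphM; congr (cls _).
exact/esym/commr_polyX.
Qed.

(** As D^n = T^{<=n}/P_n, the kernel of z on D^n is (P_{n+1} cap T^{<=n})/P_n. *)
Lemma Dz_regular_jacobi : (forall y : D, z * y = 0 -> y = 0) <->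
  forall n, jacobi P n.
Proof.
split=> [h n y [hy hn]|hJ y].
  apply/(cls_star_eq0 hn)/h; rewrite -rmorphM -star_mulX //.
  by apply/cls_star_eq0 => //; exact: tle_le hn.
elim/rquot_ind: y => q; rewrite -rmorphM => /rquot_eq0/Pstar_hcomp h.
apply/rquot_eq0/Pstar_hcomp => n; apply: hJ; split; last exact: hcomp_tle.
by have := h n.+1; rewrite hcompMX.
Qed.

(** The projection on D^n. The representative is arbitrary; independence of it is the homogeneity of
    <P^*>. *)
Definition Dproj n (x : D) : D := cls (star n (hcomp n (repr x))).

Lemma DprojE n q : Dproj n (cls q) = cls (star n (hcomp n q)).
Proof.
apply/eqP; rewrite -subr_eq0 -raddfB -raddfB /= -raddfB; apply/eqP.
apply/cls_star_eq0; first exact: hcomp_tle.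
move: n; apply/Pstar_hcomp/rquot_eq; by rewrite /rquot_class reprK.
Qed.

Fact Dproj_is_zmod n : zmod_morphism (Dproj n).
Proof.
elim/rquot_ind=> p; elim/rquot_ind=> q.
by rewrite -raddfB !DprojE !raddfB.
Qed.
HB.instance Definition _ n := GRing.isZmodMorphism.Build D D (Dproj n)
  (Dproj_is_zmod n).

Lemma Dproj_ext (x : D) : (forall n, Dproj n x = 0) -> x = 0.
Proof.
elim/rquot_ind: x => q h; apply/rquot_eq0/Pstar_hcomp => n.
by apply/cls_star_eq0; [exact: hcomp_tle | rewrite -DprojE].
Qed.

Lemma Dproj_deg n (x : D) : Ddeg n (Dproj n x).
Proof.
elim/rquot_ind: x => q; rewrite DprojE.
exists (star n (hcomp n q)) => // i; rewrite coef_star.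
by case: leqP => // _; exact: tdeg_tproj.
Qed.

Lemma Ddeg_Dproj n m (x : D) : Ddeg n x -> Dproj m x = if m == n then x else 0.
Proof.
case=> q hq <-; rewrite DprojE.
have e : hcomp m q = if m == n then hcomp n q else 0.
  case: eqP => [-> //|nm]; rewrite /hcomp big1 // => i _; have := hq i.
  case: leqP => [hi ht|_ ->]; last by rewrite raddf0.
  apply: (tproj_tdeg ht) => h; apply: nm.
  have him : (i <= m)%N by rewrite -ltnS.
  by rewrite -(subnK hi) -h subnK.
rewrite e; case: eqP => [->|_]; last by rewrite !raddf0.
congr (cls _); apply/polyP => i; rewrite coef_star; have := hq i.
by case: leqP => [hi ht|//]; rewrite (tproj_hcomp q hi) tproj_id.
Qed.

Lemma DprojM n (x y : D) :
  Dproj n (x * y) = \sum_(i < n.+1) Dproj i x * Dproj (n - i) y.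
Proof.
elim/rquot_ind: x => p; elim/rquot_ind: y => q.
rewrite -rmorphM DprojE hcompM (raddf_sum (@star S A n)) (raddf_sum cls) /=.
apply: eq_bigr => i _.
have hi : (i <= n)%N by rewrite -ltnS.
rewrite !DprojE -{1}(subnKC hi) starM ?rmorphM //; exact: hcomp_tle.
Qed.

Lemma Ddeg_subgroup n : subgroup (@Ddeg S A P n).
Proof.
split; first by rewrite -(raddf0 (Dproj n)); exact: Dproj_deg.
move=> x y hx hy.
have -> : x = Dproj n x by rewrite (Ddeg_Dproj _ hx) eqxx.
have -> : y = Dproj n y by rewrite (Ddeg_Dproj _ hy) eqxx.
by rewrite -raddfB; exact: Dproj_deg.
Qed.

Lemma DdegM i j (x y : D) : Ddeg i x -> Ddeg j y -> Ddeg (i + j) (x * y).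
Proof.
move=> hx hy; suff -> : x * y = Dproj (i + j) (x * y) by exact: Dproj_deg.
have hi : (i < (i + j).+1)%N by rewrite ltnS leq_addr.
rewrite DprojM (bigD1 (Ordinal hi)) //= addKn (Ddeg_Dproj _ hx) eqxx.
rewrite (Ddeg_Dproj _ hy) eqxx big1 ?addr0 // => k.
by rewrite -val_eqE /= => /negbTE hk; rewrite (Ddeg_Dproj _ hx) hk mul0r.
Qed.

Lemma Dproj_mulr k n (x y : D) : Ddeg k y ->
  Dproj n (x * y) = if (k <= n)%N then Dproj (n - k) x * y else 0.
Proof.
move=> hy; rewrite DprojM; case: leqP => hk; last first.
  rewrite big1 // => i _; rewrite (Ddeg_Dproj _ hy) ltn_eqF ?mulr0 //.
  exact: leq_ltn_trans (leq_subr _ _) hk.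
have hnk : (n - k < n.+1)%N by rewrite ltnS leq_subr.
rewrite (bigD1 (Ordinal hnk)) //= subKn // (Ddeg_Dproj _ hy) eqxx.
rewrite big1 ?addr0 // => i; rewrite -val_eqE /= => hi.
rewrite (Ddeg_Dproj _ hy); case: eqP => [e|_]; last by rewrite mulr0.
by move: hi; rewrite -e subKn ?eqxx // -ltnS.
Qed.

Lemma Ddeg_cls p t k : tdeg V p t -> Ddeg (p + k) (cls (t%:P * 'X^k)).
Proof.
move=> ht; have -> : cls (t%:P * 'X^k) = Dproj (p + k) (cls (t%:P * 'X^k)).
  rewrite DprojE (hcomp_mono _ _ ht) eqxx (star_mono ht) ?leq_addr //.
  by rewrite addKn.
exact: Dproj_deg.
Qed.

Lemma Ddeg_clsC p t : tdeg V p t -> Ddeg p (cls t%:P).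
Proof. by move=> /Ddeg_cls - /(_ 0%N); rewrite addn0 mulr1. Qed.

Lemma Ddeg_z : Ddeg 1 z.
Proof. by have := Ddeg_cls 1 (tdeg_eta V 1); rewrite add0n mul1r expr1. Qed.

Lemma Ddeg0 (x : D) : Ddeg 0 x -> exists s, x = D_eta P s.
Proof.
case=> q hq <-; exists (eps0 q`_0); rewrite /D_eta /=; congr (cls _).
have h0 := hq 0%N; rewrite /= in h0; apply/polyP => -[|i].
  by rewrite coefC eqxx -tdeg0.
by rewrite coefC /=; have := hq i.+1.
Qed.

End Homogenization.

(** * The annihilator of z and H_1 of the complex *)

Section Core.
Variables (S : nzRingType) (A : connected_sring S).
Hypotheses (A_strong : strongly_graded A) (A1_proj : projective (A1 A)).
Variable P : subbimod A.
Hypothesis P_gen : ideal_gen (RP P) = @IA S A.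
Notation T := (TA A).
Notation D := (Dring P).
Notation cls := (rquot_class (Pstar P)).
Notation z := (Dz P).

Lemma Dz_inj_deg n (y : D) : jacobi P n -> Ddeg n y -> z * y = 0 -> y = 0.
Proof.
elim/rquot_ind: y => q hJ hq; rewrite -rmorphM => /rquot_eq0/Pstar_hcomp h.
have := Ddeg_Dproj n hq; rewrite eqxx => <-; rewrite DprojE.
apply/cls_star_eq0; first exact: hcomp_tle.
apply: hJ; split; last exact: hcomp_tle.
by have := h n.+1; rewrite hcompMX.
Qed.

(** The relation y^* = 0 in D expresses the leading form of y as z times the homogenized remainder,
    up to sign. *)
Lemma cls_lead_z n (y : T) : sb_set P y -> tle (A1_bimod A) n y ->
  exists w : D, cls (tproj n y : T)%:P = z * w.
Proof.
move=> Py hy; have /rquot_eq0 := star_Pstar Py hy.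
have e0 : star n (tproj n y : T) = (tproj n y : T)%:P.
  by rewrite (star_mono (@tdeg_tproj _ _ n y)) // subnn mulr1.
rewrite -[y in star n y](subrK (tproj n y)) raddfD /= e0 rmorphD /=.
case: n hy e0 => [|n] hy e0.
  rewrite {1}(tle_sum hy) big_ord1 subrr !raddf0 add0r => ->.
  by exists 0; rewrite mulr0.
have hr : tle (A1_bimod A) n (y - tproj n.+1 y).
  apply/tle_tproj => m hm; rewrite raddfB /= tproj_tproj.
  case: eqVneq => [->|ne]; first by rewrite subrr.
  by rewrite subr0; apply: (tle_tproj _ _).1 hy _ _; rewrite ltn_neqAle eq_sym ne.
rewrite star_mulX // rmorphM => /eqP; rewrite addrC addr_eq0 => /eqP ->.
by exists (- cls (star n (y - tproj n.+1 y))); rewrite mulrN.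
Qed.

Lemma cls_ideal_z (t : T) : ideal_gen (RP P) t ->
  exists w : D, cls t%:P = z * w.
Proof.
elim=> {t} [t ht||x y _ [w e] _ [w' e']|a x _ [w e]|a x _ [w e]].
- have [N hN] := tle_ex t; rewrite (tle_sum hN) rmorph_sum rmorph_sum /=.
  elim/big_ind: _ => [|x y [w ->] [w' ->]|i _].
  + by exists 0; rewrite mulr0.
  + by exists (w + w'); rewrite mulrDr.
  + by have [y [Py hy] ->] := ht i; exact: cls_lead_z.
- by exists 0; rewrite mulr0 !raddf0.
- by exists (w - w'); rewrite polyCB raddfB /= e e' mulrBr.
- by exists (cls a%:P * w); rewrite polyCM rmorphM /= e !mulrA DzC.
- by exists (w * cls a%:P); rewrite polyCM rmorphM /= e mulrA.
Qed.

Variable p : {rmorphism D -> A}.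
Hypothesis pE : forall q : {poly T}, p (cls q) = piA q`_0.

Lemma pC (t : T) : p (cls t%:P) = piA t.
Proof. by rewrite pE coefC. Qed.

Lemma p_z : p z = 0.
Proof. by rewrite pE coefX raddf0. Qed.

(** Only the constant coefficient matters modulo z; it lies in I_A = <R_P>, and leading forms are
    multiples of z in D. With [p_z] this is D/zD = A. *)
Lemma p_ker (x : D) : p x = 0 -> exists y, x = z * y.
Proof.
elim/rquot_ind: x => q; elim/poly_ind: q => [|q c _].
  by exists 0; rewrite mulr0 raddf0.
rewrite pE coefD coefMX coefC /= add0r => hc.
have [w e] : exists w : D, cls c%:P = z * w.
  by apply: cls_ideal_z; rewrite P_gen.
exists (cls q + w); rewrite raddfD /= e mulrDr; congr (_ + _).
by rewrite -rmorphM commr_polyX.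
Qed.

Lemma p_surj_deg n a : adeg A n a -> exists2 d : D, Ddeg n d & p d = a.
Proof.
move=> /(piA_surj_deg A_strong)[t ht <-]; exists (cls t%:P); last exact: pC.
exact: Ddeg_clsC.
Qed.

Lemma p_surj a : exists d : D, p d = a.
Proof. by have [t <-] := piA_surj A_strong a; exists (cls t%:P); exact: pC. Qed.

Lemma p_Dproj0 (d : D) : Dproj 0 d = D_eta P (eps A (p d)).
Proof.
elim/rquot_ind: d => q; have [s e] := Ddeg0 (Dproj_deg 0 (cls q)).
rewrite e; congr (D_eta P _); rewrite pE eps_piA.
move: e; rewrite DprojE /star /hcomp !big_ord1 subnn mulr1 tproj_tproj /= => e.
have := congr1 p e; rewrite /D_eta /= !pC => /(congr1 (eps A)).
by rewrite !eps_piA eps0_eta -eta_eps0 eps0_eta.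
Qed.

Section PiTensorTheory.
Variable V : lmodType S.
Notation pi := (pi_tensor pE V).

Lemma pi_pure (d : D_bimod P) (v : V) :
  pi (tpure d v) = tpure (p d : A_bimod A) v.
Proof. exact: tensor_mapl_pure. Qed.

Lemma pi_scale (d : D) u : pi (d *: u) = p d *: pi u.
Proof.
elim/tensor_ind: u => [|x y hx hy|c v]; first by rewrite scaler0 !raddf0 ?scaler0.
  by rewrite scalerBr !raddfB /= hx hy ?scalerBr.
rewrite -tpureZ !pi_pure -tpureZ; congr tpure; exact: rmorphM.
Qed.

Lemma pi_surj x : exists u, pi u = x.
Proof. by apply: tensor_mapl_surj => a; exact: p_surj. Qed.

Lemma pi_ker u : pi u = 0 -> exists u', u = z *: u'.
Proof.
move=> /tensor_mapl_ker h; have {h} := h p_surj.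
elim=> [_ [d [v [/p_ker[y ->] ->]]]||x y _ [x' ->] _ [y' ->]].
- by exists (tpure (y : D_bimod P) v); rewrite -tpureZ.
- by exists 0; rewrite scaler0.
- by exists (x' - y'); rewrite scalerBr.
Qed.

Lemma pi_lift_deg (g : nat -> set V) n x : AV_deg g n x ->
  exists2 u, DV_deg g n u & pi u = x.
Proof.
elim=> {x} [_ [i [j [a [v [e /p_surj_deg[d hd <-] hv ->]]]]]|| x y _ [u hu <-]
  _ [w hw <-]].
- exists (tpure (d : D_bimod P) v); last exact: pi_pure.
  by apply: zspan_gen; exists i, j, d, v.
- by exists 0; [exact: zspan0 | rewrite raddf0].
- by exists (u - w); [exact: zspanB | rewrite raddfB].
Qed.

End PiTensorTheory.

Fact DprojA_ract k (d : D_bimod P) s :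
  Dproj k (ract d s : D) = ract (Dproj k d : D_bimod P) s.
Proof.
have h : Ddeg 0 (D_eta P s) by exact: (Ddeg_clsC P (tdeg_eta _ s)).
change (Dproj k ((d : D) * D_eta P s) = Dproj k d * D_eta P s).
by rewrite (Dproj_mulr _ _ h) subn0.
Qed.

(** The projection on D^k (x) A^1, which has total degree k + 1 since A^1 sits in degree 1. *)
Definition DprojA k : {additive tensor (D_bimod P) (A1 A) ->
  tensor (D_bimod P) (A1 A)} :=
  @tensor_mapl _ _ _ (D_bimod P) (D_bimod P) (Dproj k : {additive D -> D})
    (@DprojA_ract k) (A1 A).

Lemma DprojA_pure k (d : D_bimod P) a :
  DprojA k (tpure d a) = tpure (Dproj k d : D_bimod P) a.
Proof. exact: tensor_mapl_pure. Qed.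

Lemma DprojA_z k u : DprojA k.+1 (z *: u) = z *: DprojA k u.
Proof.
elim/tensor_ind: u => [|x y hx hy|d v]; first by rewrite scaler0 !raddf0 ?scaler0.
  by rewrite scalerBr !raddfB /= hx hy ?scalerBr.
rewrite -tpureZ !DprojA_pure -tpureZ; congr tpure.
change (Dproj k.+1 (z * d) = z * Dproj k d).
by rewrite DzC (Dproj_mulr _ _ (Ddeg_z P)) subn1 DzC.
Qed.

Lemma DprojA_id k u : DV_deg (deg_in1 (A1 A)) k.+1 u -> DprojA k u = u.
Proof.
elim=> {u} [_ [i [j [d [a [e hd ha ->]]]]]||x y _ hx _ hy].
- have [->|[j1 _]] : a = 0 \/ j = 1%N /\ True.
  + by case: j ha {e} => [|[|j]] ha; [left| right | left].
  + by rewrite tpurer0 raddf0.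
  + rewrite DprojA_pure (Ddeg_Dproj _ hd); case: eqP => // ne; exfalso.
    by apply: ne; move: e; rewrite j1 addn1 => -[].
- by rewrite raddf0.
- by rewrite raddfB /= hx hy.
Qed.

Lemma DprojA_deg k u : DV_deg (deg_in1 (A1 A)) k.+1 (DprojA k u).
Proof.
elim/tensor_ind: u => [|x y hx hy|d v]; first by rewrite raddf0; exact: zspan0.
  by rewrite raddfB; exact: zspanB.
rewrite DprojA_pure; apply: zspan_gen; exists k, 1%N, (Dproj k d : D_bimod P), v.
by split=> //; [rewrite addn1 | exact: Dproj_deg].
Qed.

Variable sigma : {linear A1 A -> restr (D_eta P) (Dring P)^o}.
Hypothesis sigma_deg : forall a, Ddeg 1 (sigma a : D).
Hypothesis sigmaK : forall a, p (sigma a) = a1_ring a.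
Variables (V : lmodType S) (gV : nat -> set V).
Variable d2 : {linear tensor (A_bimod A) V -> tensor (A_bimod A) (A1 A)}.
Variable par2 : {linear tensor (D_bimod P) V -> tensor (D_bimod P) (A1 A)}.
Variable f2 : {linear tensor (D_bimod P) V -> (Dring P)^o}.
Hypothesis par2_deg :
  graded_map (DV_deg gV) (DV_deg (deg_in1 (A1 A))) par2.
Hypothesis par2E : forall x, pi_tensor pE (A1 A) (par2 x) =
    d2 (pi_tensor pE V x).
Hypothesis f2_deg : graded_map (DV_deg gV) (deg_shift (@Ddeg S A P)) f2.
Notation par1 := (par1 sigma).
Hypothesis f2E : forall x, par1 (par2 x) = - (z * f2 x).

Lemma par1_pure (d : D_bimod P) a : par1 (tpure d a) = (d : D) * sigma a.
Proof. exact: (tlift_pure (par1_balanced sigma)). Qed.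

Lemma par1_scale (d : D) u : par1 (d *: u) = d * par1 u.
Proof. exact: linearZZ. Qed.

Lemma par2_scale (d : D) u : par2 (d *: u) = d *: par2 u.
Proof. exact: linearZZ. Qed.

Lemma f2_scale (d : D) u : f2 (d *: u) = d * f2 u.
Proof. exact: linearZZ. Qed.

Lemma par1_deg n u : DV_deg (deg_in1 (A1 A)) n u -> Ddeg n (par1 u).
Proof.
elim=> {u} [_ [i [j [d [a [<- hd ha ->]]]]]||x y _ hx _ hy].
- have [->|[-> _]] : a = 0 \/ j = 1%N /\ True.
  + by case: j ha => [|[|j]] ha; [left| right | left].
  + rewrite tpurer0 raddf0; exact: (Ddeg_subgroup P _).1.
  + by rewrite par1_pure; apply: DdegM => //; exact: sigma_deg.
- rewrite raddf0; exact: (Ddeg_subgroup P _).1.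
- by rewrite raddfB; exact: (Ddeg_subgroup P _).2.
Qed.

(** H_1 = 0 in terms of elements, for an arbitrary V_2, so that it covers both a given resolution
    and the choice V_2 = R. *)
Definition H1_exact : Prop := forall u (y : D), par1 u + z * y = 0 ->
  exists v w, u = par2 v - z *: w /\ y = par1 w + f2 v.

(** Modulo z the component u becomes a cycle over A, hence a d_2-boundary. Lifting the preimage to D
    leaves an error divisible by z, which the second summand of M_2 absorbs. *)
Lemma regular_H1 :
  (forall u, @res_d1 S A (pi_tensor pE (A1 A) u) = 0 ->
     exists v, pi_tensor pE (A1 A) u = d2 v) ->
  (forall y : D, z * y = 0 -> y = 0) -> H1_exact.
Proof.
move=> ex1 reg u y e.
have [|v' hv'] := ex1 u.
  have -> : @res_d1 S A (pi_tensor pE (A1 A) u) = p (par1 u).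
    elim/tensor_ind: u {e} => [|x x' hx hx'|d a]; first by rewrite !raddf0.
      by rewrite !raddfB /= hx hx'.
    rewrite pi_pure par1_pure rmorphM sigmaK.
    exact: (tlift_pure (@d1_balanced S A)).
  have := congr1 p e; rewrite raddf0 rmorphD /= rmorphM /= p_z mul0r addr0.
  exact.
have [v hv] := pi_surj v'; rewrite -hv -par2E in hv'.
have [w hw] : exists w, par2 v - u = z *: w.
  by apply: pi_ker; rewrite raddfB /= hv' subrr.
exists v, w; split; first by rewrite -hw opprB addrC subrK.
(* As z is regular, the second component may be compared after multiplication by z, where the cycle
   condition and partial_1 partial_2 = -z f_2 apply. *)
apply/eqP; rewrite -subr_eq0; apply/eqP/reg.
have -> : z * (y - (par1 w + f2 v)) = z * y - par1 (z *: w) - z * f2 v.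
  by rewrite par1_scale mulrBr mulrDr opprD addrA.
rewrite -hw raddfB /= f2E opprB opprK !addrA addrK.
by rewrite addrC.
Qed.

Let K : set D := [set y | z * y = 0].
Let KA : set D := [set u | exists k a, K k /\ u = k * (sigma a : D)].
(** This is K A^1 + D_+ K: by [p_Dproj0], the condition on d says that its component in D^0
    vanishes. *)
Let K' : set D :=
  zspan (KA `|` [set u | exists d k, [/\ eps A (p d) = 0, K k & u = d * k]]).

(** A relation rather than a map, since y depends on the lift u and on the quotient w; [obs0]
    measures the ambiguity. *)
Let obs (x : tensor (A_bimod A) V) (y : D) : Prop := exists u w,
  [/\ pi_tensor pE V u = x, par2 u = z *: w & y = par1 w + f2 u].

Let obs_ex x : d2 x = 0 -> exists y, obs x y.
Proof.
move=> hx; have [u hu] := pi_surj x; have [w hw] : exists w, par2 u = z *: w.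
  by apply: pi_ker; rewrite par2E hu.
by exists (par1 w + f2 u), u, w.
Qed.

Let obs_K x y : obs x y -> K y.
Proof.
move=> [u [w [_ hw ->]]]; rewrite /K /= mulrDr -par1_scale -hw f2E.
exact: addNr.
Qed.

(** A lift of 0 is z u', and then w - partial_2 u' is killed by z. As A^1 is projective, the
    z-torsion of D (x) A^1 comes from K (x) A^1, which partial_1 sends to K A^1. *)
Let obs0 y : obs 0 y -> zspan KA y.
Proof.
move=> [u [w [/pi_ker[u' ->] hw ->]]].
have hz : z *: (w - par2 u') = 0.
  by rewrite scalerBr -hw par2_scale subrr.
have -> : par1 w + f2 (z *: u') = par1 (w - par2 u').
  by rewrite f2_scale raddfB /= f2E opprK.
have := projective_torsion A1_proj hz; elim=> {w hw hz}.
- move=> _ [k [a [hk ->]]]; rewrite par1_pure; apply: zspan_gen.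
  by exists k, a.
- by rewrite raddf0; exact: zspan0.
- by move=> x x' _ h _ h'; rewrite raddfB; exact: zspanB.
Qed.

Let obsB x x' y y' : obs x y -> obs x' y' -> obs (x - x') (y - y').
Proof.
move=> [u [w [<- hw ->]]] [u' [w' [<- hw' ->]]]; exists (u - u'), (w - w').
split; first exact: raddfB.
  by rewrite raddfB /= hw hw' scalerBr.
by rewrite !raddfB /= opprD addrACA.
Qed.

Let obsZ d x y : obs x y -> obs (p d *: x) (d * y).
Proof.
move=> [u [w [<- hw ->]]]; exists (d *: u), (d *: w); split.
- exact: pi_scale.
- rewrite par2_scale hw.
  apply: etrans (scalerA d z w) _.
  rewrite -DzC.
  apply: esym.
  exact: scalerA.
- by rewrite par1_scale f2_scale mulrDr.
Qed.

(** For homogeneous choices the obstruction lies in D^{k+1} and is killed by z, and (J_{k+1}) is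
    injectivity of z there. *)
Let obs_deg k x : jacobi P k.+1 -> AV_deg gV k.+2 x -> d2 x = 0 -> obs x 0.
Proof.
move=> hJ /pi_lift_deg[u hu <-] hx.
have [w0 hw0] : exists w, par2 u = z *: w by apply: pi_ker; rewrite par2E.
(* w0 need not be homogeneous, but partial_2 u has degree k + 2 and z raises degrees by one, so the
   component of w0 in D^k (x) A^1 suffices. *)
have hw : par2 u = z *: DprojA k w0.
  by rewrite -DprojA_z -hw0 DprojA_id //; exact: par2_deg.
exists u, (DprojA k w0); split=> //; apply/esym.
apply: (Dz_inj_deg hJ).
  rewrite -[X in Ddeg _ (_ + X)]opprK; apply: (Ddeg_subgroup P _).2.
    exact/par1_deg/DprojA_deg.
  rewrite -sub0r; apply: (Ddeg_subgroup P _).2; first exact: (Ddeg_subgroup P _).1.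
  exact: f2_deg hu.
exact: (@obs_K (pi_tensor pE V u) _ (ex_intro _ u (ex_intro _ _ (And3 erefl hw erefl)))).
Qed.

Let KA_K' y : zspan KA y -> K' y.
Proof.
by apply: zspan_min; [exact: zspan0 | exact: zspanB | move=> x hx; apply: zspan_gen; left].
Qed.

Let obs_gen x : zspan [set u | exists a x', [/\ u = a *: x', d2 x' = 0 &
    eps A a = 0 \/ exists2 m, jacobi P m.+1 & AV_deg gV m.+2 x']] x ->
  exists2 y, K' y & obs x y.
Proof.
elim=> {x} [_ [a [x [-> hx [ha|[m hJ hm]]]]]||x x' _ [y hy ho] _ [y' hy' ho']].
- have [d hd] := p_surj a; have [y hy] := obs_ex hx.
  exists (d * y); last by rewrite -hd; exact: obsZ.
  by apply: zspan_gen; right; exists d, y; split=> //; [rewrite hd | exact: obs_K hy].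
- have [d hd] := p_surj a; exists 0; first exact: zspan0.
  by rewrite -hd -(mulr0 d); apply: obsZ; exact: obs_deg hm hx.
- exists 0; first exact: zspan0.
  exists 0, 0; split; rewrite ?raddf0 ?scaler0 //.
  by rewrite addr0.
- by exists (y - y'); [exact: zspanB | exact: obsB].
Qed.

(** Graded Nakayama: factors from D_+ and A^1 have positive degree, so the degree n components of
    elements of K are expressed through lower components of elements of K. The induction runs over
    all of K at once. *)
Let K_Nakayama : (forall y, K y -> K' y) -> forall y, K y -> y = 0.
Proof.
move=> hK y hy; apply: Dproj_ext => n; elim/ltn_ind: n y hy => n IHn y /hK.
elim=> {y} [_ [[k [a [hk ->]]]|[d [k [hd hk ->]]]]||x y _ hx _ hy].
- rewrite (Dproj_mulr _ _ (sigma_deg a)); case: ltnP => // hn.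
  by rewrite IHn ?mul0r // subn1 prednK.
- rewrite DprojM big_ord_recl big1 ?addr0 => [|i _].
    by rewrite p_Dproj0 hd raddf0 mul0r.
  rewrite [X in _ * X]IHn ?mulr0 // ltn_subrL; apply/andP; split=> //.
  exact: leq_ltn_trans (leq0n i) (ltn_ord i).
- exact: raddf0.
- by rewrite raddfB /= hx hy subrr.
Qed.

(* The obstruction to lifting a syzygy x along z is a class in K / K A^1, K   *)
(* the annihilator of z. H_1 = 0 makes these classes exhaust K / K A^1, and   *)
(* the class of a x' is a times that of x', which vanishes if x' is           *)
(* homogeneous of degree m + 2 and (J_{m+1}) holds. Hence K = D_+ K + K A^1.  *)
Lemma H1_regular : H1_exact ->
  (forall x, d2 x = 0 ->
     zspan [set u | exists a x', [/\ u = a *: x', d2 x' = 0 &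
       eps A a = 0 \/ exists2 m, jacobi P m.+1 & AV_deg gV m.+2 x']] x) ->
  forall y : D, z * y = 0 -> y = 0.
Proof.
move=> H1 hgen; apply: K_Nakayama => y hy.
have [|u [w [e1 e2]]] := H1 0 y; first by rewrite raddf0 add0r.
have e : par2 u = z *: w by apply/eqP; rewrite -subr_eq0 -e1.
have hd : d2 (pi_tensor pE V u) = 0.
  by rewrite -par2E e pi_scale p_z scale0r.
have [y' hy' ho'] := obs_gen (hgen _ hd).
have ho : obs (pi_tensor pE V u) y by exists u, w.
have := obsB ho ho'; rewrite subrr => /obs0/KA_K' h.
by rewrite -(subrK y' y); apply: zspanD.
Qed.

End Core.

(** * Complexity as a supremum, and the index shift to the Jacobi conditions *)

(** [supremum] takes a default value when no least upper bound exists, so existence in the extended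
    integers must be shown before [complexity] bounds anything. *)
Lemma ereal_int_supremums_neq0 (X : set nat) n : X n ->
  exists c : \bar int,
    supremums [set ((m%:Z - 1)%R%:E : \bar int) | m in X] c.
Proof.
move=> Xn; set Y := image _ _.
(* An integer bound r for the m - 1 is the natural bound r + 1 for the m; positivity holds because X
   is nonempty. *)
have bd (r : int) : ubound Y r%:E -> ubound X `|(r + 1)%R|%N.
  move=> hr m Xm.
  have h k : X k -> (k%:Z <= r + 1)%R.
    by move=> Xk; rewrite -lerBlDr -lee_fin; apply: hr; exists k.
  have r0 : (0 <= r + 1)%R by apply: le_trans (h n Xn).
  by have := h m Xm; rewrite -{1}(gez0_abs r0) lez_nat.
have nNy : ~ ubound Y -oo%E by move=> /(_ _ (imageP _ Xn)).
have [[M hM]|nb] := pselect (ubound X !=set0).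
  have [|m [um lm]] := @nat_supremums_neq0 X; first by exists M.
  exists (m%:Z - 1)%:E; split=> [_ [k Xk <-]|[r| |] hu].
  - by rewrite lee_fin lerB //; exact: um.
  - have hl := lm _ (bd r hu).
    rewrite lee_fin lerBlDr.
    have r0 : (0 <= r + 1)%R.
      apply: (@le_trans _ _ n%:Z) => //.
      by rewrite -lerBlDr -lee_fin; apply: hu; exists n.
    by rewrite -(gez0_abs r0) lez_nat.
  - exact: leey.
  - by have := nNy hu.
exists +oo%E; split=> [_ [k Xk <-]|[r| |] hu]; first exact: leey.
- by case: nb; exists `|(r + 1)%R|%N; exact: bd.
- exact: lexx.
- by have := nNy hu.
Qed.

Lemma complexity_ge (W : zmodType) (g : nat -> set W) n x : g n x -> x <> 0 ->
  ((n%:Z - 1)%:E <= complexity g)%E.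
Proof.
move=> hx nx; apply: ge_supremum_Nmem; last by exists n => //; exists x.
by apply: (@ereal_int_supremums_neq0 _ n); exists x.
Qed.

Section Jacobi.
Variables (S : nzRingType) (A : connected_sring S) (P : set (TA A)).

(** Degree m + 2 in V_3 or Tor_3 corresponds to (J_{m+1}). If c = -1, the inequality m + 1 <= c is
    absurd, so both alternatives are covered. *)
Lemma jacobi_uptoP (c : \bar int) : jacobi_upto P c ->
  forall m, ((m.+2%:Z - 1)%:E <= c)%E -> jacobi P m.+1.
Proof.
move=> hJ m hm; have e : (m.+2%:Z - 1)%R = m.+1%:Z :> int.
  by rewrite -addn1 PoszD addrK.
rewrite e in hm; case: hJ => [hc|]; last by apply.
by move: hm; rewrite hc.
Qed.

End Jacobi.

Section ResolutionStep.
Variables (S : nzRingType) (A : connected_sring S) (c : \bar int).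
Variables (Q : vresolution A c) (P : subbimod A).

(** The syzygies are generated by the d_3(1 (x) v) with v homogeneous in V_3, and c_{V_3} = c(A)
    bounds their degrees. *)
Lemma vresolution_gen (hJ : jacobi_upto P c) x : res_d2 Q x = 0 ->
  zspan [set u | exists a x', [/\ u = a *: x', res_d2 Q x' = 0 &
    eps A a = 0 \/
    exists2 m, jacobi P m.+1 & AV_deg (gdeg (resV Q 0)) m.+2 x']] x.
Proof.
move=> /res_exact2[v ->]; elim/tensor_ind: v => [|v w hv hw|a v].
- by rewrite raddf0; exact: zspan0.
- by rewrite raddfB; exact: zspanB.
have [_ dec _] := gdegP (resV Q 1).
have [N [f [hf ->]]] := dec v.
rewrite tpure_sumr (raddf_sum (res_d Q 0)); apply: zspan_sum => i _ /=.
have -> : res_d Q 0 (tpure a (f i)) =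
    (a : A) *: res_d Q 0 (tpure (1 : A_bimod A) (f i)).
  rewrite -linearZZ -tpureZ; congr (res_d Q 0 (tpure _ _)).
  exact/esym/mulr1.
have [->|/eqP ne] := eqVneq (f i) 0.
  by rewrite tpurer0 raddf0 scaler0; exact: zspan0.
apply: zspan_gen; eexists; eexists; split; [reflexivity| |].
  by apply/res_exact2; eexists.
right; have hi : (2 <= i)%N.
  by rewrite leqNgt; apply/negP => h; apply: ne; exact: resV_low (hf i).
exists (i - 2)%N.
  apply: (jacobi_uptoP hJ); rewrite -addn2 subnK // -(resV3_complexity Q).
  exact: complexity_ge (hf i) ne.
rewrite -addn2 subnK //; apply: res_d_deg; apply: zspan_gen.
exists 0%N, (i : nat), (1 : A_bimod A), (f i); split=> //.
by rewrite -(rmorph1 (eta A)); exact: adeg_eta.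
Qed.

End ResolutionStep.

(** * The criterion of part (1) *)

Section JacobiCriterion.
Variables (S : nzRingType) (A : connected_sring S).
Hypotheses (A_strong : strongly_graded A) (A1_proj : projective (A1 A)).
Variables (R P : subbimod A) (c : \bar int) (Q : vresolution A c).
Hypotheses (R_gen : ideal_gen R = @IA S A) (hR : R `<=` RP P).

Lemma H1M_exact (K : central_data Q P) : (forall h : H1M K, h = 0) <->
  H1_exact (cd_sigma K) (cd_par2 K) (cd_f2 K).
Proof.
split=> [/homology_eq0 h u y e|h].
  have [[v w] [-> ->]] := h (u, y) e; by exists v, w.
apply/homology_eq0 => -[u y] /h[v [w [/= eu ey]]].
by exists (v, w); rewrite eu ey.
Qed.

Lemma pbw_iff_H1M (K : ideal_gen R = ideal_gen (RP P) -> central_data Q P) :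
  pbw_deformation P R <->
  exists e : ideal_gen R = ideal_gen (RP P),
    (forall h : H1M (K e), h = 0) /\ jacobi_upto P c.
Proof.
rewrite (pbw_leading hR R_gen) (leading_RP hR); split=> [[e hJ]|[e [h1 hJ]]].
  have P_gen : ideal_gen (RP P) = @IA S A by rewrite -e.
  exists e; split; last by right=> n _ _; exact: hJ.
  apply/H1M_exact.
  apply: (regular_H1 A_strong P_gen (pE := cd_piE (K e)) _ (d2 := res_d2 Q)).
  - exact: cd_sigmaK.
  - exact: cd_par2E.
  - exact: cd_f2E.
  - by move=> u /res_exact1.
  - exact/Dz_regular_jacobi.
split=> //; apply/Dz_regular_jacobi.
have P_gen : ideal_gen (RP P) = @IA S A by rewrite -e.
apply: (H1_regular A_strong A1_proj P_gen (pE := cd_piE (K e))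
  (sigma := cd_sigma (K e)) _ (gV := gdeg (resV Q 0)) (d2 := res_d2 Q)
  (par2 := cd_par2 (K e)) (f2 := cd_f2 (K e))).
- exact: cd_sigma_deg.
- exact: cd_par2_deg.
- exact: cd_par2E.
- exact: cd_f2_deg.
- exact: cd_f2E.
- exact/H1M_exact.
- by move=> x; exact: vresolution_gen.
Qed.

End JacobiCriterion.

(** * Fox derivatives *)

(* [tau] is the Fox derivative T -> B (x) A^1 along g : T -> B: it writes the *)
(* part of positive degree of t as a left combination of elements of A^1.     *)
Section Tau.
Variables (S : nzRingType) (A : connected_sring S).
Notation T := (TA A).
Notation V := (A1_bimod A).
Variables (B : pzRingType) (etaB : {rmorphism S -> B}) (g : {rmorphism T -> B}).
Hypothesis g_eta : forall s, g (tring_eta V s) = etaB s.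
Notation M := (tensor (ring_bimod etaB) (A1 A)).

Lemma tpure_eta s (a : A1 A) :
  tpure (1 : ring_bimod etaB) (s *: a) = etaB s *: tpure (1 : ring_bimod etaB) a.
Proof.
rewrite -tpure_bal -tpureZ; congr tpure.
by rewrite /= mul1r /GRing.scale /= mulr1.
Qed.

Lemma eps0Z s (x : T) : eps0 (s *: x) = s * eps0 x.
Proof. by []. Qed.

Lemma vinD (v w : V) : vin (v + w) = vin v + vin w.
Proof. exact: lmulDl. Qed.

Section Step.
Variables (n : nat) (f : {linear tpow V n -> restr etaB M}).
Let phi (v : V) (x : tpow V n) : M :=
  g (vin v) *: (f x : M) +
  tpure (1 : ring_bimod etaB) (ract v (eps0 (din x : T))).
Let phi_balanced : balanced phi.
Proof.
split=> [v w x|v x y|v s x]; rewrite /phi.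
- by rewrite vinD rmorphD scalerDl ractDl tpureDr addrACA.
- have -> : eps0 (din (x + y) : T) = eps0 (din x : T) + eps0 (din y : T).
    by rewrite (raddfD (@din (tpow V) n)) (raddfD (@eps0 S V)).
  rewrite linearD ractDr tpureDr addrACA; congr (_ + _).
  exact: scalerDr.
- rewrite vin_ract rmorphM g_eta -ractM dinZ eps0Z; congr (_ + _).
  rewrite linearZ; exact/esym/scalerA.
Qed.
Definition tauS_fun : tensor V (tpow V n) -> restr etaB M := tlift phi_balanced.
HB.instance Definition _ := GRing.Additive.on tauS_fun.
Fact tauS_scalable : scalable tauS_fun.
Proof.
apply: tlift_scale => c v x; rewrite /phi vinZ rmorphM g_eta ractZ tpure_eta.
rewrite -[RHS]/(etaB c *: (g (vin v) *: (f x : M) +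
  tpure (1 : ring_bimod etaB) (ract v (eps0 (din x : T))))).
by rewrite scalerDr (scalerA (etaB c)).
Qed.
HB.instance Definition _ := GRing.isScalable.Build S (tensor V (tpow V n))
  (restr etaB M) _ tauS_fun tauS_scalable.
Definition tauS : {linear tensor V (tpow V n) -> restr etaB M} := tauS_fun.

Lemma tauS_pure v x : tauS (tpure v x) = phi v x.
Proof. exact: (tlift_pure phi_balanced). Qed.
End Step.

Fixpoint tau_pow n : {linear tpow V n -> restr etaB M} :=
  if n is m.+1 then tauS (tau_pow m) else \0.

Definition tau (t : T) : M :=
  dlift (fun n => tau_pow n : {additive tpow V n -> M}) t.

Fact tau_is_zmod : zmod_morphism tau.
Proof. exact: dliftB. Qed.
HB.instance Definition _ := GRing.isZmodMorphism.Build T M tau tau_is_zmod.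

Lemma tau_din n (x : tpow V n) : tau (din x) = tau_pow n x.
Proof. exact: (dlift_din (fun n => tau_pow n : {additive tpow V n -> M})). Qed.

Lemma tau_eta s : tau (tring_eta V s) = 0.
Proof. by rewrite [LHS]tau_din. Qed.

Lemma tau_lmul v (t : T) : tau (lmul v t) =
  g (vin v) *: tau t + tpure (1 : ring_bimod etaB) (ract v (eps0 t)).
Proof.
have [N hN] := dcompP t; rewrite {1 2}(dsum_din hN).
have -> : eps0 t = \sum_(i < N) eps0 (din (t i) : T).
  by rewrite {1}(dsum_din hN) raddf_sum.
rewrite (raddf_sum (lmul v)) !(raddf_sum tau) scaler_sumr.
have -> : ract v (\sum_(i < N) eps0 (din (t i) : T)) =
    \sum_(i < N) ract v (eps0 (din (t i) : T)).
  elim/big_ind2: _ => // [|? x ? y <- <-]; last exact: ractDr.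
  by apply: (addrI (ract v 0)); rewrite -ractDr !addr0.
rewrite tpure_sumr -big_split /=; apply: eq_bigr => i _.
by rewrite lmul_din !tau_din [LHS]tauS_pure.
Qed.

(** The Fox product rule, d(xy) = x d(y) + d(x) eps(y). The scalar eps(y) stays inside the argument
    because the target is only a left module. *)
Lemma tauM (x y : T) :
  tau (x * y) = g x *: tau y + tau (x * tring_eta V (eps0 y)).
Proof.
elim/tring_ind: x => [|x w hx hw|s|v x hx].
- by rewrite !mul0r !raddf0 scale0r addr0.
- by rewrite !mulrBl !raddfB /= hx hw ?rmorphB scalerBl opprD addrACA.
- rewrite -rmorphM tau_eta addr0.
  elim/tring_ind: y => [|y w hy hw|t|v y hy].
  + by rewrite mulr0 !raddf0 ?scaler0.
  + by rewrite mulrBr !raddfB /= hy hw ?scalerBr.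
  + by rewrite -rmorphM !tau_eta scaler0.
  + have -> : tring_eta V s * lmul v y = lmul (s *: v) y.
      by rewrite tring_etaZ lmulZ.
    rewrite !tau_lmul vinZ rmorphM ractZ tpure_eta scalerDr g_eta.
    by congr (_ + _); exact/esym/scalerA.
- have e w : lmul v x * w = lmul v (x * w) by rewrite !lmulE mulrA.
  rewrite !e !tau_lmul hx scalerDr -addrA; congr (_ + _).
    by rewrite lmulE rmorphM; exact: scalerA.
  suff -> : eps0 (x * y) = eps0 (x * tring_eta V (eps0 y)) by [].
  rewrite !(rmorphM (@eps0 S V)); congr (_ * _); exact/esym/eps0_eta.
Qed.

Lemma tau_vin t (a : V) : tau (t * vin a) = tpure (g t : ring_bimod etaB) a.
Proof.
rewrite tauM eps0_vin !raddf0 mulr0 raddf0 addr0 /vin tau_lmul.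
have e1 : tau 1 = 0 by rewrite -(rmorph1 (tring_eta V)) tau_eta.
rewrite e1 scaler0 add0r rmorph1 ract1 -tpureZ; congr tpure.
exact: mulr1.
Qed.

Lemma tau_etaM s t : tau (tring_eta V s * t) = etaB s *: tau t.
Proof. by rewrite tauM -rmorphM tau_eta addr0 g_eta. Qed.

Lemma tau_span t : zspan [set u : T * M | exists t' (a : A1 A),
    u = (t' * vin (a : V), tpure (g t' : ring_bimod etaB) a)]
  (t - tproj 0 t, tau t).
Proof.
elim/tring_ind: t => [|x w hx hw|s|v x hx].
- by rewrite !raddf0 addr0; exact: zspan0.
- rewrite !raddfB /= (_ : (_, _) = (x - tproj 0 x, tau x) - (w - tproj 0 w, tau w)).
    exact: zspanB.
  by congr pair; rewrite /= opprD addrACA -opprD.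
- by rewrite tau_eta tproj_eta subrr; exact: zspan0.
rewrite tproj_lmul subr0 tau_lmul.
pose f (u : T * M) : T * M := (vin v * u.1, g (vin v) *: u.2).
have fB : zmod_morphism f.
  by move=> u w; rewrite /f /= mulrBr scalerBr.
pose fa : {additive T * M -> T * M} :=
  HB.pack f (GRing.isZmodMorphism.Build (T * M)%type (T * M)%type f fB).
rewrite (_ : (_, _) = fa (x - tproj 0 x, tau x) +
  (1 * vin (ract v (eps0 x)), tpure (g 1 : ring_bimod etaB) (ract v (eps0 x)))).
  apply: zspanD; last by apply: zspan_gen; exists 1, (ract v (eps0 x)).
  apply: zspan_map hx => _ [t' [a ->]]; apply: zspan_gen.
  exists (vin v * t'), a; rewrite /fa /= /f /= mulrA rmorphM.
  by rewrite -tpureZ.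
have e : lmul v x = vin v * (x - tproj 0 x) + vin (ract v (eps0 x)).
  by rewrite vin_ract lmulE -mulrDr -eta_eps0 subrK.
by rewrite rmorph1 mul1r e.
Qed.

Section Degree.
Variable gB : nat -> set B.
Hypothesis gBM : forall i j x y, gB i x -> gB j y -> gB (i + j)%N (x * y).
Hypothesis g_deg : forall n (t : T), tdeg V n t -> gB n (g t).

Lemma tensor_deg_scale (U : lmodType S) (gU : nat -> set U) i n b x :
  gB i b -> @tensor_deg _ _ (ring_bimod etaB) U gB gU n x ->
  @tensor_deg _ _ (ring_bimod etaB) U gB gU (i + n) (b *: x).
Proof.
move=> hb; elim=> {x} [_ [j [k [c [v [<- hc hv ->]]]]]||x y _ hx _ hy].
- rewrite -tpureZ; apply: zspan_gen.
  exists (i + j)%N, k, (b * c : ring_bimod etaB), v; split=> //.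
    by rewrite addnA.
  exact: gBM.
- by rewrite scaler0; exact: zspan0.
- by rewrite scalerBr; exact: zspanB.
Qed.

Lemma tau_deg n (t : T) : tdeg V n t ->
  @tensor_deg _ _ (ring_bimod etaB) (A1 A) gB (deg_in1 (A1 A)) n (tau t).
Proof.
move=> ht; rewrite -(tproj_id ht) {ht}.
elim/tring_ind: t n => [|x y hx hy|s|v x hx] n.
- by rewrite !raddf0; exact: zspan0.
- by rewrite !raddfB; exact: (zspanB (hx n) (hy n)).
- rewrite tproj_eta; case: n => [|n]; rewrite ?tau_eta ?raddf0; exact: zspan0.
rewrite tproj_lmul; case: n => [|n]; first by rewrite raddf0; exact: zspan0.
rewrite tau_lmul; apply: zspanD.
  rewrite -add1n; apply: tensor_deg_scale; last exact: hx.
  by apply: g_deg; exact: tdeg_vin.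
have [->|n0] := posnP n.
  apply: zspan_gen; exists 0%N, 1%N, (1 : ring_bimod etaB).
  exists (ract v (eps0 (tproj 0 x : T))); split=> //.
  by rewrite -(rmorph1 g) -(rmorph1 (tring_eta V)); exact/g_deg/tdeg_eta.
have -> : eps0 (tproj n x : T) = 0.
  apply: (@tring_eta_inj _ V); rewrite eta_eps0 tproj_tproj raddf0.
  by rewrite eq_sym gtn_eqF.
have -> : ract v 0 = 0 :> V.
  by apply: (addrI (ract v 0)); rewrite -ractDr !addr0.
by rewrite tpurer0; exact: zspan0.
Qed.

End Degree.

End Tau.

Lemma tau_map (S : nzRingType) (A : connected_sring S) (B C : pzRingType)
  (etaB : {rmorphism S -> B}) (etaC : {rmorphism S -> C})
  (g : {rmorphism TA A -> B}) (h : {rmorphism TA A -> C})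
  (g_eta : forall s, g (tring_eta (A1_bimod A) s) = etaB s)
  (h_eta : forall s, h (tring_eta (A1_bimod A) s) = etaC s)
  (F : {additive tensor (ring_bimod etaB) (A1 A) ->
     tensor (ring_bimod etaC) (A1 A)}) :
  (forall t u, F (g t *: u) = h t *: F u) ->
  (forall v, F (tpure (1 : ring_bimod etaB) v) =
     tpure (1 : ring_bimod etaC) v) ->
  forall t, F (tau g_eta t) = tau h_eta t.
Proof.
move=> FZ F1; elim/tring_ind=> [|x y hx hy|s|v x hx].
- by rewrite !raddf0.
- by rewrite !raddfB /= hx hy.
- by rewrite !tau_eta raddf0.
- by rewrite !tau_lmul raddfD /= FZ F1 hx.
Qed.

(** * Homogeneous components for an abstract grading *)

Section GradingProjections.
Variables (W : zmodType) (g : nat -> set W).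
Hypothesis hg : is_grading g.

Lemma grading_subgroup n : subgroup (g n).
Proof. by case: hg => h _ _; exact: h. Qed.

Lemma grading_dec x : exists f : nat -> W, (forall i, g i (f i)) /\
  exists N, (forall i, (N <= i)%N -> f i = 0) /\ x = \sum_(i < N) f i.
Proof.
have [_ /(_ x)[N [f [hf e]]] _] := hg.
exists (fun i => if (i < N)%N then f i else 0); split=> [i|].
  by case: ifP => // _; exact: (grading_subgroup i).1.
exists N; split=> [i hi|]; first by rewrite ltnNge hi.
by rewrite e; apply: eq_bigr => i _; rewrite ltn_ord.
Qed.

Definition gproj n x : W := projT1 (cid (grading_dec x)) n.

Lemma gproj_deg n x : g n (gproj n x).
Proof. by rewrite /gproj; case: cid => f /= [hf _]. Qed.

Lemma big_ord_support (f : nat -> W) N M : (N <= M)%N ->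
  (forall i, (N <= i)%N -> f i = 0) -> \sum_(i < M) f i = \sum_(i < N) f i.
Proof.
move=> NM h; rewrite -!(big_mkord xpredT f) (big_cat_nat (leq0n N) NM) /=.
rewrite [X in _ + X]big1_seq ?addr0 // => i.
by rewrite mem_index_iota => /andP[_ /andP[/h]].
Qed.

Lemma gproj_sum x : exists N, forall M, (N <= M)%N ->
  x = \sum_(i < M) gproj i x.
Proof.
rewrite /gproj; case: cid => f /= [_ [N [h e]]]; exists N => M NM.
by rewrite (big_ord_support NM h).
Qed.

Lemma gprojE x (f : nat -> W) N : (forall i, g i (f i)) ->
  (forall i, (N <= i)%N -> f i = 0) -> x = \sum_(i < N) f i ->
  forall n, gproj n x = f n.
Proof.
move=> hf h e n; rewrite /gproj; case: cid => f' /= [hf' [N' [h' e']]].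
have [_ _ uniq] := hg; set M := maxn n.+1 (maxn N N').
have NM : (N <= M)%N by rewrite /M !leq_max leqnn orbT.
have NM' : (N' <= M)%N by rewrite /M !leq_max leqnn !orbT.
apply/eqP; rewrite -subr_eq0; apply/eqP.
apply: (uniq M (fun i => f' i - f i)); last by rewrite leq_max leqnn.
  by move=> i; apply: (grading_subgroup i).2.
rewrite sumrB (big_ord_support NM h) (big_ord_support NM' h').
by rewrite -e -e' subrr.
Qed.

Fact gproj_is_zmod n : zmod_morphism (gproj n).
Proof.
move=> x y; have [N hN] := gproj_sum x; have [N' hN'] := gproj_sum y.
rewrite (@gprojE (x - y) (fun i => gproj i x - gproj i y) (maxn N N')) //.
- by move=> i; apply: (grading_subgroup i).2; exact: gproj_deg.
- have out (w : W) K : (forall M, (K <= M)%N -> w = \sum_(i < M) gproj i w) ->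
      forall i, (K <= i)%N -> gproj i w = 0.
    move=> hK i hi; have e1 := hK i hi; have e2 := hK i.+1 (leqW hi).
    rewrite big_ord_recr /= -e1 in e2.
    by apply: (addrI w); rewrite -e2 addr0.
  move=> i; rewrite geq_max => /andP[hi hi'].
  by rewrite (out x N) // (out y N') // subrr.
- rewrite sumrB -hN ?leq_maxl // -hN' ?leq_maxr //.
Qed.
HB.instance Definition _ n := GRing.isZmodMorphism.Build W W (gproj n)
  (gproj_is_zmod n).

Lemma gproj_hom m n x : g n x -> gproj m x = if m == n then x else 0.
Proof.
move=> hx; rewrite (@gprojE x (fun i => if i == n then x else 0) n.+1) //.
- by move=> i; case: eqP => [->//|_]; exact: (grading_subgroup i).1.
- by move=> i hi; rewrite gtn_eqF.
- rewrite big_ord_recr /= eqxx big1 ?add0r // => i _.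
  by rewrite ltn_eqF.
Qed.

End GradingProjections.

Lemma gproj_map (W W' : zmodType) (g : nat -> set W) (g' : nat -> set W')
  (hg : is_grading g) (hg' : is_grading g') (f : {additive W -> W'}) :
  graded_map g g' f -> forall n x, f (gproj hg n x) = gproj hg' n (f x).
Proof.
move=> hf n x; have [N hN] := gproj_sum hg x.
rewrite [in RHS](hN (maxn n.+1 N) (leq_maxr _ _)).
rewrite (raddf_sum f) (raddf_sum (gproj hg' n)).
have hn : (n < maxn n.+1 N)%N by rewrite leq_max leqnn.
rewrite (bigD1 (Ordinal hn)) //= (gproj_hom hg' _ (hf _ _ (gproj_deg hg n x))).
rewrite eqxx big1 ?addr0 // => i; rewrite -val_eqE /= => /negbTE hi.
by rewrite (gproj_hom hg' _ (hf _ _ (gproj_deg hg i x))) eq_sym hi.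
Qed.

Lemma eps0M (S : nzRingType) (V : bimod S S) (x y : tring V) :
  eps0 (x * y) = eps0 x * eps0 y.
Proof. exact: rmorphM. Qed.

(** * The sequence A (x) R -> A (x) A^1 -> A and its minimality *)

Section RelationBimodule.
Variables (S : nzRingType) (A : connected_sring S).
Hypothesis A_strong : strongly_graded A.
Notation T := (TA A).
Notation V := (A1_bimod A).
Notation M := (tensor (A_bimod A) (A1 A)).

Definition tauA : T -> M := tau (etaB := eta A) (g := @piA S A) (@piA_eta S A).
HB.instance Definition _ := GRing.Additive.copy tauA
  (tau (etaB := eta A) (g := @piA S A) (@piA_eta S A)).

Lemma tauAM (x y : T) :
  tauA (x * y) = piA x *: tauA y + tauA (x * tring_eta V (eps0 y)).
Proof. exact: tauM. Qed.

Lemma res_d1_pure (a : A_bimod A) (v : A1 A) :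
  @res_d1 S A (tpure a v) = (a : A) * a1_ring v.
Proof. exact: (tlift_pure (@d1_balanced S A)). Qed.

(** The fundamental formula of Fox calculus: multiplying the derivative out recovers the part of
    positive degree. *)
Lemma res_d1_tauA (t : T) : @res_d1 S A (tauA t) = piA (t - tproj 0 t : T).
Proof.
have h := tau_span (etaB := eta A) (g := @piA S A) (@piA_eta S A) t.
pose Q (u : T * M) := @res_d1 S A u.2 = piA u.1.
apply: (zspan_min (Q := Q) _ _ _ h); rewrite /Q /=; first by rewrite !raddf0.
  by move=> u w /= hu hw; rewrite !raddfB /= hu hw.
by move=> _ [t' [a ->]]; rewrite res_d1_pure rmorphM /= piA_vin.
Qed.

Lemma res_d1_onto (a : A) : eps A a = 0 -> exists u, a = @res_d1 S A u.
Proof.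
have [t <-] := piA_surj A_strong a; rewrite eps_piA => ht; exists (tauA t).
by rewrite res_d1_tauA -eta_eps0 ht !raddf0 addr0.
Qed.

Lemma AV_deg0 (x : M) : @AV_deg S A _ (deg_in1 (A1 A)) 0 x -> x = 0.
Proof.
elim=> {x} [_ [i [j [a [v [e ha hv ->]]]]]||x y _ -> _ ->]; rewrite ?subrr //.
by case: j hv e => [|j] hv; [rewrite hv tpurer0 | rewrite addnS].
Qed.

Fact AprojA_ract k (a : A_bimod A) s : gproj (adegP A) k (ract a s : A) =
  ract (gproj (adegP A) k a : A_bimod A) s.
Proof.
pose f : {additive A -> A} := (eta A s \o* idfun)%R.
have hf : graded_map (adeg A) (adeg A) f.
  by move=> n x hx; rewrite -[n]addn0; apply: adegM => //; exact: adeg_eta.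
exact: (esym (gproj_map (adegP A) (adegP A) hf k a)).
Qed.

Definition AprojA k : {additive M -> M} :=
  @tensor_mapl _ _ _ (A_bimod A) (A_bimod A)
    (gproj (adegP A) k : {additive A -> A}) (@AprojA_ract k) (A1 A).

Lemma AprojA_pure k (a : A_bimod A) v :
  AprojA k (tpure a v) = tpure (gproj (adegP A) k a : A_bimod A) v.
Proof. exact: tensor_mapl_pure. Qed.

Lemma AprojA_deg k n (x : M) : @AV_deg S A _ (deg_in1 (A1 A)) n.+1 x ->
  AprojA k x = if k == n then x else 0.
Proof.
elim=> {x} [_ [i [j [a [v [e ha hv ->]]]]]||x y _ hx _ hy].
- have [->|[j1 _]] : v = 0 \/ j = 1%N /\ True.
  + by case: j hv {e} => [|[|j]] hv; [left| right | left].
  + by rewrite tpurer0 raddf0; case: eqP.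
  + rewrite AprojA_pure (gproj_hom _ _ ha).
    have -> : i = n by move: e; rewrite j1 addn1 => -[].
    by case: eqP => // _; exact: tpurel0.
- by rewrite raddf0; case: eqP.
- by rewrite raddfB /= hx hy; case: eqP; rewrite ?subrr.
Qed.

(** Total degree n + 1 is A^n (x) A^1, so projecting the left factor separates the degrees, and
    degree 0 is zero. *)
Lemma AV_deg_uniq N (f : nat -> M) :
  (forall n, @AV_deg S A _ (deg_in1 (A1 A)) n (f n)) -> \sum_(n < N) f n = 0 ->
  forall n, (n < N)%N -> f n = 0.
Proof.
move=> hf e [|n] hn; first exact: AV_deg0 (hf 0%N).
have := congr1 (AprojA n) e; rewrite raddf0 raddf_sum (bigD1 (Ordinal hn)) //=.
rewrite (AprojA_deg _ (hf n.+1)) eqxx big1 ?addr0 // => -[[|i] hi] /=.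
  by rewrite (AV_deg0 (hf 0%N)) raddf0.
rewrite -val_eqE /= eqSS => /negbTE ni.
by rewrite (AprojA_deg _ (hf i.+1)) eq_sym ni.
Qed.

Lemma AV_deg_scale (U : lmodType S) (gU : nat -> set U) i n (a : A)
    (x : tensor (A_bimod A) U) :
  adeg A i a -> @AV_deg S A _ gU n x -> @AV_deg S A _ gU (i + n) (a *: x).
Proof. by apply: tensor_deg_scale => *; exact: adegM. Qed.

Lemma tauA_deg n (t : T) : tdeg V n t -> @AV_deg S A _ (deg_in1 (A1 A)) n (tauA t).
Proof. by apply: tau_deg => *; [exact: adegM | exact: piA_tdeg]. Qed.

Variable R : subbimod A.
Hypotheses (R_graded : graded_sub R) (R_gen : ideal_gen R = @IA S A).

Lemma sb_val (r : sb_mod R) : sb_set R (val r).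
Proof. by case: r => r /= /asboolP. Qed.

Lemma sb_IA (r : sb_mod R) : IA (val r : T).
Proof. by rewrite -R_gen; exact/ideal_gen_gen/sb_val. Qed.

Definition relmap (r : sb_mod R) : restr (eta A) M := tauA (val r : T).
Fact relmap_linear : linear relmap.
Proof.
move=> s r r'.
have e : val (s *: r + r') = tring_eta V s * val r + val r' :> T.
  by rewrite tring_etaZ.
rewrite /relmap e (raddfD tauA); congr (_ + _); exact: tau_etaM.
Qed.
HB.instance Definition _ := GRing.isLinear.Build S (sb_mod R)
  (restr (eta A) M) _ relmap relmap_linear.

(** The classical second differential with V_2 = R: a relation r = sum t_i a_i goes to sum pi(t_i)
    (x) a_i. *)
Definition d2R : {linear tensor (A_bimod A) (sb_mod R) -> M} :=
  tensor_ext relmap.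

Lemma d2R_pure (a : A) r : d2R (tpure (a : A_bimod A) r) = a *: tauA (val r : T).
Proof. exact: tensor_ext_pure. Qed.

Definition sb_deg n : set (sb_mod R) := [set r | tdeg V n (val r)].

Lemma d2R_deg : graded_map (@AV_deg S A _ sb_deg) (@AV_deg S A _ (deg_in1 (A1 A))) d2R.
Proof.
move=> n x; elim=> {x} [_ [i [j [a [r [<- ha hr ->]]]]]||x y _ hx _ hy].
- by rewrite d2R_pure; apply: AV_deg_scale => //; exact: tauA_deg.
- by rewrite raddf0; exact: zspan0.
- by rewrite raddfB; exact: zspanB.
Qed.

Lemma res_d1_d2R x : @res_d1 S A (d2R x) = 0.
Proof.
elim/tensor_ind: x => [|x y hx hy|a r]; first by rewrite !raddf0.
  by rewrite !raddfB /= hx hy subrr.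
rewrite d2R_pure.
have -> : @res_d1 S A (a *: tauA (val r : T)) = (a : A) * @res_d1 S A (tauA (val r : T)).
  elim/tensor_ind: (tauA _) => [|x y hx hy|b v].
  - by rewrite scaler0 !raddf0 ?mulr0.
  - by rewrite scalerBr !raddfB /= hx hy ?mulrBr.
  - by rewrite -tpureZ !res_d1_pure -mulrA.
rewrite res_d1_tauA (IA_low (sb_IA r)) // subr0.
by have -> := sb_IA r; rewrite mulr0.
Qed.

(** Every u is the derivative of some t in T_+, and d_1 u = 0 says that t lies in I_A = <R>. The
    product rule then reduces tau on <R> to A-multiples of tau on R. *)
Lemma d2R_exact u : @res_d1 S A u = 0 -> exists x, u = d2R x.
Proof.
have him (t : T) : IA t -> exists x, tauA t = d2R x.
  rewrite -{1}R_gen => ht.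
  (* Since pi(t) = 0, right multiplication by b acts on the derivative of t only through the scalar
     eps(b); the claim is therefore strengthened by a scalar on the right. *)
  suff h : forall s, exists x, tauA (t * tring_eta V s) = d2R x.
    by have [x] := h 1; rewrite rmorph1 mulr1 => ->; exists x.
  elim: ht => {t} [r hr s||x y _ hx _ hy s|a t ht IH s|b t ht IH s].
  - have hr' : (r * tring_eta V s : tring V) \in sb_pred R.
      by apply/asboolP; exact: sbMr.
    exists (tpure (1 : A_bimod A) (SBMod hr')).
    by rewrite d2R_pure scale1r.
  - by exists 0; rewrite mul0r !raddf0.
  - have [u' eu] := hx s; have [w ew] := hy s.
    by exists (u' - w); rewrite mulrBl !raddfB /= eu ew.
  - have [x ex] := IH s; exists (piA a *: x).
    have t0 : eps0 (t * tring_eta V s : T) = 0.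
      by rewrite eps0M (IA_eps0 (t := t)) ?mul0r // -R_gen.
    by rewrite -mulrA tauAM t0 !raddf0 mulr0 raddf0 addr0 ex linearZZ.
  - have [x ex] := IH (eps0 (b * tring_eta V s : T)); exists x.
    have t0 : piA t = 0 by have : IA t by rewrite -R_gen.
    by rewrite -mulrA tauAM t0 scale0r add0r ex.
move=> hu.
have [t [et eu]] : exists t : T, tproj 0 t = 0 /\ u = tauA t.
  elim/tensor_ind: u {hu} => [|x y [t [et ->]] [t' [et' ->]]|a v].
  - by exists 0; rewrite !raddf0.
  - by exists (t - t'); rewrite !raddfB /= et et' subrr.
  - have [t <-] := piA_surj A_strong a; exists (t * vin (v : V)); split.
      by rewrite -eta_eps0 eps0M eps0_vin mulr0 raddf0.
    by rewrite /tauA tau_vin.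
rewrite eu; apply: him; rewrite /IA /= -(subr0 t) -et -res_d1_tauA -eu.
exact: hu.
Qed.

(** T_+ is the image of T (x) A^1 under multiplication, and there the derivative is pi (x) A^1,
    whose kernel is known by right exactness. *)
Lemma tauA_ker (t : T) : tproj 0 t = 0 -> tauA t = 0 ->
  zspan [set u | exists t' a, IA (t' : T) /\ u = t' * vin (a : V)] t.
Proof.
move=> t0 ht.
pose TB := ring_bimod (tring_eta V).
have hp (m : TB) b : piA (ract m b : T) = ract (piA (m : T) : A_bimod A) b.
  by rewrite /= rmorphM /= piA_eta.
pose pT : {additive tensor TB (A1 A) -> M} :=
  @tensor_mapl _ _ _ TB (A_bimod A) (@piA S A : {additive T -> A}) hp (A1 A).
have vin_lin : linear (fun a : A1 A => vin (a : V) : restr (tring_eta V) T^o).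
  move=> s a b; rewrite -[vin _]/(vin ((s *: (a : V)) + (b : V))) vinD vinZ.
  by [].
pose vl : {linear A1 A -> restr (tring_eta V) T^o} :=
  HB.pack (fun a : A1 A => vin (a : V) : restr (tring_eta V) T^o)
   (GRing.isLinear.Build S (A1 A) (restr (tring_eta V) T^o) _ _ vin_lin).
have [y [e1 e2]] : exists y, tensor_ext vl y = t - tproj 0 t /\ pT y = tauA t.
  have h := tau_span (etaB := eta A) (g := @piA S A) (@piA_eta S A) t.
  pose Q (u : T * M) := exists y, tensor_ext vl y = u.1 /\ pT y = u.2.
  apply: (zspan_min (Q := Q) _ _ _ h); rewrite /Q /=.
    by exists 0; rewrite !raddf0.
    move=> u w [y [e1 e2]] [y' [e1' e2']]; exists (y - y').
    by rewrite !raddfB /= e1 e2 e1' e2'.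
  move=> _ [t' [a ->]]; exists (tpure (t' : TB) a).
  by rewrite tensor_ext_pure [pT _]tensor_mapl_pure.
rewrite t0 subr0 in e1; rewrite -e1.
rewrite ht in e2; move: e2 => /tensor_mapl_ker h.
have {h} := h (piA_surj A_strong).
elim=> {e1} [_ [t' [a [ht' ->]]]||x x' _ hx _ hx'].
- by rewrite tensor_ext_pure; apply: zspan_gen; exists t', a.
- by rewrite raddf0; exact: zspan0.
- by rewrite raddfB; exact: zspanB.
Qed.

(** The kernel lies in A_+ (x) R. Lifting x to T gives a decomposable relation by [tauA_ker], whose
    indecomposable part r lies in R; since R meets the decomposables in 0, r = 0. *)
Lemma d2R_minimal (hR : relation_bimod R) x : d2R x = 0 ->
  zspan [set u | exists a r, eps A a = 0 /\ u = tpure (a : A_bimod A) r] x.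
Proof.
set X := [set u | _] => hx.
(* For x = sum a_i (x) r_i and lifts t_i of the a_i, w is sum t_i r_i and r is sum eps(a_i) r_i. *)
have [w [r [ew Iw hw hr]]] : exists (w : T) (r : sb_mod R),
    [/\ tauA w = d2R x, IA w, IA_decomposable (w - val r) &
        zspan X (x - tpure (1 : A_bimod A) r)].
  elim/tensor_ind: x {hx} => [|x y [w [r [ew Iw hw hr]]]
      [w' [r' [ew' Iw' hw' hr']]]|a r].
  - exists 0, 0; split.
    + by rewrite !raddf0.
    + by rewrite /IA /= raddf0.
    + by rewrite !raddf0 ?addr0 ?subr0; exact: zspan0.
    + by rewrite tpurer0 subrr; exact: zspan0.
  - exists (w - w'), (r - r'); split.
    + by rewrite !raddfB /= ew ew'.
    + by rewrite /IA /= raddfB /= Iw Iw' subrr.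
    + rewrite (_ : _ - _ = (w - val r) - (w' - val r')); first exact: zspanB.
      by rewrite raddfB /= opprD addrACA -opprD.
    + rewrite (_ : _ - _ = (x - tpure (1 : A_bimod A) r) -
        (y - tpure (1 : A_bimod A) r')); first exact: zspanB.
      by rewrite tpureDr tpureNr opprD addrACA -opprD.
  - have [t et] := piA_surj A_strong a.
    exists (t * val r), (eps0 t *: r); split.
    + rewrite d2R_pure tauAM (IA_eps0 (sb_IA r)) !raddf0 mulr0 raddf0.
      by rewrite addr0 et.
    + by rewrite /IA /= rmorphM /=; have -> := sb_IA r; rewrite mulr0.
    + rewrite (_ : _ - _ = (t - tproj 0 t) * val r); last first.
        by rewrite mulrBl -eta_eps0 tring_etaZ.
      elim/tring_ind: t {et} => [|t t' ht ht'|s|v t _].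
      * by rewrite !raddf0 addr0 mul0r; exact: zspan0.
      * rewrite (_ : _ * _ = (t - tproj 0 t) * val r - (t' - tproj 0 t') * val r).
          exact: zspanB.
        by rewrite -mulrBl raddfB /= opprD addrACA -opprD.
      * by rewrite tproj_eta subrr mul0r; exact: zspan0.
      * rewrite tproj_lmul subr0 lmulE -mulrA; apply: zspan_gen.
        exists (vin v), (t * val r); split; [exact: tdeg_vin | | by left].
        by rewrite /IA /= rmorphM /=; have -> := sb_IA r; rewrite mulr0.
    + rewrite -tpure_bal -tpureBl; apply: zspan_gen.
      exists (a - ract (1 : A_bimod A) (eps0 t) : A), r; split=> //.
      by rewrite raddfB /= mul1r etaK -et eps_piA subrr.
rewrite hx in ew; have w0 : tproj 0 w = 0 by rewrite -eta_eps0 IA_eps0 // raddf0.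
have dw : IA_decomposable w.
  apply: zspan_min (tauA_ker w0 ew); [exact: zspan0 | exact: zspanB |].
  move=> _ [t' [a [ht' ->]]]; apply: zspan_gen.
  by exists (vin (a : V)), t'; split=> //; [exact: tdeg_vin | right].
have r0 : r = 0.
  case: hR => _ _ _ hR; apply: val_inj; rewrite raddf0; apply: hR.
    exact: sb_val.
  by rewrite -[val r](subKr w); apply: zspanB.
by move: hr; rewrite r0 tpurer0 subr0.
Qed.

Fact sb_proj_subproof n (r : sb_mod R) : tproj n (val r) \in sb_pred R.
Proof. by apply/asboolP/R_graded/sb_val. Qed.
Definition sb_proj n (r : sb_mod R) : sb_mod R := SBMod (sb_proj_subproof n r).

Fact sb_proj_linear n : linear (sb_proj n).
Proof.
move=> s r r'; apply: val_inj.
rewrite -[RHS]/(s *: tproj n (val r) + tproj n (val r')) -tprojZ.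
exact: (raddfD (@tproj S V n)).
Qed.
HB.instance Definition _ n := GRing.isLinear.Build S (sb_mod R) (sb_mod R) _
  (sb_proj n) (sb_proj_linear n).

Lemma sb_proj_deg n r : sb_deg n (sb_proj n r).
Proof. exact: (@tdeg_tproj _ V). Qed.

Lemma sb_proj_sum r : exists N, forall M, (N <= M)%N ->
  r = \sum_(i < M) sb_proj i r.
Proof.
have [N hN] := tle_ex (val r); exists N.+1 => -[//|m] Nm; apply: val_inj.
rewrite raddf_sum; apply: tle_sum; exact: tle_le hN.
Qed.

Lemma sb_proj_id n r : sb_deg n r -> sb_proj n r = r.
Proof. by move=> hr; apply: val_inj; exact: tproj_id. Qed.

Lemma sb_deg_low n r : (n < 2)%N -> sb_deg n r -> r = 0.
Proof.
move=> hn /sb_proj_id <-; apply: val_inj.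
by rewrite raddf0; exact: IA_low (sb_IA r) hn.
Qed.

Lemma AV_sb_low n (x : tensor (A_bimod A) (sb_mod R)) : (n < 2)%N ->
  @AV_deg S A _ sb_deg n x -> x = 0.
Proof.
move=> hn; elim=> {x} [_ [i [j [a [r [e ha hr ->]]]]]||x y _ -> _ ->].
- rewrite (sb_deg_low _ hr) ?tpurer0 //.
  by apply: leq_ltn_trans hn; rewrite -e leq_addl.
- by [].
- by rewrite subrr.
Qed.

Lemma zspan_graded (W : zmodType) (G : nat -> set W) x :
  (forall n, subgroup (G n)) -> zspan [set u | exists n, G n u] x ->
  exists f : nat -> W, (forall i, G i (f i)) /\
    exists N, (forall i, (N <= i)%N -> f i = 0) /\ x = \sum_(i < N) f i.
Proof.
move=> hG; elim=> {x} [x [n hx]||x y _ [f [hf [N [h ->]]]] _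
  [f' [hf' [N' [h' ->]]]]].
- exists (fun i => if i == n then x else 0); split=> [i|].
    by case: eqP => [->//|_]; exact: (hG i).1.
  exists n.+1; split=> [i hi|]; first by rewrite gtn_eqF.
  rewrite big_ord_recr /= eqxx big1 ?add0r // => i _.
  by rewrite ltn_eqF.
- exists (fun=> 0); split=> [i|]; first exact: (hG i).1.
  by exists 0%N; rewrite big_ord0.
- exists (fun i => f i - f' i); split=> [i|]; first exact: (hG i).2.
  exists (maxn N N'); split=> [i|].
    by rewrite geq_max => /andP[/h -> /h' ->]; rewrite subrr.
  rewrite sumrB (big_ord_support (leq_maxl N N') h).
  by rewrite (big_ord_support (leq_maxr N N') h').
Qed.

(** [d2R] preserves degrees and those of A (x) A^1 are independent, so each homogeneous summand of x
    is a syzygy. *)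
Lemma d2R_ker_graded x : d2R x = 0 -> exists f,
  [/\ forall i, @AV_deg S A _ sb_deg i (f i), forall i, d2R (f i) = 0 &
      exists N, x = \sum_(i < N) f i].
Proof.
have hG n : subgroup (@AV_deg S A _ sb_deg n).
  by split=> [|? ?]; [exact: zspan0 | exact: zspanB].
have [f [hf [N [h e]]]] : exists f : nat -> _,
    (forall i, @AV_deg S A _ sb_deg i (f i)) /\
    exists N, (forall i, (N <= i)%N -> f i = 0) /\ x = \sum_(i < N) f i.
  apply: (zspan_graded hG); elim/tensor_ind: x => [|x y hx hy|a r].
  - exact: zspan0.
  - exact: zspanB.
  - have [N hN] := gproj_sum (adegP A) a; have [M hM] := sb_proj_sum r.
    rewrite (hM M (leqnn M)) tpure_sumr; apply: zspan_sum => j _.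
    rewrite (hN N (leqnn N)).
    have -> : tpure (\sum_(i < N) gproj (adegP A) i a : A_bimod A) (sb_proj j r) =
        \sum_(i < N) tpure (gproj (adegP A) i a : A_bimod A) (sb_proj j r).
      elim/big_ind2: _ => [|? u ? w <- <-|//]; first exact: tpurel0.
      exact: tpureDl.
    apply: zspan_sum => i _; apply: zspan_gen; exists (i + j)%N.
    apply: zspan_gen; exists (i : nat), (j : nat).
    eexists; eexists; split; [by []| | |reflexivity].
      exact: gproj_deg.
    exact: sb_proj_deg.
move=> hx; exists f; split=> // [i|]; last by exists N.
have [hi|/h ->] := ltnP i N; last exact: raddf0.
apply: (@AV_deg_uniq N (fun i => d2R (f i))) => //.
  by move=> n; exact: d2R_deg.
by rewrite -(raddf_sum d2R) -e.
Qed.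

End RelationBimodule.

Section RestrLinear.
Variables (B C : pzRingType) (eta : {rmorphism B -> C}).
Variables (M N : lmodType C) (f : {linear M -> N}).
Definition restr_map (x : restr eta M) : restr eta N := f x.
Fact restr_map_linear : linear restr_map.
Proof. by move=> b x y; exact: linearP. Qed.
HB.instance Definition _ := GRing.isLinear.Build B (restr eta M) (restr eta N)
  _ restr_map restr_map_linear.
Definition restr_lin : {linear restr eta M -> restr eta N} := restr_map.
End RestrLinear.

(** * Syzygies of [d2R] and Tor_3 *)

Section AugmentationTensor.
Variables (S : nzRingType) (A : connected_sring S) (N : lmodType A).

Lemma tensor_S_pure (w : tensor (S_bimod A) N) :
  exists m, w = tpure (1 : S_bimod A) m.
Proof.
elim/tensor_ind: w => [|x y [m ->] [m' ->]|s m].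
- by exists 0; rewrite tpurer0.
- by exists (m - m'); rewrite tpureDr tpureNr.
- exists (eta A (s : S) *: m); rewrite -tpure_bal; congr tpure.
  by rewrite /= etaK mul1r.
Qed.

(** S (x)_A N is N/A_+ N, by right exactness applied to the augmentation A -> S. *)
Lemma tensor_S_eq0 (m : N) : tpure (1 : S_bimod A) m = 0 ->
  zspan [set u | exists a m', eps A a = 0 /\ u = a *: m'] m.
Proof.
pose AA := ring_bimod (idfun : {rmorphism A -> A}).
have hf (x : AA) b : eps A (ract x b : A) = ract (eps A x : S_bimod A) b.
  exact: rmorphM.
have surj s : exists x : AA, eps A x = s by exists (eta A s); exact: etaK.
pose fS : {additive AA -> S_bimod A} := (eps A : {additive A -> S}).
have id_lin : linear (fun x : N => x : restr (idfun : {rmorphism A -> A}) N).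
  by [].
pose idN : {linear N -> restr (idfun : {rmorphism A -> A}) N} :=
  HB.pack (fun x : N => x : restr (idfun : {rmorphism A -> A}) N)
   (GRing.isLinear.Build A N (restr (idfun : {rmorphism A -> A}) N) _ _ id_lin).
move=> h.
have h0 : @tensor_mapl _ _ _ AA (S_bimod A) fS hf N (tpure (1 : AA) m) = 0.
  rewrite tensor_mapl_pure -[RHS]h; congr tpure; exact: (rmorph1 (eps A)).
move: h0 => /tensor_mapl_ker h1; have {h1} h1 := h1 surj.
have e : m = tensor_ext idN (tpure (1 : AA) m).
  by rewrite tensor_ext_pure; exact/esym/scale1r.
rewrite e; elim: h1 => [_ [a [m' [ha ->]]]||x y _ hx _ hy].
- by rewrite tensor_ext_pure; apply: zspan_gen; exists a, m'.
- by rewrite raddf0; exact: zspan0.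
- by rewrite raddfB; exact: zspanB.
Qed.

End AugmentationTensor.

Lemma subrBB (W : zmodType) (a b c d : W) : (a - b) - (c - d) = (a - c) - (b - d).
Proof. by rewrite opprD addrACA -opprD. Qed.

Lemma subr_sub3 (W : zmodType) (a b c a' b' c' : W) :
  (a - b - c) - (a' - b' - c') = (a - a') - (b - b') - (c - c').
Proof. by rewrite subrBB (subrBB a). Qed.

Lemma scaler_sub3 (B : pzRingType) (W : lmodType B) (a b : B) (x y u : W) :
  a *: (x - y - b *: u) = a *: x - a *: y - (a * b) *: u.
Proof. by rewrite !scalerBr scalerA. Qed.

Section TorComparison.
Variables (S : nzRingType) (A : connected_sring S).
Hypotheses (A_strong : strongly_graded A) (A1_proj : projective (A1 A)).
Variable R : subbimod A.
Hypotheses (R_graded : graded_sub R) (R_gen : ideal_gen R = @IA S A).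
Hypotheses (R_proj : projective (sb_mod R)) (R_rel : relation_bimod R).
Variable F : gresolution A.
Notation M := (tensor (A_bimod A) (A1 A)).
Notation N := (tensor (A_bimod A) (sb_mod R)).
Notation dF := (gres_d F).
Notation dR := (d2R R).
Notation gF n := (gdegP (F n)).

Let setT_closed (X : lmodType S) : forall b (x y : X),
  setT x -> setT y -> setT (b *: x + y).
Proof. by []. Qed.

Lemma res_d1Z (a : A) u : @res_d1 S A (a *: u) = a * @res_d1 S A u.
Proof.
elim/tensor_ind: u => [|x y hx hy|b v].
- by rewrite scaler0 !raddf0 ?mulr0.
- by rewrite scalerBr !raddfB /= hx hy ?mulrBr.
- by rewrite -tpureZ !res_d1_pure -mulrA.
Qed.

Lemma a1_ringP s (a b : A1 A) :
  a1_ring (s *: a + b) = eta A s * a1_ring a + a1_ring b.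
Proof. by []. Qed.

Lemma gproj_dF k n (x : F k.+1) :
  dF k (gproj (gF k.+1) n x) = gproj (gF k) n (dF k x).
Proof. by apply: gproj_map; exact: gres_d_deg. Qed.

Lemma gres_unit : exists2 e : F 0, gdeg (F 0) 0 e & gres_aug F e = (1 : S).
Proof.
have [x hx] := gres_aug_surj F (1 : S); exists (gproj (gF 0) 0 x).
  exact: gproj_deg.
have [m hm] := gproj_sum (gF 0) x.
have h0 i : (0 < i)%N -> gres_aug F (gproj (gF 0) i x) = 0.
  by case: i => // i _; exact: gres_aug_deg (gproj_deg (gF 0) i.+1 x).
move: hx; rewrite {1}(hm m.+1 (leqnSn m)) raddf_sum big_ord_recl big1 ?addr0 //.
by move=> i _; exact: h0.
Qed.

Lemma gres_phi1 (e : F 0) : gdeg (F 0) 0 e ->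
  exists phi : {linear A1 A -> restr (eta A) (F 1%N)}, forall a,
    gdeg (F 1%N) 1 (phi a) /\ dF 0 (phi a) = a1_ring a *: e.
Proof.
move=> he.
have lin : linear (fun a : A1 A => a1_ring a *: e : restr (eta A) (F 0)).
  move=> s a b; rewrite a1_ringP scalerDl -scalerA.
  by [].
pose f : {linear A1 A -> restr (eta A) (F 0)} :=
  HB.pack (fun a : A1 A => a1_ring a *: e : restr (eta A) (F 0))
   (GRing.isLinear.Build S (A1 A) (restr (eta A) (F 0)) _ _ lin).
apply: (projective_lift (g := restr_lin (eta A) (dF 0)) (f := f)
  (U := gdeg (F 1%N) 1) _ _ A1_proj).
- exact: (grading_subgroup (gF 1%N) 1).1.
- move=> b x y hx hy; rewrite -[y]opprK; apply: (grading_subgroup (gF 1%N) 1).2.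
    exact: (gdegZ (adeg_eta A b) hx).
  rewrite -sub0r; apply: (grading_subgroup (gF 1%N) 1).2 => //.
  exact: (grading_subgroup (gF 1%N) 1).1.
move=> a; have ha : gdeg (F 0) 1 (a1_ring a *: e).
  by have := gdegZ (a1_adeg a) he.
have : gres_aug F (a1_ring a *: e) = 0.
  rewrite linearZZ; change (eps A (a1_ring a) * (gres_aug F e : S) = 0).
  by rewrite (eps_pos (a1_adeg a)) mul0r.
case/gres_exact0 => x hx; exists (gproj (gF 1%N) 1 x); first exact: gproj_deg.
change (dF 0 (gproj (gF 1%N) 1 x) = a1_ring a *: e).
by rewrite gproj_dF -hx (gproj_hom _ _ ha).
Qed.

(** The chain map into F must preserve degrees, because the degree of x is to be compared with a
    degree of Tor_3. *)
Lemma gres_phi2 (f1 : {linear M -> F 1%N}) :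
  graded_map (@AV_deg S A _ (deg_in1 (A1 A))) (gdeg (F 1%N)) f1 ->
  (forall u, @res_d1 S A u = 0 -> dF 0 (f1 u) = 0) ->
  exists phi : {linear N -> F 2}, (forall x, dF 1 (phi x) = f1 (dR x)) /\
    graded_map (@AV_deg S A _ (@sb_deg S A R)) (gdeg (F 2)) phi.
Proof.
move=> f1_deg f1_ker.
pose f : {linear sb_mod R -> restr (eta A) (F 1%N)} :=
  (restr_lin (eta A) f1 \o @relmap S A R)%FUN.
have [|h hh] := projective_lift (g := restr_lin (eta A) (dF 1)) (f := f)
  (U := setT) I (@setT_closed _) R_proj.
  move=> r; have : dF 0 (f1 (tauA (val r))) = 0.
    apply: f1_ker; have := res_d1_d2R R_gen (tpure (1 : A_bimod A) r).
    by rewrite d2R_pure scale1r.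
  by case/gres_exactS => x hx; exists x.
pose bd (r : sb_mod R) := projT1 (cid (sb_proj_sum R_graded r)).
(* Projectivity of R gives a lift h that ignores degrees; its homogeneous part sends r_i to the
   degree i component of h(r_i). *)
pose phi (r : sb_mod R) : restr (eta A) (F 2) :=
  \sum_(i < bd r) gproj (gF 2) i (h (sb_proj R_graded i r)).
have sb0 r n : (bd r <= n)%N -> sb_proj R_graded n r = 0.
  rewrite /bd; case: cid => m /= hm mn.
  have e1 := hm n mn; have e2 := hm n.+1 (leqW mn).
  rewrite big_ord_recr /= -e1 in e2.
  by apply: (addrI r); rewrite -e2 addr0.
have phiE r m : (bd r <= m)%N ->
    phi r = \sum_(i < m) gproj (gF 2) i (h (sb_proj R_graded i r)).
  move=> hm; apply/esym.
  apply: (@big_ord_support _ (fun i => gproj (gF 2) i (h (sb_proj R_graded i r)))).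
    exact: hm.
  by move=> i hi; rewrite sb0 // !raddf0.
have lin : linear phi.
  move=> s r r'; pose m := maxn (bd (s *: r + r')) (maxn (bd r) (bd r')).
  have h1 : (bd (s *: r + r')%R <= m)%N by rewrite leq_maxl.
  have h2 : (bd r <= m)%N by rewrite /m !leq_max leqnn orbT.
  have h3 : (bd r' <= m)%N by rewrite /m !leq_max leqnn !orbT.
  rewrite (phiE _ _ h1) (phiE _ _ h2) (phiE _ _ h3) scaler_sumr -big_split /=.
  apply: eq_bigr => i _; rewrite !linearP raddfD; congr (_ + _).
  pose sc : {additive F 2 -> F 2} := ( *:%R (eta A s))%R.
  apply: (esym (gproj_map (gF 2) (gF 2) (f := sc) _ i (h (sb_proj R_graded i r)))).
  by move=> n x; exact: (gdegZ (adeg_eta A s)).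
pose phiL : {linear sb_mod R -> restr (eta A) (F 2)} := HB.pack phi
  (GRing.isLinear.Build S (sb_mod R) (restr (eta A) (F 2)) _ _ lin).
have phi_deg n r : sb_deg n r -> gdeg (F 2) n (phi r).
  move=> hr; have hm := leq_maxr n.+1 (bd r).
  rewrite (phiE _ _ hm).
  have hn : (n < maxn n.+1 (bd r))%N by rewrite leq_max leqnn.
  rewrite (bigD1 (Ordinal hn)) //= big1 ?addr0; first exact: gproj_deg.
  move=> i; rewrite -val_eqE /= => /eqP ni.
  have -> : sb_proj R_graded i r = 0.
    by apply: val_inj; rewrite raddf0; exact: (tproj_tdeg hr).
  by rewrite !raddf0.
exists (tensor_ext phiL); split=> [x|n x].
  elim/tensor_ind: x => [|x y hx hy|a r]; first by rewrite !raddf0.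
    by rewrite !raddfB /= hx hy.
  rewrite tensor_ext_pure d2R_pure !linearZZ; congr (_ *: _).
  change (dF 1 (phi r) = f r).
  have [m hm] := sb_proj_sum R_graded r.
  have hb := leq_maxr m (bd r).
  rewrite (phiE _ _ hb) (raddf_sum (dF 1)).
  rewrite [in RHS](hm _ (leq_maxl m (bd r))) (raddf_sum f).
  apply: eq_bigr => i _; apply: etrans (@gproj_dF 1%N i _) _.
  have -> : dF 1 (h (sb_proj R_graded i r)) = f (sb_proj R_graded i r).
    exact: (hh (sb_proj R_graded i r)).2.
  rewrite (gproj_hom (gF 1%N) _ (n := i)) ?eqxx //.
  by apply/f1_deg/tauA_deg; exact: sb_proj_deg.
elim=> {x} [_ [i [j [a [r [<- ha hr ->]]]]]||x y _ hx _ hy].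
- by rewrite tensor_ext_pure; apply: gdegZ => //; exact: phi_deg.
- by rewrite raddf0; exact: (grading_subgroup (gF 2) n).1.
- by rewrite raddfB; exact: (grading_subgroup (gF 2) n).2.
Qed.

Let d1L : {linear M -> A^o} :=
  HB.pack (@res_d1 S A : M -> A^o)
    (GRing.isZmodMorphism.Build M A^o (@res_d1 S A : M -> A^o)
       (raddfB (@res_d1 S A)))
    (GRing.isScalable.Build A M A^o _ (@res_d1 S A : M -> A^o) res_d1Z).

(** Comparison in the opposite direction, from projectivity of the F_n and exactness of A (x) R -> A
    (x) A^1 -> A -> S. *)
Lemma gres_psi : exists (psi0 : {linear F 0 -> A^o}) (psi1 : {linear F 1%N -> M})
    (psi2 : {linear F 2 -> N}),
  [/\ forall x, eps A (psi0 x) = gres_aug F x,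
      forall x, @res_d1 S A (psi1 x) = psi0 (dF 0 x) &
      forall x, dR (psi2 x) = psi1 (dF 1 x)].
Proof.
have eps_lin : linear (fun x : A^o => eps A x : S_lmod A).
  by move=> a x y; rewrite rmorphD; congr (_ + _); exact: rmorphM.
pose epsL : {linear A^o -> S_lmod A} :=
  HB.pack (fun x : A^o => eps A x : S_lmod A)
    (GRing.isLinear.Build A A^o (S_lmod A) _ _ eps_lin).
have T_closed (X : lmodType A) : forall b (x y : X),
  setT x -> setT y -> setT (b *: x + y) by [].
have [|psi0 h0] := projective_lift (g := epsL) (f := gres_aug F) (U := setT)
  I (T_closed _) (@gres_proj S A F 0).
  move=> x; exists (eta A (gres_aug F x : S)) => //.
  exact: (@etaK S A (gres_aug F x)).
have [|psi1 h1] := projective_lift (g := d1L) (f := (psi0 \o dF 0)%FUN)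
  (U := setT) I (T_closed _) (@gres_proj S A F 1%N).
  move=> x; have : eps A (psi0 (dF 0 x)) = 0.
    by rewrite [LHS](h0 (dF 0 x)).2; apply/gres_exact0; exists x.
  by case/(res_d1_onto A_strong) => u hu; exists u.
have [|psi2 h2] := projective_lift (g := dR) (f := (psi1 \o dF 1)%FUN)
  (U := setT) I (T_closed _) (@gres_proj S A F 2).
  move=> x; have : @res_d1 S A (psi1 (dF 1 x)) = 0.
    rewrite [LHS](h1 (dF 1 x)).2 /=.
    have -> : dF 0 (dF 1 x) = 0 by apply/gres_exactS; exists x.
    exact: raddf0.
  by case/(d2R_exact A_strong R_gen) => u hu; exists u.
exists psi0, psi1, psi2; split=> x.
- exact: (h0 x).2.
- exact: (h1 x).2.
- exact: (h2 x).2.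
Qed.

(* Comparing A (x) R -> A (x) A^1 -> A with F: an element x of ker d2R is     *)
(* psi (phi x) up to A_+ ker d2R, and phi x bounds a 3-chain of F whose class *)
(* in Tor_3 has the degree of x.                                              *)
Lemma tor_gen n x : @AV_deg S A _ (@sb_deg S A R) n x -> dR x = 0 ->
  ~ ((n%:Z - 1)%:E <= hcomplexity F)%E ->
  zspan [set u | exists a x', [/\ u = a *: x', dR x' = 0 & eps A a = 0]] x.
Proof.
move=> hx dx hn; set J := [set u | _].
have [e he ae] := gres_unit.
have [phi1 hphi1] := gres_phi1 he.
pose f1 : {linear M -> F 1%N} := tensor_ext phi1.
have f1_pure (a : A_bimod A) v : f1 (tpure a v) = (a : A) *: (phi1 v : F 1%N).
  exact: tensor_ext_pure.
have d0f1 u : dF 0 (f1 u) = @res_d1 S A u *: e.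
  elim/tensor_ind: u => [|y z hy hz|a v].
  - by rewrite !raddf0 scale0r.
  - by rewrite !raddfB /= hy hz scalerBl.
  - by rewrite f1_pure res_d1_pure linearZZ (hphi1 v).2 scalerA.
have f1_deg : graded_map (@AV_deg S A _ (deg_in1 (A1 A))) (gdeg (F 1%N)) f1.
  move=> k u; elim=> {u} [_ [i [j [a [v [<- ha hv ->]]]]]||y z _ hy _ hz].
  - rewrite f1_pure; have [->|[-> _]] : v = 0 \/ j = 1%N /\ True.
    + by case: j hv => [|[|j]] hv; [left| right | left].
    + by rewrite raddf0 scaler0; exact: (grading_subgroup (gF 1%N) _).1.
    + by apply: gdegZ => //; exact: (hphi1 v).1.
  - by rewrite raddf0; exact: (grading_subgroup (gF 1%N) k).1.
  - by rewrite raddfB; exact: (grading_subgroup (gF 1%N) k).2.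
have [|phi2 [hphi2 phi2_deg]] := gres_phi2 f1_deg.
  by move=> u hu; rewrite d0f1 hu scale0r.
have [psi0 [psi1 [psi2 [hpsi0 hpsi1 hpsi2]]]] := gres_psi.
(* A homotopy between psi phi and the identity starts with s_0(a) = a g0. *)
have [g0 hg0] : exists g0, psi0 e - 1 = @res_d1 S A g0.
  apply: (res_d1_onto A_strong); rewrite raddfB /= hpsi0 ae rmorph1.
  exact: subrr.
(* psi_1 phi_1 - id - s_0 d_1 takes values in ker d_1 = im [d2R], so projectivity of A^1 yields the
   next homotopy s_1. *)
pose k1 (a : A1 A) : restr (eta A) M :=
  psi1 (phi1 a) - tpure (1 : A_bimod A) a - a1_ring a *: g0.
have k1_lin : linear k1.
  move=> s a b; rewrite /k1.
  have e1 : psi1 (phi1 (s *: a + b)) =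
      eta A s *: psi1 (phi1 a) + psi1 (phi1 b).
    rewrite linearP; exact: linearP.
  have e2 : tpure (1 : A_bimod A) (s *: a + b) =
      eta A s *: tpure (1 : A_bimod A) a + tpure (1 : A_bimod A) b.
    by rewrite tpureDr tpure_eta.
  have e3 : a1_ring (s *: a + b) *: g0 =
      eta A s *: (a1_ring a *: g0) + a1_ring b *: g0.
    by rewrite a1_ringP scalerDl -scalerA.
  rewrite e1 e2 e3.
  change (eta A s *: psi1 (phi1 a) + psi1 (phi1 b)
    - (eta A s *: tpure (1 : A_bimod A) a + tpure (1 : A_bimod A) b)
    - (eta A s *: (a1_ring a *: g0) + a1_ring b *: g0) =
    eta A s *: (psi1 (phi1 a) - tpure (1 : A_bimod A) a - a1_ring a *: g0)
    + (psi1 (phi1 b) - tpure (1 : A_bimod A) b - a1_ring b *: g0)).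
  by rewrite !scalerBr !opprD (addrACA (eta A s *: psi1 (phi1 a))) [LHS]addrACA.
pose k1L : {linear A1 A -> restr (eta A) M} := HB.pack k1
  (GRing.isLinear.Build S (A1 A) (restr (eta A) M) _ _ k1_lin).
have [|s1 hs1] := projective_lift (g := restr_lin (eta A) (dR))
  (f := k1L) (U := setT) I (@setT_closed _) A1_proj.
  move=> a; have : @res_d1 S A (k1 a) = 0.
    rewrite /k1 !raddfB /= hpsi1 (hphi1 a).2 linearZZ res_d1_pure mul1r.
    rewrite res_d1Z -hg0 mulrBr mulr1 opprB addrA subrK.
    exact: subrr.
  by case/(d2R_exact A_strong R_gen) => u hu; exists u.
pose s1L : {linear M -> N} := tensor_ext s1.
have hs1L u : dR (s1L u) = psi1 (f1 u) - u - @res_d1 S A u *: g0.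
  elim/tensor_ind: u => [|y z hy hz|a v].
  - by rewrite !raddf0 scale0r !raddf0 !addr0.
  - have e1 : dR (s1L (y - z)) = dR (s1L y) - dR (s1L z) by rewrite !raddfB.
    have e2 : psi1 (f1 (y - z)) = psi1 (f1 y) - psi1 (f1 z) by rewrite !raddfB.
    have e3 : @res_d1 S A (y - z) *: g0 =
        @res_d1 S A y *: g0 - @res_d1 S A z *: g0 by rewrite raddfB scalerBl.
    by rewrite e1 e2 e3 hy hz subr_sub3.
  - rewrite [s1L _]tensor_ext_pure f1_pure (linearZZ dR) (linearZZ psi1).
    rewrite res_d1_pure.
    have -> : dR (s1 v : N) = k1 v by exact: (hs1 v).2.
    have -> : tpure (a : A_bimod A) v = a *: tpure (1 : A_bimod A) v.
      by rewrite -tpureZ; congr tpure; exact/esym/mulr1.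
    exact: scaler_sub3.
(* [s2] is A-linear with values in ker [d2R]; as x lies in A_+ (x) R, [s2 x] lies in A_+ ker
   [d2R]. *)
pose s2 y := psi2 (phi2 y) - y - s1L (dR y).
have s2B y z : s2 (y - z) = s2 y - s2 z.
  have e1 : psi2 (phi2 (y - z)) = psi2 (phi2 y) - psi2 (phi2 z).
    by rewrite !raddfB.
  have e2 : s1L (dR (y - z)) = s1L (dR y) - s1L (dR z) by rewrite !raddfB.
  by rewrite /s2 e1 e2 subr_sub3.
have s2Z a y : s2 (a *: y) = a *: s2 y.
  rewrite /s2 (linearZZ phi2) (linearZZ psi2) (linearZZ dR) (linearZZ s1L).
  by rewrite -!scalerBr.
have ds2 y : dR (s2 y) = 0.
  rewrite /s2 !raddfB /= hs1L hpsi2 hphi2 res_d1_d2R // scale0r subr0.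
  exact: subrr.
have hmin := d2R_minimal A_strong R_gen R_rel dx.
have hs2 : zspan J (s2 x).
  elim: hmin => [_ [a [r [ha ->]]]||y z _ hy _ hz].
  - have -> : tpure (a : A_bimod A) r = a *: tpure (1 : A_bimod A) r.
      by rewrite -tpureZ; congr tpure; exact/esym/mulr1.
    rewrite s2Z; apply: zspan_gen; eexists; eexists; split; [by [] | exact: ds2 | by []].
  - have -> : s2 0 = 0 by have := s2B 0 0; rewrite !subrr.
    exact: zspan0.
  - by rewrite s2B; exact: zspanB.
have ex : x = psi2 (phi2 x) - s2 x.
  have e0 : s1L (dR x) = 0 by rewrite dx raddf0.
  by rewrite /s2 e0 subr0 opprB addrC subrK.
rewrite ex; apply: zspanB => //.
have : dF 1 (phi2 x) = 0 by rewrite hphi2 dx raddf0.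
case/gres_exactS => h0 e0.
have [h hh eh] : exists2 h : F 3, gdeg (F 3) n h & phi2 x = dF 2 h.
  exists (gproj (gF 3) n h0); first exact: gproj_deg.
  by rewrite gproj_dF -e0 (gproj_hom (gF 2) _ (phi2_deg _ _ hx)) eqxx.
(* By minimality phi x lies in A_+ F_2, so it vanishes in S (x) F_2. *)
have cyc : tensor_mapr (S_bimod A) (dF 2) (tpure (1 : S_bimod A) h) = 0.
  rewrite tensor_mapr_pure -eh.
  elim: hmin => [_ [a [r [ha ->]]]||y z _ hy _ hz].
  - have -> : tpure (a : A_bimod A) r = a *: tpure (1 : A_bimod A) r.
      by rewrite -tpureZ; congr tpure; exact/esym/mulr1.
    rewrite linearZZ -tpure_bal.
    have -> : ract (1 : S_bimod A) a = 0 by rewrite /= ha mulr0.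
    exact: tpurel0.
  - by rewrite raddf0 tpurer0.
  - by rewrite raddfB tpureDr tpureNr hy hz subrr.
have [w hw] : exists w, tpure (1 : S_bimod A) h =
    tensor_mapr (S_bimod A) (dF 3) w.
  apply/(homology_class_eq0 (tensor_mapr (S_bimod A) (dF 3)) cyc);
  apply: contrapT => ne.
  case: hn; apply: (complexity_ge (W := Tor3 F) _ ne).
  eexists; last reflexivity.
  apply: zspan_gen; exists 0%N, n, (1 : S_bimod A), h; split=> //.
have [h' eh'] := tensor_S_pure w.
have : tpure (1 : S_bimod A) (h - dF 3 h') = 0.
  by rewrite tpureDr tpureNr hw eh' tensor_mapr_pure subrr.
move=> /tensor_S_eq0 hd.
(* Since Tor_3 has no class in degree n, h agrees with a boundary modulo A_+ F_3. Thus phi x is in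
   A_+ times the boundaries of F_2, and psi carries it to A_+ ker [d2R]. *)
have -> : phi2 x = dF 2 (h - dF 3 h').
  rewrite raddfB /= -eh (_ : dF 2 (dF 3 h') = 0) ?subr0 //.
  by apply/gres_exactS; exists h'.
elim: hd => [_ [a [m [ha ->]]]||y z _ hy _ hz].
- rewrite !linearZZ; apply: zspan_gen; eexists; eexists; split; [by [] | | by []].
  rewrite hpsi2 (_ : dF 1 (dF 2 m) = 0) ?raddf0 //.
  by apply/gres_exactS; exists m.
- by rewrite !raddf0; exact: zspan0.
- by rewrite !raddfB; exact: zspanB.
Qed.

End TorComparison.

(** * Fox derivatives over D *)

Section LocallyFiniteSum.
Variables (B : pzRingType) (U W : lmodType B) (G : nat -> {linear U -> W}).
Hypothesis G_fin : forall u, exists N, forall n, (N <= n)%N -> G n u = 0.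

Let bd u := projT1 (cid (G_fin u)).
Let bdP u n : (bd u <= n)%N -> G n u = 0.
Proof. by rewrite /bd; case: cid => N /= h; exact: h. Qed.

Definition lfsum (u : U) : W := \sum_(n < bd u) G n u.

Let lfsumE u N : (bd u <= N)%N -> lfsum u = \sum_(n < N) G n u.
Proof.
move=> h; apply/esym; apply: (@big_ord_support _ (fun n => G n u)) => // i.
exact: bdP.
Qed.

Fact lfsum_linear : linear lfsum.
Proof.
move=> b u v; pose w := b *: u + v; pose m := maxn (bd w) (maxn (bd u) (bd v)).
have h1 : (bd w <= m)%N by rewrite leq_maxl.
have h2 : (bd u <= m)%N by rewrite /m !leq_max leqnn orbT.
have h3 : (bd v <= m)%N by rewrite /m !leq_max leqnn !orbT.
rewrite (lfsumE h1) (lfsumE h2) (lfsumE h3) scaler_sumr -big_split /=.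
by apply: eq_bigr => i _; rewrite /w linearP.
Qed.
HB.instance Definition _ := GRing.isLinear.Build B U W _ lfsum lfsum_linear.

Lemma lfsum_single u n : (forall m, m <> n -> G m u = 0) -> lfsum u = G n u.
Proof.
move=> h; rewrite (lfsumE (leq_maxr n.+1 (bd u))).
have hn : (n < maxn n.+1 (bd u))%N by rewrite leq_max leqnn.
rewrite (bigD1 (Ordinal hn)) //= big1 ?addr0 // => i.
by rewrite -val_eqE /= => /eqP /h.
Qed.

End LocallyFiniteSum.

Lemma scale_swap (B : pzRingType) (W : lmodType B) (z c : B) (x y u v : W) :
  z * c = c * z -> z *: (c *: x + y) + (c *: u + v) =
  c *: (z *: x + u) + (z *: y + v).
Proof. by move=> zc; rewrite !scalerDr !scalerA zc addrACA. Qed.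

Lemma scale_swapD (B : pzRingType) (W : lmodType B) (z c d : B) (x y v : W) :
  z * c = c * z -> z *: (c *: x + y) + (d *: x + v) =
  (c * z + d) *: x + (z *: y + v).
Proof. by move=> zc; rewrite !scalerDr scalerDl scalerA zc addrACA. Qed.

Section CentralExtensionTau.
Variables (S : nzRingType) (A : connected_sring S).
Variable P : subbimod A.
Notation T := (TA A).
Notation V := (A1_bimod A).
Notation D := (Dring P).
Notation cls := (rquot_class (Pstar P)).
Notation z := (Dz P).
Notation MD := (tensor (D_bimod P) (A1 A)).

Section Projection.
Hypothesis P_gen : ideal_gen (RP P) = @IA S A.

Lemma Pstar_coef0 (q : {poly T}) : ideal_gen (Pstar P) q -> IA (q`_0 : T).
Proof.
rewrite /IA; elim=> {q} [_ [d [a [Pa ha _ ->]]]||x y _ hx _ hy|a x _ hx|a x _ hx] /=.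
- rewrite coef_star subn0 /=; have := ideal_gen_gen (RP_lead Pa ha).
  by rewrite P_gen.
- by rewrite coef0 raddf0.
- by rewrite coefB raddfB /= hx hy subrr.
- by rewrite coef0M rmorphM /= hx mulr0.
- by rewrite coef0M rmorphM /= hx mul0r.
Qed.

Lemma central_projection : exists p : {rmorphism D -> A},
  forall q : {poly T}, p (cls q) = piA q`_0.
Proof.
pose f (x : D) : A := piA ((repr x : {poly T})`_0 : T).
have fE q : f (cls q) = piA (q`_0 : T).
  apply/eqP; rewrite -subr_eq0 -raddfB -coefB; apply/eqP/Pstar_coef0/rquot_eq.
  by rewrite /rquot_class reprK.
have fB : zmod_morphism f.
  elim/rquot_ind=> x; elim/rquot_ind=> y.
  have -> : cls x - cls y = cls (x - y) by rewrite raddfB.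
  by rewrite !fE coefB raddfB.
have fM : monoid_morphism f.
  split; first by rewrite -(rmorph1 cls) fE coefC eqxx rmorph1.
  elim/rquot_ind=> x; elim/rquot_ind=> y.
  have -> : cls x * cls y = cls (x * y) by rewrite rmorphM.
  by rewrite !fE coef0M rmorphM.
pose p : {rmorphism D -> A} := HB.pack f
  (GRing.isZmodMorphism.Build D A f fB) (GRing.isMonoidMorphism.Build D A f fM).
by exists p.
Qed.

End Projection.

Definition jD : {rmorphism T -> D} := (cls \o @polyC T)%FUN.

Lemma jD_eta s : jD (tring_eta V s) = D_eta P s. Proof. by []. Qed.

Definition tauD : T -> MD := tau (etaB := D_eta P) (g := jD) jD_eta.
HB.instance Definition _ := GRing.Additive.copy tauD
  (tau (etaB := D_eta P) (g := jD) jD_eta).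

Lemma tauDM (x y : T) :
  tauD (x * y) = cls x%:P *: tauD y + tauD (x * tring_eta V (eps0 y)).
Proof. exact: tauM. Qed.

Lemma tauD_eta s : tauD (tring_eta V s) = 0. Proof. exact: tau_eta. Qed.

Lemma tauD_vin (t : T) (a : A1 A) :
  tauD (t * vin (a : V)) = tpure (cls t%:P : D_bimod P) a.
Proof. exact: tau_vin. Qed.

(** The z-linear extension of the derivative to T[z], relative to the augmentation T[z] -> S[z]
    given by [epsz]. *)
Definition tauz (q : {poly T}) : MD := \sum_(i < size q) z ^+ i *: tauD q`_i.

Lemma tauzE (q : {poly T}) n : (size q <= n)%N -> tauz q = \sum_(i < n) z ^+ i *: tauD q`_i.
Proof.
move=> h; apply/esym.
apply: (@big_ord_support _ (fun i => z ^+ i *: tauD q`_i)) => // i hi.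
by rewrite nth_default // raddf0 scaler0.
Qed.

Fact tauz_is_zmod : zmod_morphism tauz.
Proof.
move=> p q; pose n := maxn (size (p - q)) (maxn (size p) (size q)).
rewrite (@tauzE (p - q) n) ?leq_maxl // (@tauzE p n) ?(@tauzE q n).
- rewrite -sumrB; apply: eq_bigr => i _.
  by rewrite coefB raddfB scalerBr.
- by rewrite /n !leq_max leqnn !orbT.
- by rewrite /n !leq_max leqnn !orbT.
Qed.
HB.instance Definition _ := GRing.isZmodMorphism.Build {poly T} MD tauz
  tauz_is_zmod.

Lemma tauzB p q : tauz (p - q) = tauz p - tauz q.
Proof. exact: raddfB. Qed.

Lemma tauzD p q : tauz (p + q) = tauz p + tauz q.
Proof. exact: raddfD. Qed.

Lemma tauzX (q : {poly T}) : tauz (q * 'X) = z *: tauz q.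
Proof.
rewrite (@tauzE (q * 'X) (size q).+1) ?size_mulX_leq //; last first.
  by have [->|q0] := eqVneq q 0; rewrite ?mul0r ?size_poly0 // size_mulX.
rewrite big_ord_recl coefMX /= raddf0 scaler0 add0r scaler_sumr.
by apply: eq_bigr => i _; rewrite coefMX /= exprS scalerA.
Qed.

Lemma tauzC t : tauz t%:P = tauD t.
Proof.
by rewrite (@tauzE _ 1) ?size_polyC_leq1 // big_ord1 coefC scale1r.
Qed.

Lemma tauzXC (q : {poly T}) c : tauz (q * 'X + c%:P) = z *: tauz q + tauD c.
Proof. by rewrite (raddfD tauz) /= tauzX tauzC. Qed.

Lemma tauzXn (q : {poly T}) k : tauz (q * 'X^k) = z ^+ k *: tauz q.
Proof.
elim: k => [|k IHk]; first by rewrite mulr1 scale1r.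
rewrite exprSr mulrA tauzX IHk exprS; exact: scalerA.
Qed.

Definition epsz (q : {poly T}) : {poly T} := map_poly (tring_eta V \o @eps0 S V) q.
HB.instance Definition _ := GRing.RMorphism.copy epsz
  (map_poly (tring_eta V \o @eps0 S V)).

Lemma epszX : epsz 'X = 'X. Proof. exact: map_polyX. Qed.

Lemma epszC t : epsz t%:P = (tring_eta V (eps0 t))%:P.
Proof. exact: map_polyC. Qed.

Lemma epszM p q : epsz (p * q) = epsz p * epsz q.
Proof. exact: rmorphM. Qed.

Lemma epszXC q c :
  epsz (q * 'X + c%:P) = epsz q * 'X + (tring_eta V (eps0 c))%:P.
Proof. by rewrite rmorphD rmorphM /= epszX epszC. Qed.

Lemma coef_epsz q i : (epsz q)`_i = tring_eta V (eps0 q`_i).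
Proof. exact: coef_map. Qed.

Lemma epsz_idem q : epsz (epsz q) = epsz q.
Proof. by apply/polyP => i; rewrite !coef_epsz eps0_eta. Qed.

Lemma tauz_epsz q : tauz (epsz q) = 0.
Proof.
elim/poly_ind: q => [|q c IHq]; first by rewrite !raddf0.
by rewrite epszXC raddfD /= tauzX IHq scaler0 tauzC tauD_eta addr0.
Qed.

Lemma tauzM p q : tauz (p * q) = cls p *: tauz q + tauz (p * epsz q).
Proof.
elim/poly_ind: p => [|p c IHp].
  by rewrite !mul0r !raddf0 scale0r addr0.
have e w : (p * 'X + c%:P) * w = p * w * 'X + c%:P * w.
  by rewrite mulrDl -!mulrA commr_polyX.
rewrite !e !(raddfD tauz) /= !tauzX IHp.
have -> : tauz (c%:P * q) = cls c%:P *: tauz q + tauz (c%:P * epsz q).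
  elim/poly_ind: q {IHp} => [|q b IHq].
    by rewrite !raddf0 !mulr0 !raddf0 ?scaler0 addr0.
  have e' w b' : c%:P * (w * 'X + b'%:P) = c%:P * w * 'X + (c * b')%:P.
    by rewrite mulrDr mulrA polyCM.
  rewrite epszXC !e' !(raddfD tauz) /= !tauzX IHq.
  rewrite !tauzC tauDM; exact/scale_swap/DzC.
rewrite rmorphD rmorphM /=; exact/scale_swapD/DzC.
Qed.

Lemma tauz_etaM s q : tauz ((tring_eta V s)%:P * q) = D_eta P s *: tauz q.
Proof.
rewrite tauzM (_ : _ * epsz q = epsz ((tring_eta V s)%:P * q)).
  by rewrite tauz_epsz addr0.
by rewrite rmorphM /= epszC eps0_eta.
Qed.

(** The augmentation of q divided by z, the division being done in S[z] because z may have torsion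
    in D; [z_e1] is the defining property. *)
Definition e1 (q : {poly T}) : D := cls (drop_poly 1 (epsz q)).

Lemma clsXC (q : {poly T}) c : cls (q * 'X + c%:P) = cls q * z + cls c%:P.
Proof. by rewrite rmorphD rmorphM. Qed.

Lemma drop_poly1X (q : {poly T}) : drop_poly 1 (q * 'X) = q.
Proof. by apply/polyP => i; rewrite coef_drop_poly coefMX addn1. Qed.

Lemma epsz_drop (q : {poly T}) : eps0 q`_0 = 0 -> epsz q = drop_poly 1 (epsz q) * 'X.
Proof.
move=> h; apply/polyP => -[|i]; first by rewrite coefMX coef_epsz h raddf0.
by rewrite coefMX coef_drop_poly addn1.
Qed.

Fact e1_is_zmod : zmod_morphism e1.
Proof.
by move=> p q; rewrite /e1 !raddfB.
Qed.
HB.instance Definition _ := GRing.isZmodMorphism.Build {poly T} D e1 e1_is_zmod.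

Lemma e1B p q : e1 (p - q) = e1 p - e1 q.
Proof. exact: raddfB. Qed.

Lemma e1D p q : e1 (p + q) = e1 p + e1 q.
Proof. exact: raddfD. Qed.

Lemma e1_mulX q : e1 (q * 'X) = cls (epsz q).
Proof.
by rewrite /e1 rmorphM /= epszX drop_poly1X.
Qed.

Lemma e1_mul (p q : {poly T}) : eps0 q`_0 = 0 -> e1 (p * q) = cls (epsz p) * e1 q.
Proof.
move=> h; rewrite /e1 rmorphM /= (epsz_drop h) mulrA !drop_poly1X.
exact: rmorphM.
Qed.

Lemma z_e1 (q : {poly T}) : eps0 q`_0 = 0 -> z * e1 q = cls (epsz q).
Proof. by move=> h; rewrite (epsz_drop h) rmorphM /= DzC. Qed.

Lemma e1_etaM s q : e1 ((tring_eta V s)%:P * q) = D_eta P s * e1 q.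
Proof.
rewrite /e1 rmorphM /= epszC eps0_eta /D_eta /= -rmorphM; congr (cls _).
by apply/polyP => i; rewrite coef_drop_poly !coefCM coef_drop_poly.
Qed.

Fact sigmaD_linear :
  linear (fun a : A1 A => jD (vin (a : V)) : restr (D_eta P) (Dring P)^o).
Proof.
move=> s a b; rewrite -[vin _]/(vin ((s *: (a : V)) + (b : V))) vinD vinZ.
by rewrite rmorphD rmorphM.
Qed.
Definition sigmaD : {linear A1 A -> restr (D_eta P) (Dring P)^o} :=
  HB.pack (fun a : A1 A => jD (vin (a : V)) : restr (D_eta P) (Dring P)^o)
    (GRing.isLinear.Build S (A1 A) (restr (D_eta P) (Dring P)^o) _ _
       sigmaD_linear).

Lemma par1D_pure (d : D_bimod P) (a : A1 A) :
  par1 sigmaD (tpure d a) = (d : D) * cls (vin (a : V))%:P.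
Proof. exact: par1_pure. Qed.

Lemma par1_sigmaB u w :
  par1 sigmaD (u - w) = par1 sigmaD u - par1 sigmaD w.
Proof. exact: raddfB. Qed.

Lemma par1_sigmaD u w :
  par1 sigmaD (u + w) = par1 sigmaD u + par1 sigmaD w.
Proof. exact: raddfD. Qed.

Lemma par1_tauD t : par1 sigmaD (tauD t) = cls (t - tproj 0 t)%:P.
Proof.
have h := tau_span (etaB := D_eta P) (g := jD) jD_eta t.
pose Q (u : T * MD) := par1 sigmaD u.2 = cls u.1%:P.
apply: (zspan_min (Q := Q) _ _ _ h); rewrite /Q /=; first by rewrite !raddf0.
  by move=> u w /= hu hw; rewrite polyCB !raddfB /= hu hw.
by move=> _ [t' [a ->]]; rewrite par1D_pure polyCM rmorphM.
Qed.

(** The fundamental formula over D. For q in <P^*> the right side is -z [e1 q], which produces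
    partial_1 partial_2 = -z f_2. *)
Lemma par1_tauz q : par1 sigmaD (tauz q) = cls q - cls (epsz q).
Proof.
elim/poly_ind: q => [|q c IHq]; first by rewrite !raddf0 addr0.
rewrite epszXC (raddfD tauz) (raddfD (par1 _)) /=.
rewrite tauzX tauzC par1_tauD par1_scale IHq -eta_eps0 polyCB.
by rewrite !clsXC rmorphB /= DzC mulrBl opprD addrACA.
Qed.

Lemma tauD_deg n (t : T) : tdeg V n t -> @DV_deg S A P _ (deg_in1 (A1 A)) n (tauD t).
Proof. by apply: tau_deg => *; [exact: DdegM | exact: Ddeg_clsC]. Qed.

Lemma Ddeg_zn k : @Ddeg S A P k (z ^+ k).
Proof.
elim: k => [|k IHk]; first exact: (Ddeg_clsC P (tdeg_eta V 1)).
by rewrite exprS -add1n; apply: DdegM => //; exact: Ddeg_z.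
Qed.

Lemma tauz_star_deg n (t : T) : @DV_deg S A P _ (deg_in1 (A1 A)) n (tauz (star n t)).
Proof.
rewrite /star (raddf_sum tauz); apply: zspan_sum => i _ /=; rewrite tauzXn tauzC.
have hi : (i <= n)%N by rewrite -ltnS.
suff : @DV_deg S A P _ (deg_in1 (A1 A)) (n - i + i)
    (z ^+ (n - i) *: tauD (tproj i t : T)) by rewrite subnK.
apply: tensor_deg_scale.
- by move=> *; exact: DdegM.
- exact: Ddeg_zn.
- by apply: tauD_deg; exact: tdeg_tproj.
Qed.

Lemma e1_star_deg n (t : T) : @Ddeg S A P n (e1 (star n.+1 t)).
Proof.
have -> : e1 (star n.+1 t) = cls ((tproj 0 t : T)%:P * 'X^n).
  rewrite /e1; congr (cls _); apply/polyP => i.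
  rewrite coef_drop_poly coef_epsz coef_star coefCM coefXn addn1 ltnS.
  case: ltngtP => hi; rewrite ?raddf0 ?mulr0 //.
    rewrite eta_eps0 tproj_tproj; case: eqP => // e.
    by move: hi; rewrite -subn_gt0 -subSS -e.
  by rewrite hi subnn eta_eps0 tproj_tproj mulr1.
by have := Ddeg_cls P n (@tdeg_tproj _ V 0 t).
Qed.

End CentralExtensionTau.

(** * Part (2): P is the image of a filtered map *)

Section FilteredMap.
Variables (S : nzRingType) (A : connected_sring S).
Hypotheses (A_strong : strongly_graded A) (A1_proj : projective (A1 A)).
Variable R : subbimod A.
Hypotheses (R_graded : graded_sub R) (R_gen : ideal_gen R = @IA S A).
Notation T := (TA A).
Notation V := (A1_bimod A).
Variable alpha : {linear sb_mod R -> tring V}.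
Hypothesis alphaM : forall r s,
  alpha (sb_mod_ract r s) = alpha r * tring_eta V s.
Hypothesis alpha_filt : forall n r, tdeg V n (sbval r) ->
  tle V n (alpha r) /\ tproj n (alpha r) = sbval r.

Fact range0 : range alpha 0.
Proof. by exists 0; rewrite ?raddf0. Qed.
Fact rangeB x y : range alpha x -> range alpha y -> range alpha (x - y).
Proof. by move=> [r _ <-] [r' _ <-]; exists (r - r'); rewrite ?raddfB. Qed.
Fact rangeMl s x : range alpha x -> range alpha (tring_eta V s * x).
Proof.
by move=> [r _ <-]; exists (s *: r) => //; rewrite tring_etaZ; exact: linearZZ.
Qed.
Fact rangeMr s x : range alpha x -> range alpha (x * tring_eta V s).
Proof. by move=> [r _ <-]; exists (sb_mod_ract r s). Qed.

Definition range_sb : subbimod A := SubBimod range0 rangeB rangeMl rangeMr.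
Notation P := range_sb.

Lemma alpha_le n r : tle V n (sbval r) ->
  tle V n (alpha r) /\ tproj n (alpha r) = tproj n (sbval r).
Proof.
move=> hr; have -> : alpha r = \sum_(i < n.+1) alpha (sb_proj R_graded i r).
  rewrite -(raddf_sum alpha); congr (alpha _); apply: val_inj.
  by rewrite raddf_sum; exact: tle_sum.
have h i := alpha_filt (@sb_proj_deg S A R R_graded i r).
have hle i : (i <= n)%N -> tle V n (alpha (sb_proj R_graded i r)).
  by move=> hi; apply: tle_le hi _; exact: (h i).1.
split.
  apply: closed_sum; [exact: (tle_subgroup V n).1|exact: (tle_subgroup V n).2|].
  by move=> i _; apply: hle; rewrite -ltnS.
rewrite raddf_sum /= big_ord_recr /= (h n).2 big1 ?add0r //.
by move=> i _; exact: (tle_tproj _ _).1 (h i).1 _ (ltn_ord i).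
Qed.

(** [alpha] cannot lower degrees: the top component of r is also that of [alpha r]. *)
Lemma alpha_le_inv n r : tle V n (alpha r) -> tle V n (sbval r).
Proof.
move=> hn; have [N hN] := tle_ex (sbval r).
have [k] := ubnP (N - n); elim: k N hN => // k IHk N hN hk.
have [Nn|nN] := leqP N n; first exact: tle_le hN.
case: N hN hk nN => // N hN hk nN.
apply: (IHk N); last by move: hk; rewrite subSn.
apply/tle_tproj => m; rewrite leq_eqVlt => /orP[/eqP <-|hm].
  by rewrite -(alpha_le hN).2; exact: (tle_tproj _ _).1 hn _ nN.
exact: (tle_tproj _ _).1 hN _ hm.
Qed.

Lemma R_sub_RP : R `<=` RP P.
Proof.
move=> x hx n; have hx' : x \in sb_pred R by apply/asboolP.
have [h1 h2] := alpha_filt (@sb_proj_deg S A R R_graded n (SBMod hx')).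
exists (alpha (sb_proj R_graded n (SBMod hx'))); first by split=> //; eexists.
by rewrite h2.
Qed.

(** By [alpha_le_inv], a leading form of an element of P is a homogeneous component of an element of
    R. *)
Lemma RP_range_gen : ideal_gen R = ideal_gen (RP P).
Proof.
apply/seteqP; split=> x; apply: ideal_gen_min => {}x hx.
  exact/ideal_gen_gen/R_sub_RP.
have [N hN] := tle_ex x; rewrite (tle_sum hN); apply: ideal_gen_sum => i _.
have [y [[r _ <-] hy] ->] := hx i.
rewrite (alpha_le (alpha_le_inv hy)).2; apply: ideal_gen_gen.
exact/R_graded/sb_val.
Qed.

Let P_gen : ideal_gen (RP P) = @IA S A.
Proof. by rewrite -RP_range_gen. Qed.

Notation D := (Dring P).
Notation cls := (rquot_class (Pstar P)).
Notation z := (Dz P).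
Notation MD := (tensor (D_bimod P) (A1 A)).
Notation tauP := (tauz P).
Notation e1P := (e1 P).
Notation epsz := (@epsz S A).

Lemma alpha_star_eps0 n r : sb_deg n r -> eps0 (star n (alpha r))`_0 = 0.
Proof.
move=> hr; rewrite coef_star leq0n subn0 (alpha_filt hr).2.
exact: IA_eps0 (sb_IA R_gen r).
Qed.

Section Pieces.
Variables (W : lmodType D) (f : {additive {poly T} -> W}).
Hypothesis fZ : forall s q, f ((tring_eta V s)%:P * q) = D_eta P s *: f q.

(** Homogenization depends on the degree, so each component of r is treated separately; [pieces]
    sums these locally finite contributions. *)
Definition piece n (r : sb_mod R) : restr (D_eta P) W :=
  f (star n (alpha (sb_proj R_graded n r))).
Fact piece_linear n : linear (piece n).
Proof.
move=> s r r'; rewrite /piece !linearP [star _ _]raddfD raddfD /=.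
congr (_ + _); rewrite -[RHS]fZ; congr (f _).
have e0 : star 0 (tring_eta V s : T) = (tring_eta V s)%:P.
  by rewrite (star_mono (tdeg_eta V s)) // mulr1.
rewrite -e0 -starM ?add0n -?tring_etaZ //; first exact/tdeg_tle/tdeg_eta.
exact: (alpha_filt (@sb_proj_deg S A R R_graded n r)).1.
Qed.
HB.instance Definition _ n := GRing.isLinear.Build S (sb_mod R)
  (restr (D_eta P) W) _ (piece n) (piece_linear n).

Fact piece_fin r : exists N, forall n, (N <= n)%N -> piece n r = 0.
Proof.
have [N hN] := tle_ex (val r); exists N.+1 => n hn.
have e : sb_proj R_graded n r = 0.
  by apply: val_inj; rewrite raddf0; exact: (tle_tproj _ _).1 hN _ hn.
by rewrite /piece e !raddf0.
Qed.

Definition pieces : {linear sb_mod R -> restr (D_eta P) W} :=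
  lfsum (G := fun n => piece n : {linear sb_mod R -> restr (D_eta P) W})
    piece_fin.

Lemma pieces_deg n r : sb_deg n r -> pieces r = f (star n (alpha r)).
Proof.
move=> hr; have e m : m <> n -> sb_proj R_graded m r = 0.
  by move=> mn; apply: val_inj; rewrite raddf0; exact: (tproj_tdeg hr).
have h : pieces r = piece n r.
  apply: lfsum_single => m /e em.
  by rewrite -[LHS]/(f (star m (alpha (sb_proj R_graded m r)))) em !raddf0.
by rewrite h /piece (sb_proj_id R_graded hr).
Qed.

End Pieces.

(** On homogeneous r this is the derivative of alpha(r)^*, a lift of [d2R] since setting z = 0
    leaves r; [f2R] is the augmentation of alpha(r)^* divided by z. *)
Definition par2R : {linear tensor (D_bimod P) (sb_mod R) -> MD} :=
  tensor_ext (pieces (f := tauP) (@tauz_etaM S A P)).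
Definition f2R : {linear tensor (D_bimod P) (sb_mod R) -> (Dring P)^o} :=
  tensor_ext (pieces (W := (Dring P)^o) (f := e1P) (@e1_etaM S A P)).

Lemma par2R_pure n (d : D) r : sb_deg n r ->
  par2R (tpure (d : D_bimod P) r) = d *: tauP (star n (alpha r)).
Proof. by move=> hr; rewrite [LHS]tensor_ext_pure (pieces_deg _ hr). Qed.

Lemma f2R_pure n (d : D) r : sb_deg n r ->
  f2R (tpure (d : D_bimod P) r) = d * e1P (star n (alpha r)).
Proof. by move=> hr; rewrite [LHS]tensor_ext_pure (pieces_deg _ hr). Qed.

Lemma par2R_scale (d : D) u : par2R (d *: u) = d *: par2R u.
Proof. exact: linearZZ. Qed.

Lemma f2R_scale (d : D) u : f2R (d *: u) = d * f2R u.
Proof. exact: linearZZ. Qed.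

Lemma sb_tensor_ind (Q : tensor (D_bimod P) (sb_mod R) -> Prop) : Q 0 ->
  (forall x y, Q x -> Q y -> Q (x - y)) ->
  (forall n (d : D) r, sb_deg n r -> Q (tpure (d : D_bimod P) r)) ->
  forall u, Q u.
Proof.
move=> h0 hB h; elim/tensor_ind=> // d r.
have [N hN] := sb_proj_sum R_graded r; rewrite (hN N (leqnn N)) tpure_sumr.
apply: closed_sum => // i _; apply: (h i); exact: sb_proj_deg.
Qed.

Lemma par2R_deg : graded_map (@DV_deg S A P _ (@sb_deg S A R))
  (@DV_deg S A P _ (deg_in1 (A1 A))) par2R.
Proof.
move=> n x; elim=> {x} [_ [i [j [d [r [<- hd hr ->]]]]]||x y _ hx _ hy].
- rewrite (par2R_pure _ hr); apply: tensor_deg_scale => //.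
    by move=> *; exact: DdegM.
  exact: tauz_star_deg.
- by rewrite raddf0; exact: zspan0.
- by rewrite raddfB; exact: zspanB.
Qed.

Lemma f2R_deg : graded_map (@DV_deg S A P _ (@sb_deg S A R))
  (deg_shift (@Ddeg S A P)) f2R.
Proof.
have sub n : subgroup (deg_shift (@Ddeg S A P) n).
  case: n => [|n]; last exact: Ddeg_subgroup.
  by split=> // x y -> ->; exact: subrr.
move=> n x; elim=> {x} [_ [i [j [d [r [<- hd hr ->]]]]]||x y _ hx _ hy].
- case: j hr => [|j] hr.
    by rewrite (sb_deg_low R_graded R_gen _ hr) // tpurer0 raddf0; exact: (sub _).1.
  rewrite (f2R_pure _ hr) addnS; apply: DdegM => //; exact: e1_star_deg.
- rewrite raddf0; exact: (sub _).1.
- by rewrite raddfB; exact: (sub _).2.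
Qed.

Lemma par1_par2R x : par1 (sigmaD P) (par2R x) = - (z * f2R x).
Proof.
elim/sb_tensor_ind: x => [|x y hx hy|n d r hr].
- by rewrite !raddf0 mulr0 oppr0.
- rewrite (raddfB par2R) par1_sigmaB (raddfB f2R) /= hx hy mulrBr.
  by rewrite opprB opprK addrC.
rewrite (par2R_pure _ hr) (f2R_pure _ hr) par1_scale par1_tauz.
rewrite -(z_e1 _ (alpha_star_eps0 hr)).
have -> : cls (star n (alpha r)) = 0.
  apply/rquot_eq0; apply: star_Pstar; last exact: (alpha_filt hr).1.
  by exists r.
by rewrite sub0r mulrN mulrA -DzC mulrA.
Qed.

Section WithProjection.
Variable p : {rmorphism D -> A}.
Hypothesis pE : forall q : {poly T}, p (cls q) = piA q`_0.

Lemma pi_tauz q : pi_tensor pE (A1 A) (tauP q) = tauA (q`_0 : T).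
Proof.
elim/poly_ind: q => [|q c IHq]; first by rewrite coef0 !raddf0.
rewrite tauzXC (raddfD (pi_tensor pE (A1 A))) pi_scale.
rewrite (p_z pE) scale0r add0r.
rewrite coefD coefMX coefC /= add0r.
apply: tau_map => [t u|v].
  apply: etrans (pi_scale pE _ _) _; congr (_ *: _); exact: (pC pE).
apply: etrans (pi_pure pE _ _) _; congr tpure; exact: (rmorph1 p).
Qed.

Lemma pi_par2R x :
  pi_tensor pE (A1 A) (par2R x) = d2R R (pi_tensor pE (sb_mod R) x).
Proof.
elim/sb_tensor_ind: x => [|x y hx hy|n d r hr].
- by rewrite !raddf0.
- by rewrite !raddfB /= hx hy.
rewrite (par2R_pure _ hr) pi_scale pi_pure d2R_pure pi_tauz.
by rewrite coef_star leq0n subn0 (alpha_filt hr).2.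
Qed.

End WithProjection.

(* (tauP q, e1P q) is left D-linear in q in <P^*> modulo the image of delta_2, *)
(* so that membership in that image is decided on the generators of <P^*>.    *)
Let im (q : {poly T}) : Prop :=
  exists (u : tensor (D_bimod P) (sb_mod R)) (w : MD),
    tauP q = par2R u - z *: w /\ e1P q = par1 (sigmaD P) w + f2R u.

Let im0 : im 0.
Proof. by exists 0, 0; rewrite !raddf0 ?scaler0 ?addr0 ?subrr. Qed.

Let imB x y : im x -> im y -> im (x - y).
Proof.
move=> [u [w [h h']]] [u' [w' [k k']]]; exists (u - u'), (w - w').
rewrite tauzB e1B h h' k k'; split.
  by rewrite (raddfB par2R) scalerBr /= subrBB.
by rewrite par1_sigmaB (raddfB f2R) /= opprD addrACA.
Qed.

Let imD x y : im x -> im y -> im (x + y).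
Proof.
move=> hx hy; rewrite -[y]opprK; apply: imB => //.
by rewrite -sub0r; exact: imB im0 hy.
Qed.

Let imX (q : {poly T}) : eps0 q`_0 = 0 -> im q -> im (q * 'X).
Proof.
move=> h0 [u [w [h h']]]; exists (z *: u), (z *: w).
rewrite tauzX h e1_mulX -(z_e1 P h0) h'; split.
  by rewrite par2R_scale scalerBr.
by rewrite mulrDr par1_scale f2R_scale.
Qed.

Let im_piece i d r : sb_deg i r -> (i <= d)%N -> im (star d (alpha r)).
Proof.
move=> hr; have base : im (star i (alpha r)).
  exists (tpure (1 : D_bimod P) r), 0.
  rewrite (par2R_pure _ hr) (f2R_pure _ hr) scale1r mul1r scaler0 subr0.
  by rewrite raddf0 add0r.
elim: d => [|d IHd]; first by rewrite leqn0 => /eqP <-.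
rewrite leq_eqVlt => /orP[/eqP <- //|]; rewrite ltnS => hid.
have hle : tle V d (alpha r) by apply: tle_le hid _; exact: (alpha_filt hr).1.
rewrite star_mulX // -commr_polyX; apply: imX; last exact: IHd.
rewrite coef_star leq0n subn0; have [->|nid] := eqVneq d i.
  by rewrite (alpha_filt hr).2; exact: IA_eps0 (sb_IA R_gen _).
have hlt : (i < d)%N by rewrite ltn_neqAle eq_sym nid.
by rewrite ((tle_tproj _ _).1 (alpha_filt hr).1 _ hlt) raddf0.
Qed.

Let im_alpha d r : tle V d (val r) -> im (star d (alpha r)).
Proof.
move=> hr; have -> : star d (alpha r) =
    \sum_(i < d.+1) star d (alpha (sb_proj R_graded i r)).
  rewrite -(raddf_sum (@star S A d)) -(raddf_sum alpha); congr (star d (alpha _)).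
  by apply: val_inj; rewrite raddf_sum; exact: tle_sum.
apply: closed_sum; [exact: im0 | exact: imB |] => i _.
by apply: (im_piece (@sb_proj_deg S A R R_graded i r)); rewrite -ltnS.
Qed.

Let Pstar_eps0 (q : {poly T}) : ideal_gen (Pstar P) q -> eps0 (q`_0 : T) = 0.
Proof. by move=> /(Pstar_coef0 P_gen)/IA_eps0. Qed.

(** The scalar on the right is carried along because, as over A, right multiplication acts on the
    derivative only through the augmentation. *)
Let im_ideal (q : {poly T}) : ideal_gen (Pstar P) q ->
  forall s, im (q * (tring_eta V s)%:P).
Proof.
elim=> {q} [_ [d [a [[r _ <-] ha _ ->]]] s||x y _ hx _ hy s|
    q' q hq IH s|q' q hq IH s].
- have e0 : star 0 (tring_eta V s : T) = (tring_eta V s)%:P.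
    by rewrite (star_mono (tdeg_eta V s)) // mulr1.
  have hs : tle V d (alpha r * tring_eta V s).
    by rewrite -[d]addn0; apply: tleM => //; exact/tdeg_tle/tdeg_eta.
  rewrite -e0 -starM //; last exact/tdeg_tle/tdeg_eta.
  rewrite addn0 -alphaM; apply: im_alpha; apply: alpha_le_inv.
  by rewrite alphaM.
- by move=> s; rewrite mul0r; exact: im0.
- by rewrite mulrBl; exact: imB.
- have [u [w [h h']]] := IH s; rewrite -mulrA.
  set qs := q * (tring_eta V s)%:P in h h' *.
  have qs0 : eps0 (qs`_0 : T) = 0 by apply/Pstar_eps0/ideal_genMr.
  pose dl := drop_poly 1 (epsz qs).
  have edl : epsz dl = dl.
    by apply/polyP => i; rewrite coef_epsz coef_drop_poly coef_epsz eps0_eta.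
  (* In the product rule the term tau(q' eps(qs)) equals z tau(q' dl), because eps(qs) = dl z; it
     goes into the component multiplied by z. *)
  exists (cls q' *: u), (cls q' *: w - tauP (q' * dl)).
  split.
    rewrite par2R_scale tauzM (epsz_drop qs0) mulrA tauzX h !scalerBr.
    by rewrite opprB addrA addrAC !scalerA DzC.
  rewrite f2R_scale (e1_mul _ _ qs0).
  rewrite par1_sigmaB par1_scale par1_tauz addrAC -mulrDr -h'.
  rewrite !rmorphM /= edl -[cls dl]/(e1P qs).
  by rewrite opprB addrC subrK.
(* As q = 0 in D, tau(q q') = tau(q eps(q')); the factor eps(q') lies in S[z] and is built from
   right scalars and powers of z. *)
- have step w : im (q * epsz w).
    elim/poly_ind: w => [|w c IHw]; first by rewrite raddf0 mulr0; exact: im0.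
    rewrite epszXC mulrDr mulrA; apply: imD; last exact: IH.
    by apply: imX IHw; apply/Pstar_eps0/ideal_genMr.
  rewrite -mulrA; set w := q' * _; have [u [v [h h']]] := step w.
  exists u, v; rewrite tauzM; have /rquot_eq0 -> := hq.
  rewrite scale0r add0r; split=> //; rewrite -h' /e1; congr (cls (drop_poly 1 _)).
  by rewrite (epszM q w) (epszM q (epsz w)) epsz_idem.
Qed.

(** A cycle (x, y) lifts to an element of <P^*> whose derivative, corrected by that of a lift of y,
    is x; [im_ideal] then exhibits the cycle as a boundary. *)
Lemma range_H1 : H1_exact (sigmaD P) par2R f2R.
Proof.
move=> x y; elim/rquot_ind: y => q' e.
have [q [etau [ecls e0]]] : exists q : {poly T},
    tauP q = x /\ cls q = par1 (sigmaD P) x /\ epsz q = 0.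
  elim/tensor_ind: x {e} => [|x y [q [h1 [h2 h3]]] [q2 [k1 [k2 k3]]]|d a].
  - by exists 0; rewrite !raddf0.
  - have eb : cls (q - q2) = cls q - cls q2 by rewrite raddfB.
    have ez : epsz (q - q2) = epsz q - epsz q2 by rewrite raddfB.
    exists (q - q2); rewrite tauzB eb ez par1_sigmaB.
    by rewrite h1 h2 h3 k1 k2 k3 subrr.
  - elim/rquot_ind: d => q; exists (q * (vin (a : V))%:P).
    have ev : epsz (vin (a : V))%:P = 0 by rewrite epszC eps0_vin !raddf0.
    split; last by rewrite epszM ev mulr0 par1D_pure rmorphM.
    rewrite tauzM ev mulr0 raddf0 addr0 tauzC -[vin _]mul1r tauD_vin.
    rewrite -tpureZ; congr tpure.
    by rewrite -[LHS]/(cls q * cls 1%:P) -rmorphM polyC1 mulr1.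
(* The cycle condition partial_1 x + z y = 0 is the vanishing of q + q' z in D. *)
have hq : ideal_gen (Pstar P) (q + q' * 'X).
  have eX : cls (q + q' * 'X) = cls q + cls q' * z by rewrite rmorphD rmorphM.
  by apply/rquot_eq0; rewrite eX ecls -DzC.
have e1E : (q + q' * 'X) * (tring_eta V 1)%:P = q + q' * 'X.
  by rewrite !rmorph1 mulr1.
have [u [w]] := im_ideal hq 1; rewrite e1E => -[h h'].
exists u, (w + tauP q').
rewrite tauzD tauzX etau in h.
rewrite e1D e1_mulX in h'.
have e1q : e1P q = 0 by rewrite /e1 e0 !raddf0.
rewrite e1q add0r in h'; split.
  by rewrite scalerDr opprD addrA -h addrK.
by rewrite par1_sigmaD par1_tauz addrAC -h' addrC subrK.
Qed.

Variable F : gresolution A.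
Hypotheses (R_proj : projective (sb_mod R)) (R_rel : relation_bimod R).

Lemma pbw_range_iff : pbw_deformation P R <-> jacobi_upto P (hcomplexity F).
Proof.
rewrite (pbw_leading R_sub_RP R_gen) (leading_RP R_sub_RP).
split=> [[_ hJ]|hJ]; first by right=> n _ _; exact: hJ.
split; first exact: RP_range_gen.
have [p pE] := central_projection P_gen.
apply/Dz_regular_jacobi.
apply: (H1_regular A_strong A1_proj P_gen (pE := pE) (sigma := sigmaD P) _
  (gV := @sb_deg S A R) (d2 := d2R R) (par2 := par2R) (f2 := f2R)).
- by move=> a; exact: (Ddeg_clsC P (tdeg_vin (a : V))).
- exact: par2R_deg.
- exact: pi_par2R.
- exact: f2R_deg.
- exact: par1_par2R.
- exact: range_H1.
move=> x /(d2R_ker_graded R_graded)[f [hf df [N ->]]].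
apply: zspan_sum => i _.
(* Above the complexity [tor_gen] puts the syzygy into A_+ times syzygies. Otherwise (J_{i-1}) is
   available for i >= 2, and below degree 2 there are no relations. *)
have [hi|hi] := pselect ((i%:Z - 1)%:E <= hcomplexity F)%E; last first.
  have := tor_gen A_strong A1_proj R_graded R_gen R_proj R_rel (hf i) (df i) hi.
  apply: zspan_min; [exact: zspan0 | exact: zspanB |].
  move=> _ [a [x' [-> hx' ha]]]; apply: zspan_gen.
  by exists a, x'; split=> //; left.
have [i2|i2] := ltnP i 2.
  by rewrite (AV_sb_low R_graded R_gen i2 (hf i)); exact: zspan0.
apply: zspan_gen; exists 1, (f i); rewrite scale1r; split=> //.
right; exists (i - 2)%N; last by rewrite -addn2 subnK //; exact: hf.
by apply: (jacobi_uptoP hJ); rewrite -addn2 subnK.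
Qed.

End FilteredMap.

(* In (1), K assigns choices for 1M_* to a proof that the ideals coincide:    *)
(* the projection D -> A, hence 1M_*, is only available in that case.         *)
Theorem theorem5p4 (S : nzRingType) (A : connected_sring S)
  (A_strong : strongly_graded A)
  (A_rel : exists R0 : subbimod A, relation_bimod R0 /\ projective (sb_mod R0))
  (R : subbimod A) (R_graded : graded_sub R) (R_gen : ideal_gen R = @IA S A)
  (A1_proj : projective (A1 A)) (R_proj : projective (sb_mod R))
  (F : gresolution A) :
  (forall (P : subbimod A), R `<=` RP P ->
   forall (Q : vresolution A (hcomplexity F))
     (K : ideal_gen R = ideal_gen (RP P) -> central_data Q P),
     pbw_deformation P R <->
     exists e : ideal_gen R = ideal_gen (RP P),
       (forall h : H1M (K e), h = 0) /\ jacobi_upto P (hcomplexity F)) /\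
  (forall alpha : {linear sb_mod R -> tring (A1_bimod A)},
     (forall r s, alpha (sb_mod_ract r s) =
                  alpha r * tring_eta (A1_bimod A) s) ->
     (forall n r, tdeg (A1_bimod A) n (sbval r) ->
        tle (A1_bimod A) n (alpha r) /\ tproj n (alpha r) = sbval r) ->
     relation_bimod R ->
     (pbw_deformation (range alpha) R <->
      jacobi_upto (range alpha) (hcomplexity F))).
Proof.
split=> [P hR Q K|alpha alphaM alphaF R_rel].
  exact: (pbw_iff_H1M A_strong A1_proj R_gen hR K).
exact: (pbw_range_iff A_strong A1_proj R_graded R_gen alphaM alphaF F R_proj
  R_rel).
Qed.
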